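(* Let $r\geq 3$ be a fixed integer. If $n\in\mathbb{N}$ is sufficiently large (depending on $r$) and divisible by $12r$, then \[T_{2r}(n)=\binom{r}{3}\left(\frac{n}{r}\right)^3+\frac{(r-1)n^2}{r}+\frac{n}{3}.\]
   Context: $T_d(n)$ denotes the maximum number of equilateral triangles (of any side lengths) determined by a set of $n$ points in $\mathbb{R}^d$, i.e. the maximum number of $3$-element subsets with all pairwise distances equal. *)

(* Defs.v *)
From HB Require Import structures.
From mathcomp Require Import all_boot all_order all_algebra.
From mathcomp Require Import finmap.
From mathcomp Require Import boolp reals.

Set Implicit Arguments.
Unset Strict Implicit.
Unset Printing Implicit Defensive.

Import Order.TTheory GRing.Theory Num.Theory.
Local Open Scope ring_scope.

(* The library norm on 'rV[R]_d is the sup norm, hence this definition. *)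
Definition edist (R : realType) (d : nat) (x y : 'rV[R]_d) : R :=
  Num.sqrt (\sum_(i < d) (x 0 i - y 0 i) ^+ 2).

Definition equidistant (R : realType) (d : nat) (P : {fset 'rV[R]_d})
    (S : {set P}) : bool :=
  [forall x in S, forall y in S, forall z in S, forall t in S,
    (x != y) && (z != t) ==>
    (edist (val x) (val y) == edist (val z) (val t))].

Definition equilateral_triangles (R : realType) (d : nat)
    (P : {fset 'rV[R]_d}) : {set {set P}} :=
  [set S : {set P} | (#|S| == 3)%N && equidistant S].

(* The maximum of #|equilateral_triangles P| over n-point sets P; the range
   'C(n, 3).+1 of the bounded maximum loses nothing, see T_ge and T_attained. *)
Definition T (R : realType) (d n : nat) : nat :=
  \max_(m < 'C(n, 3).+1 |
    `[< exists P : {fset 'rV[R]_d},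
          #|` P| = n /\ #|equilateral_triangles P| = m >]) m.

Lemma triangles_lt (R : realType) (d n : nat) (P : {fset 'rV[R]_d}) :
  #|` P| = n -> (#|equilateral_triangles P| < 'C(n, 3).+1)%N.
Proof.
move=> <-; rewrite ltnS cardfE -(card_draws P 3).
by apply/subset_leq_card/subsetP => S; rewrite !inE => /andP[].
Qed.

Lemma T_ge (R : realType) (d n : nat) (P : {fset 'rV[R]_d}) :
  #|` P| = n -> (#|equilateral_triangles P| <= T R d n)%N.
Proof.
move=> Pn.
have le_bin := triangles_lt Pn.
rewrite /T -[leqLHS]/(nat_of_ord (Ordinal le_bin)).
by apply: (@leq_bigmax_cond _ _ (@nat_of_ord _)); apply/asboolP; exists P.
Qed.

Lemma T_attained (R : realType) (d n : nat) : (0 < d)%N ->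
  exists P : {fset 'rV[R]_d},
    #|` P| = n /\ #|equilateral_triangles P| = T R d n.
Proof.
case: d => // d _.
pose f (i : nat) : 'rV[R]_d.+1 := const_mx i%:R.
have f_inj : injective f.
  move=> i j /rowP/(_ 0); rewrite !mxE => /eqP.
  by rewrite eqr_nat => /eqP.
pose P0 : {fset 'rV[R]_d.+1} := [fset x in [seq f i | i <- iota 0 n]]%fset.
have P0n : #|` P0| = n.
  by rewrite card_fseq undup_id ?size_map ?size_iota // map_inj_uniq ?iota_uniq.
have le_bin := triangles_lt P0n.
have P0T : `[< exists P : {fset 'rV[R]_d.+1},
    #|` P| = n /\ #|equilateral_triangles P| = Ordinal le_bin >].
  by apply/asboolP; exists P0.
rewrite /T (bigop.bigmax_eq_arg (Ordinal le_bin)) //.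
by case: arg_maxnP => // m /asboolP[P [Pn Pm]] _; exists P.
Qed.

(* Main.v *)
Require Import Defs.
From mathcomp Require Import all_boot all_order all_algebra.
From mathcomp Require Import reals.
From mathcomp Require Import finmap boolp.
From mathcomp Require Import ring lra zify.

(** The lower bound comes from the Lenz configuration. Put n / r points on
    each of r circles of radius 1 about a common center in mutually
    orthogonal planes, the points of a circle forming regular 12-gons.
    Points on distinct circles, and points a quarter turn apart on one
    circle, are at distance sqrt 2. The three terms of the formula count the
    triangles with vertices on three, two and one circles (tdeg_lenz).

    For the upper bound, let tdeg x be the number of ordered pairs (y, z)
    for which xyz is equilateral, so that the sum of tdeg is six times the
    number of triangles. Removing a point of small degree lowers this sum by
    less than the claimed bound drops; since the surplus cannot grow
    forever, it is enough to treat point sets in which every degree is at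
    least (1 - 1/r) (1 - 2/r) n^2 - 2 n (ordered_upper, dense_tdeg_bound).

    The geometric input concerns homogeneous blocks: sets of at least three
    points such that the distance between points of two different sets
    depends on the two sets only. They span mutually orthogonal planes, so
    dimension 2 r has room for r blocks only (blocks_dim), and r blocks at
    one mutual distance lie on r circles as in the lower bound (lenz_frame).

    Blocks are found as follows. A pair is rich if it lies in a positive
    proportion of equilateral triangles. By supersaturation and the box
    theorem of Erdos, too many rich pairs would produce r + 1 homogeneous
    blocks: fixing a common apex z makes d(x, y) = d(x, z) = d(y, z)
    constant (few_rich_pairs). Sets with a single distance satisfy the
    Moon-Moser inequality from three points on; starting it with the rich pairs
    in place of all pairs gives a positive proportion of equidistant r-point
    sets, and a box of those consists of r blocks at one distance
    (find_unit_blocks).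

    Given the blocks, count the triangles with a vertex in the blocks by
    their opposite pairs. A pair seen by a block is an edge of a graph
    without r + 1 homogeneous blocks, so it has at most (1 - 1/r + o(1)) n^2
    ordered edges, and almost all pairs are seen by at most r - 2 blocks.
    Large degrees thus force almost (1 - 1/r) n^2 pairs to be seen by r - 2
    blocks, hence by Goodman almost (1 - 1/r) (1 - 2/r) n^3 triangles of
    such pairs. A point off the circles has a sparse link in this graph
    (link_free), whereas the points on the circles account for no more
    triangles than their number allows (maclaurin3); so almost all points
    lie on the circles (near_structure).

    Finally the circles are nearly balanced, and a point off the circles
    sees at most r - 2 circles at the right distance, so its degree is too
    small: no such point exists (all_on_circles).

    For points on the circles the degrees have a sharp bound, because a
    circle contains at most two points at a given distance from a given
    point, unless it is equidistant from it as a whole (tdeg_circle,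
    count_on_circles). *)

Set Implicit Arguments.
Unset Strict Implicit.
Unset Printing Implicit Defensive.

Import Order.TTheory GRing.Theory Num.Theory.
Local Open Scope ring_scope.

(** * Families of finite sets: the Moon-Moser inequality *)

Lemma mem_fun (T : Type) (P : pred T) x : (x \in (fun y => P y)) = P x.
Proof. by []. Qed.

Lemma card_sum (T : finType) (P : pred T) : (#|[set x | P x]| = \sum_x P x)%N.
Proof. by rewrite cardsE -sum1_card big_mkcond. Qed.

Section MoonMoser.
Variables (V : finType) (F : pred {set V}).
Local Open Scope nat_scope.

Definition nsets (s : nat) := #|[set A : {set V} | (#|A| == s) && F A]|.
Definition extn (C : {set V}) := #|[set v | (v \notin C) && F (v |: C)]|.

Lemma setU1K_eq (a : V) (C : {set V}) : ((a |: C) :\ a == C) = (a \notin C).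
Proof.
apply/eqP/idP => [<-|]; first by rewrite !inE eqxx.
exact: setU1K.
Qed.

Lemma sum_extn (s : nat) (g : {set V} -> nat) :
  \sum_(C : {set V} | #|C| == s) g C * extn C =
  \sum_(A : {set V} | (#|A| == s.+1) && F A) \sum_(a in A) g (A :\ a).
Proof.
under eq_bigr do rewrite /extn cardsE -sum1_card big_distrr /= big_mkcond /=.
rewrite exchange_big /= [RHS](exchange_big_dep predT) //=; apply: eq_bigr => a _.
rewrite [RHS](reindex_onto (fun C => a |: C) (fun A => A :\ a)) /=; last first.
  by move=> A /andP[_ aA]; rewrite setD1K.
rewrite big_mkcond /= [RHS]big_mkcond; apply: eq_bigr => C _.
rewrite setU1K_eq setU11 andbT mem_fun /=.
case aC: (a \in C) => /=; first by rewrite andbF if_same.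
rewrite andbT cardsU1 aC add1n eqSS.
by case: (#|C| == s) => //=; rewrite muln1 setU1K ?aC.
Qed.

Lemma sum_extn1 (s : nat) :
  \sum_(C : {set V} | #|C| == s) extn C = s.+1 * nsets s.+1.
Proof.
have /= := sum_extn s (fun=> 1).
under eq_bigr do rewrite mul1n.
move=> ->; rewrite mulnC /nsets cardsE -sum_nat_const.
by apply: eq_bigr => A /andP[/eqP cA _]; rewrite sum1_card.
Qed.

(** The closure property behind the Moon-Moser inequality, with the sets A minus
    a as facets of A: a vertex that extends two facets of a member extends the
    member. Cliques have it, and so do sets with a single distance, from three
    points on. *)
Definition glues (s : nat) := forall (A : {set V}) v a b, #|A| = s.+1 -> F A ->
  v \notin A -> a \in A -> b \in A -> a != b ->
  F (v |: (A :\ a)) -> F (v |: (A :\ b)) -> F (v |: A).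

(** Count pairs of a member A and a facet C of A, weighted by the number of
    extensions of C. A vertex outside A extends all facets of A if it extends A,
    and at most one of them otherwise. *)
Lemma moon_moser (s : nat) : glues s ->
  \sum_(C : {set V} | #|C| == s) extn C ^ 2 <=
    #|V| * nsets s.+1 + s * s.+2 * nsets s.+2.
Proof.
move=> Fext.
under eq_bigr do rewrite expnS expn1.
rewrite sum_extn.
apply: (@leq_trans (\sum_(A : {set V} | (#|A| == s.+1) && F A)
                       (#|V| + s * extn A))); last first.
  rewrite big_split /= sum_nat_const -big_distrr /= mulnC /nsets cardsE leq_add2l.
  rewrite -mulnA leq_mul2l; apply/orP; right.
  rewrite -[_.+2 * _]sum_extn1 big_mkcondr /=.
  by apply: leq_sum => A _; case: ifP.
apply: leq_sum => A /andP[/eqP cA FA].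
under eq_bigr do rewrite /extn cardsE -sum1_card big_mkcond /=.
rewrite exchange_big /= /extn cardsE -[#|V|]sum1_card -[#|[pred _ | _]|]sum1_card.
rewrite [X in _ + s * X]big_mkcond big_distrr /= -big_split /=; apply: leq_sum => v _.
rewrite -big_mkcondr /= sum1_card [v \in _]mem_fun.
case: ifP => [|/negbT]; first by rewrite muln1 add1n -cA => _; apply: subset_leq_card;
  apply/subsetP => x; rewrite [x \in _]mem_fun => /andP[].
rewrite negb_and negbK => vF; rewrite muln0 addn0.
rewrite leqNgt; apply/negP => /card_gt1P[a [b []]].
move=> /andP[aA /andP[va Fa]] /andP[bA /andP[vb Fb]] ab; rewrite !inE in va vb.
case vA: (v \in A) vF va vb => /=.
  rewrite !andbT !negbK => _ /eqP va /eqP vb.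
  by rewrite -va -vb eqxx in ab.
move=> /negP vF _ _; apply: vF; apply: Fext ab Fa Fb => //; by rewrite vA.
Qed.

Local Open Scope ring_scope.

(** Linearized by (e - lam)^2 >= 0. The sum on the left may be restricted to a
    family G of s-sets; this is used with the rich pairs. *)
Lemma moon_moser_lin (s : nat) (lam : rat) (G : pred {set V}) : glues s ->
  2 * lam * (\sum_(C : {set V} | (#|C| == s) && G C) extn C)%N%:R
    - lam ^+ 2 * #|[set C : {set V} | (#|C| == s) && G C]|%:R
  <= #|V|%:R * (nsets s.+1)%:R + s%:R * s.+2%:R * (nsets s.+2)%:R.
Proof.
move=> gl; rewrite -!natrM -natrD.
have := moon_moser gl; rewrite -(ler_nat rat); apply: le_trans.
rewrite cardsE -sum1_card !natr_sum !big_distrr /= -sumrB.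
apply: le_trans (_ : \sum_(C : {set V} | (#|C| == s) && G C)
   ((extn C) ^ 2)%N%:R <= _).
  apply: ler_sum => C _; rewrite natrX mulr1.
  have := sqr_ge0 ((extn C)%:R - lam); set e := (extn C)%:R; nra.
rewrite big_mkcondr /=; apply: ler_sum => C _; case: ifP => // _; exact: ler0n.
Qed.

(** In terms of ratios of consecutive levels: if level s + 1 holds at least (1 -
    s u) m / (s + 1) times as many sets as level s, then the same u serves one
    level up. *)
Lemma nsets_step (s : nat) (u : rat) : (0 < s)%N -> glues s ->
  (forall (C : {set V}) v, #|C| = s -> v \notin C -> F (v |: C) -> F C) ->
  0 <= 1 - s%:R * u ->
  (1 - s%:R * u) * #|V|%:R * (nsets s)%:R <= s.+1%:R * (nsets s.+1)%:R ->
  (1 - s.+1%:R * u) * #|V|%:R * (nsets s.+1)%:R <= s.+2%:R * (nsets s.+2)%:R.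
Proof.
move=> s0 gl Fdown u1 base.
have := moon_moser_lin ((1 - s%:R * u) * #|V|%:R) F gl.
have -> : (\sum_(C : {set V} | (#|C| == s) && F C) extn C =
          s.+1 * nsets s.+1)%N.
  rewrite -sum_extn1 [RHS](bigID F) /= [X in (_ + X)%N]big1 ?addn0 // => C.
  case/andP=> /eqP cC nFC; rewrite /extn; apply/eqP; rewrite cards_eq0.
  apply/eqP/setP => v; rewrite !inE; apply/negP => /andP[vC FvC].
  by case/negP: nFC; apply: Fdown FvC.
rewrite -/(nsets s) natrM.
set k0 := (nsets s)%:R in base *; set k1 := (nsets s.+1)%:R in base *.
set k2 := (nsets s.+2)%:R; set m := #|V|%:R in base *.
rewrite -[s.+2]addn2 -[s.+1]addn1 !natrD in base *.
have s1 : 1 <= s%:R :> rat by rewrite (ler_nat _ 1).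
set t := s%:R in base s1 u1 *.
have m0 : 0 <= m by exact: ler0n.
set lam := (1 - t * u) * m in base *.
have lam0 : 0 <= lam by rewrite mulr_ge0.
move: (ler_wpM2l lam0 base) => base' H.
have {}H : lam * (t + 1) * k1 <= m * k1 + t * (t + 2) * k2 by nra.
rewrite -(ler_pM2l (_ : 0 < t)); last by lra.
rewrite /lam in H; nra.
Qed.

(** The ratios stay bounded below by kap / (S + 1) as long as 1 - S u >= kap. *)
Lemma nsets_chain (s0 S : nat) (u kap : rat) : (0 < s0)%N ->
  (forall s, (s0 <= s)%N -> glues s) ->
  (forall (C : {set V}) v, F (v |: C) -> F C) ->
  0 <= u -> kap <= 1 - S%:R * u -> 0 <= kap ->
  (1 - s0%:R * u) * #|V|%:R * (nsets s0)%:R <= s0.+1%:R * (nsets s0.+1)%:R ->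
  forall j, (s0 + j <= S.+1)%N ->
  (kap / S.+1%:R * #|V|%:R) ^+ j * (nsets s0)%:R <= (nsets (s0 + j))%:R.
Proof.
move=> s00 gl Fdown u0 kapP kap0 base.
have S0 : 0 < S.+1%:R :> rat by rewrite ltr0n.
have usub s : (s <= S)%N -> kap <= 1 - s%:R * u.
  move=> sS; apply: le_trans kapP _; rewrite lerD2l lerN2.
  by apply: ler_wpM2r => //; rewrite ler_nat.
have ratio j : (s0 + j <= S)%N -> (1 - (s0 + j)%:R * u) * #|V|%:R *
    (nsets (s0 + j))%:R <= (s0 + j).+1%:R * (nsets (s0 + j).+1)%:R.
  elim: j => [|j IH]; first by rewrite addn0.
  rewrite addnS => jS; apply: nsets_step; rewrite ?addn_gt0 ?s00 //.
  - by apply: gl; rewrite leq_addr.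
  - by move=> C v _ _ /Fdown.
  - by apply: le_trans kap0 _; apply: usub; apply: ltnW.
  - by apply: IH; apply: ltnW.
elim=> [|j IH] jS; first by rewrite expr0 mul1r addn0.
have jS' : (s0 + j <= S)%N by rewrite addnS in jS.
have {IH} := IH (leqW jS'); rewrite addnS exprS.
set x := kap / _ * _; rewrite -[x * _ * _]mulrA; set k := (nsets (s0 + j))%:R.
have x0 : 0 <= x by rewrite !mulr_ge0 // ?invr_ge0 ltW.
move=> /(ler_wpM2l x0); move/le_trans; apply.
have {ratio} := ratio _ jS'; rewrite -/k; set k' := (nsets _)%:R => rt.
rewrite -(ler_pM2l S0).
have -> : S.+1%:R * (x * k) = kap * #|V|%:R * k.
  by rewrite /x; field; lra.
apply: le_trans (_ : (s0 + j).+1%:R * k' <= _); last first.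
  by apply: ler_wpM2r; rewrite ?ler0n // ler_nat.
apply: le_trans rt; rewrite -!mulrA; apply: ler_wpM2r; last exact: usub.
by rewrite mulr_ge0 ?ler0n.
Qed.
End MoonMoser.

(** * Supersaturation for cliques *)

Section OrderedCounts.
Variable V : finType.
Local Open Scope nat_scope.

(** Every set of s + 1 points arises from s + 1 sets of s points; iterating
    turns sums over sets into sums over ordered tuples. *)
Lemma sum_cardS (s : nat) (g : {set V} -> nat) :
  s.+1 * (\sum_(A : {set V} | #|A| == s.+1) g A) =
  \sum_(C : {set V} | #|C| == s) \sum_(v | v \notin C) g (v |: C).
Proof.
transitivity (\sum_(A : {set V} | #|A| == s.+1) \sum_(a in A) g A).
  rewrite big_distrr /=; apply: eq_bigr => A /eqP cA.
  by rewrite sum_nat_const cA.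
rewrite (exchange_big_dep predT) //= [RHS](exchange_big_dep predT) //=.
apply: eq_bigr => a _.
rewrite (reindex_onto (fun C => a |: C) (fun A => A :\ a)) /=; last first.
  by move=> A /andP[_ aA]; rewrite setD1K.
apply: eq_bigl => C; rewrite setU1K_eq setU11 andbT.
by case aC: (a \in C); rewrite /= ?andbF // cardsU1 aC add1n eqSS.
Qed.

Lemma sum_card1 (g : {set V} -> nat) :
  \sum_(A : {set V} | #|A| == 1) g A = \sum_x g [set x].
Proof.
have := sum_cardS 0 g; rewrite mul1n => ->.
rewrite (big_pred1 set0) => [|A]; last by rewrite cards_eq0.
by apply: eq_big => [x|x _]; rewrite ?inE // setU0.
Qed.

Lemma sum_card2 (g : {set V} -> nat) :
  2 * (\sum_(A : {set V} | #|A| == 2) g A) =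
  \sum_x \sum_(y | x != y) g [set x; y].
Proof.
rewrite sum_cardS sum_card1; apply: eq_bigr => x _.
apply: eq_big => [y|y _]; first by rewrite !inE eq_sym.
by rewrite setUC.
Qed.

Lemma sum_card3 (g : {set V} -> nat) :
  6 * (\sum_(A : {set V} | #|A| == 3) g A) =
  \sum_x \sum_(y | x != y) \sum_(z | (x != z) && (y != z)) g [set x; y; z].
Proof.
rewrite -[6]/(2 * 3)%N -mulnA sum_cardS sum_card2.
apply: eq_bigr => x _; apply: eq_bigr => y xy.
apply: eq_big => [z|z _]; first by rewrite !inE negb_or ![z == _]eq_sym.
by rewrite [_ |: _]setUC.
Qed.

Lemma nsets_tuples (F : pred {set V}) s :
  nsets F s <= #|[set t : s.-tuple V | uniq t && F [set x in t]]|.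
Proof.
apply: leq_trans (leq_imset_card (fun t : s.-tuple V => [set x in t]) _).
apply: subset_leq_card; apply/subsetP => A; rewrite inE => /andP[/eqP cA FA].
have szA : size (enum A) == s by rewrite -cardE cA.
apply/imsetP; exists (Tuple szA); last by apply/setP => x; rewrite !inE mem_enum.
rewrite inE enum_uniq /=.
by have -> : [set x in enum A] = A by apply/setP => x; rewrite !inE mem_enum.
Qed.

Definition clique (e : rel V) (A : {set V}) :=
  [forall x in A, forall y in A, (x != y) ==> e x y].

Lemma cliqueP (e : rel V) (A : {set V}) :
  reflect {in A &, forall x y, x != y -> e x y} (clique e A).
Proof.
apply: (iffP forallP) => [H x y xA yA xy|H x].
  have /implyP/(_ xA)/forallP/(_ y)/implyP/(_ yA) := H x.
  by move=> /implyP/(_ xy).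
by apply/implyP => xA; apply/forallP => y; apply/implyP => yA; apply/implyP; exact: H.
Qed.

Lemma clique_down (e : rel V) (C : {set V}) v : clique e (v |: C) -> clique e C.
Proof.
by move=> /cliqueP H; apply/cliqueP => x y xC yC; apply: H; rewrite !inE ?xC ?yC orbT.
Qed.

Lemma clique_glues (e : rel V) s : symmetric e -> glues (clique e) s.
Proof.
move=> esym A v a b cA /cliqueP FA vA aA bA ab /cliqueP Fa /cliqueP Fb.
have ev x : x \in A -> e v x.
  move=> xA; have vx : v != x by apply: contraNneq vA => ->.
  have [xa|xa] := eqVneq x a.
    by apply: Fb; rewrite // !inE ?eqxx // xA xa ab orbT.
  by apply: Fa; rewrite // !inE ?eqxx // xA xa orbT.
apply/cliqueP => x y; rewrite !inE => /orP[/eqP->|xA] /orP[/eqP->|yA] xy.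
- by rewrite eqxx in xy.
- exact: ev.
- by rewrite esym; exact: ev.
- exact: FA.
Qed.

Lemma clique2 (e : rel V) x y : symmetric e -> x != y -> clique e [set x; y] = e x y.
Proof.
move=> esym xy; apply/cliqueP/idP => [H|exy u v]; first by apply: H; rewrite ?inE ?eqxx ?orbT.
rewrite !inE => /orP[]/eqP-> /orP[]/eqP->; rewrite ?eqxx // => _; by rewrite ?exy // esym.
Qed.

Lemma clique3 (e : rel V) x y z : symmetric e -> x != y -> x != z -> y != z ->
  clique e [set x; y; z] = [&& e x y, e x z & e y z].
Proof.
move=> esym xy xz yz; apply/cliqueP/and3P => [H|[exy exz eyz] u v].
  by split; apply: H; rewrite ?inE ?eqxx ?orbT.
rewrite !inE => /orP[/orP[]|]/eqP-> /orP[/orP[]|]/eqP->; rewrite ?eqxx // => _;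
  by rewrite ?exy ?exz ?eyz // esym.
Qed.

Definition edges (e : rel V) := \sum_x \sum_y ((x != y) && e x y).

Lemma nsets_sum (F : pred {set V}) s :
  nsets F s = \sum_(A : {set V} | #|A| == s) F A.
Proof. by rewrite /nsets cardsE -sum1_card big_mkcondr. Qed.

Lemma edgesE (e : rel V) : symmetric e -> 2 * nsets (clique e) 2 = edges e.
Proof.
move=> esym; rewrite nsets_sum sum_card2; apply: eq_bigr => x _.
rewrite big_mkcond; apply: eq_bigr => y _; case: ifP => //= xy.
by rewrite clique2.
Qed.

Lemma nsets1 (F : pred {set V}) : (forall x, F [set x]) -> nsets F 1 = #|V|.
Proof.
by move=> F1; rewrite nsets_sum sum_card1 -sum1_card; apply: eq_bigr => x _; rewrite F1.
Qed.

Lemma clique1 (e : rel V) x : clique e [set x].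
Proof. by apply/cliqueP => u v; rewrite !inE => /eqP-> /eqP->; rewrite eqxx. Qed.

End OrderedCounts.

(** Density 1 - 1/s + eps means u = 1/s - eps in the ratios above, which stay
    positive up to cliques of s + 1 points. *)
Lemma supersaturation (s : nat) (eps : rat) : (0 < s)%N -> 0 < eps ->
  exists2 c : rat, 0 < c & forall (V : finType) (e : rel V), symmetric e ->
    (1 - s%:R^-1 + eps) * #|V|%:R ^+ 2 <= (edges e)%:R ->
    c * #|V|%:R ^+ s.+1 <=
      #|[set t : s.+1.-tuple V | uniq t && clique e [set x in t]]|%:R.
Proof.
move=> s0 e0; have sR : 0 < s%:R :> rat by rewrite ltr0n.
wlog eps1 : eps e0 / eps <= s%:R^-1.
  move=> H; have [|lt1] := lerP eps s%:R^-1; first exact: H.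
  have /= [|//|c c0 cP] := H s%:R^-1; rewrite ?invr_gt0 //.
  exists c => // V e es He; apply: cP => //; apply: le_trans He.
  by apply: ler_wpM2r; rewrite ?sqr_ge0 //; lra.
pose kap := s%:R * eps.
exists ((kap / s.+1%:R) ^+ s).
  by rewrite exprn_gt0 // divr_gt0 ?ltr0n // mulr_gt0.
move=> V e es He.
apply: le_trans (_ : (nsets (clique e) s.+1)%:R <= _); last first.
  by rewrite ler_nat nsets_tuples.
have := @nsets_chain V (clique e) 1 s (s%:R^-1 - eps) kap isT.
have k1 := nsets1 (clique1 e); have k2 := edgesE es.
move=> /(_ (fun j _ => @clique_glues _ e j es) (@clique_down _ e)).
rewrite k1 subr_ge0 eps1 => /(_ isT) H.
have {H} := H _ _ _ s; rewrite add1n.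
set m := #|V|%:R in He *; rewrite exprMn [m ^+ s.+1]exprSr mulrA; apply => //.
- by rewrite /kap mulrBr divff ?lt0r_neq0 //; lra.
- by rewrite mulr_ge0 // ltW.
- by rewrite -natrM k2; apply: le_trans He; rewrite mul1r; lra.
Qed.

(** * Boxes in dense relations *)

Lemma rat_bound (x : rat) : exists n : nat, x <= n%:R.
Proof.
exists (Num.bound `|x|); apply: le_trans (ler_norm x) _.
exact: ltW (archi_boundP (normr_ge0 x)).
Qed.

Lemma subset_of_card (T : finType) (A : {set T}) n :
  (n <= #|A|)%N -> exists2 B : {set T}, B \subset A & #|B| = n.
Proof.
move=> nA; exists [set x in take n (enum A)].
  by apply/subsetP => x; rewrite inE => /mem_take; rewrite mem_enum.
rewrite cardsE; have /card_uniqP-> : uniq (take n (enum A)).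
  by rewrite take_uniq // enum_uniq.
by rewrite size_takel // -cardE.
Qed.

(** Fix M points of X of large degree; many y see at least t of them, and there
    are at most 2^M sets of t points to share among these y. *)
Lemma common_block (c : rat) (t : nat) : 0 < c -> exists2 c' : rat, 0 < c' &
  exists N : nat, forall (X Y : finType) (rl : X -> Y -> bool), (N <= #|X|)%N ->
    c * #|X|%:R * #|Y|%:R <= (\sum_x \sum_y rl x y)%N%:R ->
    exists2 A : {set X}, #|A| = t &
      c' * #|Y|%:R <= #|[set y | [forall x in A, rl x y]]|%:R.
Proof.
move=> c0; have [M MP] := rat_bound ((2 * t%:R + 2) / c).
have {}MP : 2 * t%:R + 2 <= M%:R * c by rewrite -ler_pdivrMr.
have M0 : 0 < M%:R :> rat.
  by rewrite -(pmulr_lgt0 _ c0); apply: lt_le_trans MP; have := ler0n rat t; lra.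
have [N1 N1P] := rat_bound (2 * M%:R / c).
have {}N1P : 2 * M%:R <= N1%:R * c by rewrite -ler_pdivrMr.
have P2 : 0 < (2 ^ M)%N%:R :> rat by rewrite ltr0n expn_gt0.
exists (2 * M%:R * (2 ^ M)%N%:R)^-1; first by rewrite invr_gt0 !mulr_gt0.
exists (N1 + t)%N => X Y rl NX H.
set c' := _^-1.
case: (posnP #|Y|) => [Y0|Y0].
  have [|A _ cA] := @subset_of_card X setT t; first by rewrite cardsT; lia.
  by exists A; rewrite // Y0 mulr0 ler0n.
have {}Y0 : 0 < #|Y|%:R :> rat by rewrite ltr0n.
pose deg x := (\sum_y rl x y)%N.
have degY x : (deg x <= #|Y|)%N.
  by rewrite -sum1_card; apply: leq_sum => y _; case: (rl x y).
pose W' := [set x | c / 2 * #|Y|%:R <= (deg x)%:R].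
have cW' : (M <= #|W'|)%N.
  have : (\sum_x deg x)%N%:R <= #|W'|%:R * #|Y|%:R + #|X|%:R * (c / 2 * #|Y|%:R) :> rat.
    rewrite (bigID (fun x => x \in W')) /= natrD lerD // natr_sum.
      apply: le_trans (ler_sum (G := fun=> #|Y|%:R) _ _) _ => [x _|].
        by rewrite ler_nat.
      by rewrite sumr_const mulr_natl.
    apply: le_trans (ler_sum (G := fun=> c / 2 * #|Y|%:R) _ _) _ => [x|].
      by rewrite inE -ltNge => /ltW.
    rewrite sumr_const -[_ *+ _]mulr_natl; apply: ler_wpM2r; last first.
      by rewrite ler_nat max_card.
    by rewrite mulr_ge0 ?ler0n // divr_ge0 // ltW.
  move=> H2; have {H H2} := le_trans H H2.
  rewrite -(ler_nat rat) => H.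
  have {}H : c / 2 * #|X|%:R <= #|W'|%:R by rewrite -(ler_pM2r Y0); lra.
  have : N1%:R <= #|X|%:R :> rat by rewrite ler_nat; lia.
  by move=> /(ler_wpM2r (ltW c0)); lra.
have [W WW' cW] := subset_of_card cW'.
pose dW y := (\sum_(x in W) rl x y)%N.
pose Y' := [set y | (t <= dW y)%N].
have cY' : #|Y|%:R <= M%:R * #|Y'|%:R :> rat.
  have le1 : M%:R * (c / 2 * #|Y|%:R) <= (\sum_(x in W) deg x)%N%:R.
    rewrite -cW natr_sum mulr_natl -sumr_const; apply: ler_sum => x xW.
    by have := subsetP WW' _ xW; rewrite inE.
  have le2 : (\sum_(x in W) deg x)%N%:R <= M%:R * #|Y'|%:R + t%:R * #|Y|%:R :> rat.
    rewrite -!natrM -natrD ler_nat exchange_big /= (bigID (fun y => y \in Y')) /=.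
    apply: leq_add.
      rewrite mulnC -sum_nat_const; apply: leq_sum => y _.
      by rewrite -cW -sum1_card; apply: leq_sum => x _; case: (rl x y).
    apply: leq_trans (_ : \sum_(y | y \notin Y') t <= _)%N.
      by apply: leq_sum => y; rewrite inE -ltnNge => /ltnW.
    by rewrite sum_nat_const mulnC leq_mul2l max_card orbT.
  have := le_trans le1 le2; nra.
pose cm (A : {set X}) := #|[set y | [forall x in A, rl x y]]|.
case: (pickP (fun A : {set X} => (#|A| == t) && (c' * #|Y|%:R <= (cm A)%:R))).
  by move=> A /andP[/eqP cA HA]; exists A.
move=> none.
have : (#|Y'| <= \sum_(A : {set X} | (A \subset W) && (#|A| == t)) cm A)%N.
  rewrite -[leqLHS]sum1_card.
  under [leqRHS]eq_bigr do rewrite /cm cardsE -sum1_card big_mkcond /=.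
  rewrite exchange_big /= big_mkcond /=; apply: leq_sum => y _.
  case: ifP => // yY'.
  have : (t <= #|[set x in W | rl x y]|)%N.
    move: yY'; rewrite inE => /leq_trans; apply.
    by rewrite /dW cardsE -sum1_card big_mkcondr /=; apply: leq_sum => x _; case: ifP.
  case/subset_of_card => A AW cA.
  have AW' : A \subset W.
    by apply/subsetP => x /(subsetP AW); rewrite inE => /andP[].
  have Ay : [forall x in A, rl x y].
    by apply/forallP => x; apply/implyP => /(subsetP AW); rewrite inE => /andP[].
  by rewrite (bigD1 A) ?AW' ?cA ?eqxx // [y \in _]Ay.
rewrite -(ler_nat rat) natr_sum => HY.
have : \sum_(A : {set X} | (A \subset W) && (#|A| == t)) (cm A)%:R <=
       (2 ^ M)%N%:R * (c' * #|Y|%:R) :> rat.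
  apply: le_trans (ler_sum (G := fun=> c' * #|Y|%:R) _ _) _ => [A /andP[_ cA]|].
    by have := none A; rewrite cA /= => /negbT; rewrite -ltNge => /ltW.
  rewrite sumr_const -[_ *+ _]mulr_natl; apply: ler_wpM2r; last first.
    rewrite ler_nat -cW -card_powerset; apply: subset_leq_card.
    by apply/subsetP => A; rewrite inE mem_fun => /andP[].
  by rewrite mulr_ge0 ?ler0n // invr_ge0 !mulr_ge0 ?ler0n // ltW.
have -> : (2 ^ M)%N%:R * (c' * #|Y|%:R) = #|Y|%:R / (2 * M%:R) :> rat.
  by rewrite /c'; field; rewrite !lt0r_neq0.
move=> /(le_trans HY); rewrite ler_pdivlMr ?mulr_gt0 //; nra.
Qed.

Lemma sum_tupleS (V : finType) s (f : s.+1.-tuple V -> nat) :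
  (\sum_t f t = \sum_x \sum_(g : s.-tuple V) f [tuple of x :: g])%N.
Proof.
rewrite pair_big /=.
rewrite (reindex (fun u : V * s.-tuple V => [tuple of u.1 :: u.2])) //=.
exists (fun t : s.+1.-tuple V => (thead t, [tuple of behead t])).
  by move=> [x g] _ /=; rewrite theadE; congr (_, _); apply: val_inj.
by move=> t _ /=; rewrite -tuple_eta.
Qed.

(** The theorem of Erdos on complete s-partite subhypergraphs. Split off the
    first coordinate: common_block gives a t-set of first entries with a
    positive proportion of common tails. *)
Lemma erdos_box (s t : nat) (c : rat) : 0 < c ->
  exists N : nat, forall (V : finType) (rl : pred (s.-tuple V)), (N <= #|V|)%N ->
    c * #|V|%:R ^+ s <= #|[set f | rl f]|%:R ->
    exists2 A : 'I_s -> {set V}, (forall i, #|A i| = t) &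
      forall f, (forall i, tnth f i \in A i) -> rl f.
Proof.
elim: s c => [|s IH] c c0.
  exists 0%N => V rl _; rewrite expr0 mulr1 => H.
  have : (0 < #|[set f | rl f]|)%N by rewrite -(ltr_nat rat); apply: lt_le_trans H.
  case/card_gt0P => f; rewrite inE tuple0 => rl0.
  by exists (fun=> set0) => [[]//|g _]; rewrite tuple0.
have [c' c'0 [N1 N1P]] := common_block t c0.
have [N2 N2P] := IH c' c'0.
exists (N1 + N2)%N => V rl NV H.
have := N1P V (s.-tuple V : finType) (fun x g => rl [tuple of x :: g]).
case; [by lia| |].
  rewrite card_tuple natrX -mulrA -exprS; apply: le_trans H _.
  by rewrite -(sum_tupleS (fun f => nat_of_bool (rl f))) ler_nat cardsE -sum1_card big_mkcond.
move=> A0 cA0; rewrite card_tuple natrX => HA0.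
have [|A cA AP] := N2P V _ _ HA0; first by lia.
exists (fun i => if unlift ord0 i is Some j then A j else A0) => [i|f fA].
  by case: unliftP.
have /forallP/(_ (thead f))/implyP : [forall x in A0, rl [tuple of x :: behead_tuple f]].
  apply: AP => i; have := fA (lift ord0 i).
  rewrite liftK tnth_behead (_ : inord i.+1 = lift ord0 i) //.
  by apply: val_inj; rewrite /= inordK ?ltnS.
have := fA ord0; rewrite unlift_none => f0 /(_ f0).
by move=> rlf; rewrite (tuple_eta f); congr (rl _): rlf; apply: val_inj.
Qed.

Lemma box_tuple (V : finType) s (A : 'I_s -> {set V}) i j x y :
  (forall k, (0 < #|A k|)%N) -> i != j -> x \in A i -> y \in A j ->
  exists f : s.-tuple V,
    [/\ forall k, tnth f k \in A k, tnth f i = x & tnth f j = y].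
Proof.
move=> A0 ij xA yA; have /fin_all_exists[g gA] : forall k, exists z, z \in A k.
  by move=> k; have /card_gt0P[z zA] := A0 k; exists z.
exists [tuple if k == i then x else if k == j then y else g k | k < s].
split=> [k||]; rewrite tnth_mktuple ?eqxx //.
  by case: eqP => [->|_] //; case: eqP => [->|].
by rewrite eq_sym (negPf ij).
Qed.

Lemma box_replace (V : finType) s (A : 'I_s -> {set V}) (f : s.-tuple V) i x :
  (forall k, tnth f k \in A k) -> x \in A i ->
  exists f' : s.-tuple V, [/\ forall k, tnth f' k \in A k, tnth f' i = x &
    forall k, k != i -> tnth f' k = tnth f k].
Proof.
move=> fA xA; exists [tuple if k == i then x else tnth f k | k < s].
split=> [k||k /negPf ki]; rewrite tnth_mktuple ?eqxx ?ki //.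
by case: eqP => [->|].
Qed.

(** * Orthogonality in Euclidean space *)

Section Euclid.
Variables (R : realType) (d : nat).
Implicit Types u v w x y : 'rV[R]_d.

Definition dot u v : R := \sum_i u 0 i * v 0 i.
Definition sqd x y : R := \sum_(i < d) (x 0 i - y 0 i) ^+ 2.

Lemma dotC u v : dot u v = dot v u.
Proof. by apply: eq_bigr => i _; rewrite mulrC. Qed.
Lemma dotDl u v w : dot (u + v) w = dot u w + dot v w.
Proof. by rewrite -big_split; apply: eq_bigr => i _; rewrite mxE mulrDl. Qed.
Lemma dotZl a u w : dot (a *: u) w = a * dot u w.
Proof. by rewrite /dot big_distrr /=; apply: eq_bigr => i _; rewrite mxE mulrA. Qed.
Lemma dot0l w : dot 0 w = 0.
Proof. by rewrite -(scale0r w) dotZl mul0r. Qed.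
Lemma dotNl u w : dot (- u) w = - dot u w.
Proof. by rewrite -scaleN1r dotZl mulN1r. Qed.
Lemma dotBl u v w : dot (u - v) w = dot u w - dot v w.
Proof. by rewrite dotDl dotNl. Qed.
Lemma dotDr u v w : dot w (u + v) = dot w u + dot w v.
Proof. by rewrite !(dotC w) dotDl. Qed.
Lemma dotZr a u w : dot w (a *: u) = a * dot w u.
Proof. by rewrite !(dotC w) dotZl. Qed.
Lemma dotBr u v w : dot w (u - v) = dot w u - dot w v.
Proof. by rewrite !(dotC w) dotBl. Qed.
Lemma dot_suml (I : finType) (f : I -> 'rV[R]_d) w :
  dot (\sum_i f i) w = \sum_i dot (f i) w.
Proof.
exact: (big_morph (fun u => dot u w) (fun u v => dotDl u v w) (dot0l w)).
Qed.

Lemma dot_ge0 u : 0 <= dot u u.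
Proof. by apply: sumr_ge0 => i _; rewrite -expr2 sqr_ge0. Qed.
Lemma dot_eq0 u : (dot u u == 0) = (u == 0).
Proof.
apply/eqP/eqP => [|->]; last exact: dot0l.
move=> /eqP; rewrite psumr_eq0 => [/allP H|i _]; last by rewrite -expr2 sqr_ge0.
apply/rowP => i; rewrite mxE; have := H i (mem_index_enum _).
by rewrite mulf_eq0 orbb => /eqP.
Qed.
Lemma dot_gt0 u : (0 < dot u u) = (u != 0).
Proof. by rewrite lt0r dot_ge0 andbT dot_eq0. Qed.

Lemma sqdE x y : sqd x y = dot (x - y) (x - y).
Proof. by apply: eq_bigr => i _; rewrite !mxE expr2. Qed.
Lemma sqdC x y : sqd x y = sqd y x.
Proof. by apply: eq_bigr => i _; rewrite -sqrrN opprB. Qed.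
Lemma sqd_eq0 x y : (sqd x y == 0) = (x == y).
Proof. by rewrite sqdE dot_eq0 subr_eq0. Qed.
Lemma sqd_ge0 x y : 0 <= sqd x y.
Proof. by rewrite sqdE dot_ge0. Qed.

(** Polarization: orthogonality of differences is a statement about distances. *)
Lemma dot_sub2 x x' y y' :
  2 * dot (x - x') (y - y') = (sqd x y' - sqd x' y') - (sqd x y - sqd x' y).
Proof.
by rewrite !sqdE !(dotBl, dotBr) (dotC y x) (dotC y' x) (dotC y x') (dotC y' x'); ring.
Qed.

Definition orthonormal (I : finType) (e : I -> 'rV[R]_d) :=
  forall i j, dot (e i) (e j) = (i == j)%:R.

Lemma orthonormal_card (I : finType) (e : I -> 'rV[R]_d) :
  orthonormal e -> (#|I| <= d)%N.
Proof.
move=> oe; pose A : 'M[R]_(#|I|, d) := \matrix_k e (enum_val k).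
have AA : A *m A^T = 1%:M.
  apply/matrixP => i j; rewrite !mxE -(inj_eq enum_val_inj) -oe.
  by apply: eq_bigr => k _; rewrite !mxE.
by rewrite -(mxrank1 R #|I|) -AA; apply: leq_trans (mxrankM_maxl _ _) (rank_leq_col _).
Qed.

Lemma parseval (I : finType) (e : I -> 'rV[R]_d) u :
  orthonormal e -> #|I| = d -> dot u u = \sum_i (dot u (e i)) ^+ 2.
Proof.
move=> oe cI; pose A : 'M[R]_(#|I|, d) := \matrix_k e (enum_val k).
have AA : A *m A^T = 1%:M.
  apply/matrixP => i j; rewrite !mxE -(inj_eq enum_val_inj) -oe.
  by apply: eq_bigr => k _; rewrite !mxE.
have tAA : A^T *m A = 1%:M.
  move: A AA; rewrite cI => A AA; exact: mulmx1C.
have -> : dot u u = ((u *m A^T) *m (A *m u^T)) 0 0.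
  by rewrite mulmxA -(mulmxA u) tAA mulmx1 mxE; apply: eq_bigr => i _; rewrite !mxE.
rewrite mxE (reindex (@enum_val I I)) /=; last by apply: onW_bij; exact: enum_val_bij.
apply: eq_bigr => k _; rewrite expr2 [in RHS]dotC !mxE; congr (_ * _).
  by rewrite dotC; apply: eq_bigr => i _; rewrite !mxE.
by apply: eq_bigr => i _; rewrite !mxE.
Qed.

Section Frame.
Variables (s : nat) (v w : 'I_s -> 'rV[R]_d).
Hypothesis v0 : forall i, v i != 0.
Hypothesis w0 : forall i a, w i != a *: v i.
Hypothesis vv : forall i j, i != j -> dot (v i) (v j) = 0.
Hypothesis vw : forall i j, i != j -> dot (v i) (w j) = 0.
Hypothesis ww : forall i j, i != j -> dot (w i) (w j) = 0.

Let w' i := w i - (dot (w i) (v i) / dot (v i) (v i)) *: v i.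
Let f (k : 'I_s * bool) := if k.2 then w' k.1 else v k.1.

Let f0 k : f k != 0.
Proof. by case: k => i [] /=; rewrite /f //= /w' subr_eq0. Qed.

Let fo k l : k != l -> dot (f k) (f l) = 0.
Proof.
have w'v i : dot (w' i) (v i) = 0.
  by rewrite dotBl dotZl divfK ?subrr // dot_eq0.
have wv i j : i != j -> dot (w i) (v j) = 0 by rewrite dotC eq_sym; exact: vw.
case: k l => [i []] [j []]; rewrite /f /= -pair_eqE /=; have [->|ij] := eqVneq i j => //= _.
- by rewrite /w' !(dotBl, dotBr, dotZl, dotZr) (ww ij) (vw ij) (wv _ _ ij) (vv ij); ring.
- by rewrite dotBl dotZl (wv _ _ ij) (vv ij) mulr0 subr0.
- by rewrite dotC.
- by rewrite dotBr dotZr (vw ij) (vv ij) mulr0 subr0.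
- exact: vv.
Qed.

(** Gram-Schmidt inside each of the mutually orthogonal planes spanned by v i
    and w i. *)
Lemma gram_schmidt_blocks : exists2 e : 'I_s * bool -> 'rV[R]_d, orthonormal e &
  forall u i b, dot u (v i) = 0 -> dot u (w i) = 0 -> dot u (e (i, b)) = 0.
Proof.
exists (fun k => (Num.sqrt (dot (f k) (f k)))^-1 *: f k) => [k l|u i b uv uw].
  rewrite dotZl dotZr; have [<-|kl] := eqVneq k l; last by rewrite (fo kl) !mulr0.
  have fk := dot_gt0 (f k); rewrite f0 in fk.
  rewrite -{3}(sqr_sqrtr (ltW fk)); rewrite -[RHS]/(1 : R); field.
  by rewrite gt_eqF // sqrtr_gt0.
rewrite dotZr; suff -> : dot u (f (i, b)) = 0 by rewrite mulr0.
case: b; rewrite /f //= /w' dotBr dotZr uw uv; ring.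
Qed.
End Frame.

(** A line meets a sphere in at most two points. *)
Lemma not_collinear c x y z : x != y -> x != z -> y != z ->
  sqd x c = sqd y c -> sqd x c = sqd z c -> forall a, z - x != a *: (y - x).
Proof.
move=> xy xz yz cxy cxz a; apply/eqP => E.
have yx : y - x != 0 by rewrite subr_eq0 eq_sym.
have [u Eu] : exists u, u = y - x by exists (y - x).
have Ey : y = x + u by rewrite Eu addrC subrK.
have Ez : z = x + a *: u by rewrite Eu -E addrC subrK.
have u0 : u != 0 by rewrite Eu.
have := dot_gt0 u; rewrite u0 => uu.
have Ec b : sqd (x + b *: u) c = sqd x c + 2 * b * dot u (x - c) + b ^+ 2 * dot u u.
  rewrite !sqdE addrAC !(dotDl, dotDr, dotZl, dotZr) (dotC _ u) (dotC (- c) u); ring.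
have H1 := Ec 1; rewrite scale1r -Ey -cxy in H1.
have H2 := Ec a; rewrite -Ez -cxz in H2.
have : a * (a - 1) * dot u u = 0 by nra.
move=> /eqP; rewrite !mulf_eq0 (gt_eqF uu) orbF subr_eq0 => /orP[/eqP a0|/eqP a1].
  by move: xz; rewrite Ez a0 scale0r addr0 eqxx.
by move: yz; rewrite Ez Ey a1 scale1r eqxx.
Qed.

End Euclid.

(** * Plane geometry *)

Section Plane.
Variable R : realType.
Implicit Types u v w a b c : R * R.

Definition pnorm u : R := u.1 ^+ 2 + u.2 ^+ 2.

Lemma pnorm_ge0 u : 0 <= pnorm u.
Proof. by rewrite addr_ge0 ?sqr_ge0. Qed.
Lemma pnorm_eq0 u : (pnorm u == 0) = (u == 0).
Proof.
rewrite paddr_eq0 ?sqr_ge0 // !sqrf_eq0.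
by case: u => x y; rewrite -pair_eqE.
Qed.
Lemma pnormBC u v : pnorm (u - v) = pnorm (v - u).
Proof. by rewrite /pnorm /=; ring. Qed.

(** If u <> v, then b - a and c - a are both orthogonal to v - u, so a, b, c are
    collinear; but a line meets a circle at most twice. *)
Lemma circumcenter_unique a b c u v : a != b -> a != c -> b != c ->
  pnorm (a - u) = pnorm (b - u) -> pnorm (a - u) = pnorm (c - u) ->
  pnorm (a - v) = pnorm (b - v) -> pnorm (a - v) = pnorm (c - v) -> u = v.
Proof.
case: a b c u v => [a1 a2] [b1 b2] [c1 c2] [u1 u2] [v1 v2].
move=> ab ac bc; rewrite /pnorm /= => H1 H2 H3 H4.
have [B1 EB1] : exists B1, B1 = b1 - a1 by eexists.
have [B2 EB2] : exists B2, B2 = b2 - a2 by eexists.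
have [C1 EC1] : exists C1, C1 = c1 - a1 by eexists.
have [C2 EC2] : exists C2, C2 = c2 - a2 by eexists.
have Eb1 : b1 = a1 + B1 by rewrite EB1; ring.
have Eb2 : b2 = a2 + B2 by rewrite EB2; ring.
have Ec1 : c1 = a1 + C1 by rewrite EC1; ring.
have Ec2 : c2 = a2 + C2 by rewrite EC2; ring.
have [m1 Em1] : exists m1, m1 = u1 - a1 by eexists.
have [m2 Em2] : exists m2, m2 = u2 - a2 by eexists.
have [d1 Ed1] : exists d1, d1 = v1 - u1 by eexists.
have [d2 Ed2] : exists d2, d2 = v2 - u2 by eexists.
have Eu1 : u1 = a1 + m1 by rewrite Em1; ring.
have Eu2 : u2 = a2 + m2 by rewrite Em2; ring.
have Ev1 : v1 = a1 + m1 + d1 by rewrite Ed1 Em1; ring.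
have Ev2 : v2 = a2 + m2 + d2 by rewrite Ed2 Em2; ring.
move: ab ac bc H1 H2 H3 H4; rewrite Ev1 Ev2 Eu1 Eu2 Eb1 Eb2 Ec1 Ec2.
rewrite -!pair_eqE /= => ab ac bc H1 H2 H3 H4.
have I1 : B1 ^+ 2 + B2 ^+ 2 = 2 * (B1 * m1 + B2 * m2) by lra.
have I2 : C1 ^+ 2 + C2 ^+ 2 = 2 * (C1 * m1 + C2 * m2) by lra.
have I3 : B1 * d1 + B2 * d2 = 0 by lra.
have I4 : C1 * d1 + C2 * d2 = 0 by lra.
have n0 : 0 < B1 ^+ 2 + B2 ^+ 2.
  rewrite lt0r addr_ge0 ?sqr_ge0 // andbT paddr_eq0 ?sqr_ge0 // !sqrf_eq0.
  by apply: contra ab => /andP[/eqP-> /eqP->]; rewrite !addr0 !eqxx.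
have [d0|dn0] := eqVneq (d1 ^+ 2 + d2 ^+ 2) 0.
  move/eqP: d0; rewrite paddr_eq0 ?sqr_ge0 // !sqrf_eq0.
  by move=> /andP[/eqP-> /eqP->]; rewrite !addr0.
have cr : B1 * C2 - B2 * C1 = 0.
  apply: (mulfI dn0); rewrite mulr0.
  transitivity ((B1 * d1 + B2 * d2) * (C2 * d1 - C1 * d2)
     - (C1 * d1 + C2 * d2) * (B2 * d1 - B1 * d2)); first ring.
  by rewrite I3 I4; ring.
set n := _ + _ in I1 n0; pose t := B1 * C1 + B2 * C2.
have J1 : n * C1 = t * B1.
  transitivity (t * B1 - B2 * (B1 * C2 - B2 * C1)); first by rewrite /n /t; ring.
  by rewrite cr; ring.
have J2 : n * C2 = t * B2.
  transitivity (t * B2 + B1 * (B1 * C2 - B2 * C1)); first by rewrite /n /t; ring.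
  by rewrite cr; ring.
have n0' : n != 0 by rewrite gt_eqF.
have K1 : C1 ^+ 2 + C2 ^+ 2 = t.
  apply: (mulfI n0'); rewrite I2.
  transitivity (2 * ((n * C1) * m1 + (n * C2) * m2)); first ring.
  rewrite J1 J2; transitivity (t * (2 * (B1 * m1 + B2 * m2))); first ring.
  by rewrite -I1 mulrC.
have K2 : t * (n - t) = 0.
  rewrite mulrBr; apply/eqP; rewrite subr_eq0; apply/eqP.
  transitivity ((n * C1) * C1 + (n * C2) * C2); first by rewrite -{1}K1; ring.
  by rewrite J1 J2 {3}/t; ring.
move/eqP: K2; rewrite mulf_eq0 subr_eq0 => /orP[/eqP t0|/eqP nt].
  move/eqP: K1; rewrite t0 paddr_eq0 ?sqr_ge0 // !sqrf_eq0 => /andP[/eqP C10 /eqP C20].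
  by case/negP: ac; rewrite C10 C20 !addr0 !eqxx.
case/negP: bc; move: J1 J2; rewrite -nt => /(mulfI n0')-> /(mulfI n0')->.
by rewrite !eqxx.
Qed.

(** The Gram determinant of three vectors of the plane vanishes; for vectors of
    squared norm h with equal dot products k it is (h - k)^2 (h + 2 k). *)
Lemma inscribed_equilateral (h s : R) u v w :
  pnorm u = h -> pnorm v = h -> pnorm w = h -> 0 < s ->
  pnorm (u - v) = s -> pnorm (v - w) = s -> pnorm (u - w) = s -> s = 3 * h.
Proof.
case: u v w => [u1 u2] [v1 v2] [w1 w2]; rewrite /pnorm /= => Hu Hv Hw s0 H1 H2 H3.
have D1 : u1 * v1 + u2 * v2 = h - s / 2 by lra.
have D2 : v1 * w1 + v2 * w2 = h - s / 2 by lra.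
have D3 : u1 * w1 + u2 * w2 = h - s / 2 by lra.
set k := h - s / 2 in D1 D2 D3.
have : h * h * h + 2 * k * k * k - 3 * h * k * k = 0.
  transitivity ((u1 ^+ 2 + u2 ^+ 2) * (v1 ^+ 2 + v2 ^+ 2) * (w1 ^+ 2 + w2 ^+ 2)
    + 2 * (u1 * v1 + u2 * v2) * (v1 * w1 + v2 * w2) * (u1 * w1 + u2 * w2)
    - (u1 ^+ 2 + u2 ^+ 2) * (v1 * w1 + v2 * w2) ^+ 2
    - (v1 ^+ 2 + v2 ^+ 2) * (u1 * w1 + u2 * w2) ^+ 2
    - (w1 ^+ 2 + w2 ^+ 2) * (u1 * v1 + u2 * v2) ^+ 2); last ring.
  by rewrite Hu Hv Hw D1 D2 D3; ring.
have -> : h * h * h + 2 * k * k * k - 3 * h * k * k = (s / 2) ^+ 2 * (3 * h - s).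
  by rewrite /k; field.
move=> /eqP; rewrite mulf_eq0 sqrf_eq0 mulf_eq0 (gt_eqF s0) invr_eq0 pnatr_eq0 /=.
by rewrite subr_eq0 => /eqP.
Qed.
End Plane.

(** * Homogeneous blocks *)

Lemma third_index r (i j : 'I_r) : (2 < r)%N -> exists2 k, k != i & k != j.
Proof.
move=> r2; have : (0 < #|~: [set i; j]|)%N.
  by have := cardsC [set i; j]; rewrite cards2 card_ord; case: (i != j) => /=; lia.
by case/card_gt0P => k; rewrite !inE negb_or => /andP[ki kj]; exists k.
Qed.

Section Blocks.
Variables (R : realType) (d : nat) (V : finType) (p : V -> 'rV[R]_d).
Hypothesis pinj : injective p.

(** The distance between two blocks is constant: exchanging i and j lets y vary
    as well. *)
Definition homogeneous s (B : 'I_s -> {set V}) := forall i j, i != j ->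
  forall x x' y, x \in B i -> x' \in B i -> y \in B j ->
  sqd (p x) (p y) = sqd (p x') (p y).

Section Frame.
Variables (s : nat) (B : 'I_s -> {set V}).
Hypothesis s1 : (1 < s)%N.
Hypothesis B3 : forall i, (2 < #|B i|)%N.
Hypothesis hB : homogeneous B.

Lemma other_index (i : 'I_s) : exists j : 'I_s, i != j.
Proof.
have c : (1 < #|'I_s|)%N by rewrite card_ord.
by case/card_gt1P: c => a [b [_ _ ab]]; case: (eqVneq i a) => [->|ia]; [exists b|exists a].
Qed.

(** Differences in distinct blocks are orthogonal, and each block spans a plane
    since its points lie on a sphere about any point of another block. *)
Lemma block_frame : exists2 e : 'I_s * bool -> 'rV[R]_d, orthonormal e &
  forall u i b, {in B i &, forall x x', dot u (p x - p x') = 0} ->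
    dot u (e (i, b)) = 0.
Proof.
have H i : exists t : V * V * V, [/\ t.1.1 \in B i, t.1.2 \in B i & t.2 \in B i] /\
    [/\ t.1.1 != t.1.2, t.1.2 != t.2 & t.1.1 != t.2].
  have /card_gt2P[x [y [z [[xB yB zB] [xy yz zx]]]]] := B3 i.
  by exists (x, y, z); split; split=> //=; rewrite eq_sym.
have {H}[t tP] := choice H.
have perp i j x x' y y' : i != j -> x \in B i -> x' \in B i -> y \in B j -> y' \in B j ->
    dot (p x - p x') (p y - p y') = 0.
  move=> ij xB x'B yB y'B.
  have := dot_sub2 (p x) (p x') (p y) (p y').
  rewrite (hB ij xB x'B yB) (hB ij xB x'B y'B) !subrr => /eqP.
  by rewrite mulf_eq0 pnatr_eq0 /= => /eqP.
pose v i := p (t i).1.2 - p (t i).1.1.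
pose w i := p (t i).2 - p (t i).1.1.
have [|i a|i j ij|i j ij|i j ij|e oe eP] := @gram_schmidt_blocks R d s v w.
- move=> i; have [_ [n _ _]] := tP i.
  by rewrite subr_eq0 (inj_eq pinj) eq_sym.
- have [[x0 x1 x2] [n1 n2 n3]] := tP i; have [j ij] := other_index i.
  have /card_gt0P[y yB] : (0 < #|B j|)%N by apply: leq_trans (B3 j).
  apply: (@not_collinear _ _ (p y)); rewrite ?(inj_eq pinj) //.
    exact: hB ij _ _ _ x0 x1 yB.
  exact: hB ij _ _ _ x0 x2 yB.
- by have [[x0 x1 x2] _] := tP i; have [[y0 y1 y2] _] := tP j; apply: perp ij _ _ _ _.
- by have [[x0 x1 x2] _] := tP i; have [[y0 y1 y2] _] := tP j; apply: perp ij _ _ _ _.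
- by have [[x0 x1 x2] _] := tP i; have [[y0 y1 y2] _] := tP j; apply: perp ij _ _ _ _.
exists e => // u i b uB; have [[x0 x1 x2] _] := tP i.
by apply: eP; apply: uB.
Qed.

Lemma blocks_dim : (2 * s <= d)%N.
Proof.
have [e oe _] := block_frame; have := orthonormal_card oe.
by rewrite card_prod card_ord card_bool mulnC.
Qed.

(** The differences inside the blocks span the space, and u - u' is orthogonal
    to all of them. *)
Lemma blocks_center_unique (u u' : 'rV[R]_d) : (2 * s)%N = d ->
  (forall i, {in B i &, forall x x', sqd u (p x) = sqd u (p x')}) ->
  (forall i, {in B i &, forall x x', sqd u' (p x) = sqd u' (p x')}) -> u = u'.
Proof.
move=> sd Hu Hu'; have [e oe eP] := block_frame.
apply/eqP; rewrite -subr_eq0 -dot_eq0 (parseval _ oe); last first.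
  by rewrite card_prod card_ord card_bool mulnC.
apply/eqP; apply: big1 => [[i b]] _; rewrite eP ?expr0n // => x x' xB x'B.
apply/eqP; rewrite -(mulrI_eq0 _ (mulfI (_ : 2 != 0 :> R))) ?pnatr_eq0 //.
by rewrite dot_sub2 (Hu _ _ _ xB x'B) (Hu' _ _ _ xB x'B) !subrr.
Qed.
End Frame.

(** Take coordinates along the frame of the blocks. The coordinates of a point
    of A i in another plane j are the circumcenter of A j there, hence
    independent of the point and of i; these circumcenters are the coordinates
    of the center o. *)
Lemma lenz_frame (r : nat) (A : 'I_r -> {set V}) (L : R) :
  (2 < r)%N -> (2 * r)%N = d -> (forall i, (2 < #|A i|)%N) ->
  (forall i j, i != j -> {in A i & A j, forall x y, sqd (p x) (p y) = L}) ->
  exists (o : 'rV[R]_d) (q : 'rV[R]_d -> 'I_r -> R * R),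
  [/\ forall u v, sqd u v = \sum_i pnorm (q u i - q v i),
      forall i, q o i = 0,
      forall i j, i != j -> {in A i, forall x, q (p x) j = 0} &
      forall i, {in A i, forall x, pnorm (q (p x) i) = L / 2}].
Proof.
move=> r2 rd A3 AL.
have r1 : (1 < r)%N by apply: ltnW.
have hA : homogeneous A.
  by move=> i j ij x x' y xA x'A yA; rewrite !(AL i j).
have [e oe eP] := block_frame r1 A3 hA.
pose c (u : 'rV[R]_d) i : R * R := (dot u (e (i, false)), dot u (e (i, true))).
have cE u v : sqd u v = \sum_i pnorm (c u i - c v i).
  rewrite sqdE (parseval _ oe); last by rewrite card_prod card_ord card_bool mulnC.
  rewrite (eq_bigr (fun k => dot (u - v) (e (k.1, k.2)) ^+ 2)); last by case.
  rewrite -(pair_bigA _ (fun i b => dot (u - v) (e (i, b)) ^+ 2)) /=.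
  by apply: eq_bigr => i _; rewrite big_bool /pnorm /= !dotBl addrC.
have cconst i j x x' : i != j -> x \in A i -> x' \in A i -> c (p x) j = c (p x') j.
  move=> ij xA x'A; suff E b : dot (p x) (e (j, b)) = dot (p x') (e (j, b)).
    by rewrite /c !E.
  apply/eqP; rewrite -subr_eq0 -dotBl eP // => y y' yA y'A.
  apply/eqP; rewrite -(mulrI_eq0 _ (mulfI (_ : 2 != 0 :> R))) ?pnatr_eq0 //.
  by rewrite dot_sub2 !(AL i j) // subrr.
have ccirc i j x y y' : i != j -> x \in A i -> y \in A j -> y' \in A j ->
    pnorm (c (p y) j - c (p x) j) = pnorm (c (p y') j - c (p x) j).
  move=> ij xA yA y'A.
  have : sqd (p x) (p y) = sqd (p x) (p y') by rewrite !(AL i j).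
  rewrite !cE (bigD1 j) //= [RHS](bigD1 j) //= (pnormBC (c (p x) j)) [X in _ = X + _]pnormBC.
  rewrite [X in _ + X = _](eq_bigr (fun k => pnorm (c (p x) k - c (p y') k))).
    by move=> /addIr.
  by move=> k kj; rewrite (cconst j k y y') // eq_sym.
have cinj j y y' : y \in A j -> y' \in A j -> y != y' -> c (p y) j != c (p y') j.
  move=> yA y'A; apply: contra => /eqP E; rewrite -(inj_eq pinj) -sqd_eq0 cE.
  apply/eqP; apply: big1 => k _; apply/eqP; rewrite pnorm_eq0 subr_eq0.
  by have [->|kj] := eqVneq k j; [rewrite E|rewrite (cconst j k y y') // eq_sym].
have oex j : exists w : R * R, forall i x, i != j -> x \in A i -> c (p x) j = w.
  have [i0 i0j] := other_index r1 j; rewrite eq_sym in i0j.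
  have /card_gt0P[x0 x0A] : (0 < #|A i0|)%N by apply: leq_trans (A3 i0).
  exists (c (p x0) j) => i x ij xA.
  have /card_gt2P[y [y' [y'' [[yA y'A y''A] [n1 n2 n3]]]]] := A3 j.
  have n3' : y != y'' by rewrite eq_sym.
  apply: (circumcenter_unique (cinj _ _ _ yA y'A n1) (cinj _ _ _ yA y''A n3')
    (cinj _ _ _ y'A y''A n2)).
  - exact: ccirc ij _ _ _.
  - exact: ccirc ij _ _ _.
  - exact: ccirc i0j _ _ _.
  - exact: ccirc i0j _ _ _.
have {oex}[w wP] := choice oex.
pose o := \sum_i ((w i).1 *: e (i, false) + (w i).2 *: e (i, true)).
have co i : c o i = w i.
  rewrite /c /o !dot_suml; rewrite (bigD1 i) //= [X in (_, X)](bigD1 i) //= !big1; last first.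
  - by move=> k ki; rewrite !(dotDl, dotZl) !oe !xpair_eqE (negPf ki) /=; ring.
  - by move=> k ki; rewrite !(dotDl, dotZl) !oe !xpair_eqE (negPf ki) /=; ring.
  rewrite !(dotDl, dotZl) !oe !xpair_eqE !eqxx /= !mulr0 !mulr1n !mulr1 !addr0 add0r.
  by case: (w i).
exists o, (fun u i => c u i - w i); split.
- by move=> u v; rewrite cE; apply: eq_bigr => i _; rewrite opprB addrA subrK.
- by move=> i; rewrite co subrr.
- by move=> i j ij x xA; rewrite (wP j i) // subrr.
(* the squared radii add up to L in pairs; three indices make them all L / 2 *)
have dist i j x y : i != j -> x \in A i -> y \in A j ->
    pnorm (c (p x) i - w i) + pnorm (c (p y) j - w j) = L.
  move=> ij xA yA; rewrite -(AL i j ij x y xA yA) cE (bigD1 i) //= (bigD1 j) ?(eq_sym j) //=.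
  rewrite (wP i j y) // 1?eq_sym // (wP j i x) // (pnormBC (w j)).
  rewrite big1 ?addr0 // => k /andP[ki kj].
  rewrite (wP k i x) // 1?eq_sym // (wP k j y) // 1?eq_sym // subrr.
  by apply/eqP; rewrite pnorm_eq0.
move=> i x xA.
have [j ij] := other_index r1 i.
have [k ki kj] := third_index i j r2; rewrite eq_sym in ki; rewrite eq_sym in kj.
have /card_gt0P[y yA] : (0 < #|A j|)%N by apply: leq_trans (A3 j).
have /card_gt0P[z zA] : (0 < #|A k|)%N by apply: leq_trans (A3 k).
have := dist _ _ _ _ ij xA yA; have := dist _ _ _ _ ki xA zA; have := dist _ _ _ _ kj yA zA.
lra.
Qed.
End Blocks.

(** * Equidistant sets and rich pairs *)

Section Mono.
Variables (R : realType) (d : nat) (V : finType) (p : V -> 'rV[R]_d).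
Hypothesis pinj : injective p.

Definition mono (A : {set V}) := [forall x in A, forall y in A,
  forall z in A, forall t in A,
    (x != y) && (z != t) ==> (sqd (p x) (p y) == sqd (p z) (p t))].

Lemma monoP (A : {set V}) : reflect (forall x y z t, x \in A -> y \in A ->
    z \in A -> t \in A -> x != y -> z != t -> sqd (p x) (p y) = sqd (p z) (p t)) (mono A).
Proof.
apply: (iffP forallP) => [H x y z t xA yA zA tA xy zt|H x].
  have /implyP/(_ xA)/forallP/(_ y)/implyP/(_ yA)/forallP/(_ z) := H x.
  move=> /implyP/(_ zA)/forallP/(_ t)/implyP/(_ tA); rewrite xy zt /=.
  by move/eqP.
apply/implyP => xA; apply/forallP => y; apply/implyP => yA.
apply/forallP => z; apply/implyP => zA; apply/forallP => t; apply/implyP => tA.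
by apply/implyP => /andP[xy zt]; rewrite (H x y z t).
Qed.

Lemma mono_sub (A B : {set V}) : A \subset B -> mono B -> mono A.
Proof.
move=> /subsetP AB /monoP H; apply/monoP => x y z t /AB xB /AB yB /AB zB /AB tB.
exact: H.
Qed.

Lemma mono_down (C : {set V}) v : mono (v |: C) -> mono C.
Proof. by apply: mono_sub; rewrite subsetUr. Qed.

Lemma mono_const (A : {set V}) D :
  {in A &, forall x y, x != y -> sqd (p x) (p y) = D} -> mono A.
Proof. by move=> H; apply/monoP => x y z t xA yA zA tA xy zt; rewrite !H. Qed.

(** A facet of A has at least two points, whose distance is that of A; so a
    vertex extending two facets is at this same distance from every point of A.
    With two points in A the facets would be single points, and this fails. *)
Lemma mono_glues s : (1 < s)%N -> glues mono s.
Proof.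
move=> s1 A v a b cA /monoP FA vA aA bA ab /monoP Fa /monoP Fb.
have [c cA3 /andP[ca cb]] : exists2 c, c \in A & (c != a) && (c != b).
  have : (0 < #|A :\: [set a; b]|)%N.
    have := cardsID [set a; b] A; have := subset_leq_card (subsetIr A [set a; b]).
    by rewrite cards2 ab cA /=; lia.
  by case/card_gt0P => c; rewrite !inE negb_or => /andP[H cA']; exists c.
have D x : x \in A -> sqd (p v) (p x) = sqd (p c) (p a).
  move=> xA; have vx : v != x by apply: contraNneq vA => ->.
  have [xa|xa] := eqVneq x a.
    by rewrite xa in vx *; apply: Fb; rewrite // !inE ?eqxx ?aA ?cA3 ?cb ?ab ?orbT.
  transitivity (sqd (p c) (p b)); last exact: FA.
  by apply: Fa; rewrite // !inE ?eqxx ?xA ?xa ?bA ?cA3 ?ca ?(eq_sym b) ?ab ?orbT.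
apply: (@mono_const _ (sqd (p c) (p a))) => x y.
rewrite !inE => /orP[/eqP->|xA] /orP[/eqP->|yA] xy.
- by rewrite eqxx in xy.
- exact: D.
- by rewrite sqdC; exact: D.
- exact: FA.
Qed.

Definition rich (eps0 : rat) (C : {set V}) := eps0 * #|V|%:R <= (extn mono C)%:R.

(** By averaging, one apex z serves a proportion eps0 of the tuples, for one
    pair of indices after the other. *)
Lemma fix_witnesses (s : nat) (eps0 c : rat) (l : seq ('I_s * 'I_s))
    (rl : pred (s.-tuple V)) : (0 < #|V|)%N -> 0 <= eps0 -> 0 <= c ->
  (forall i j f, (i, j) \in l -> rl f ->
     [/\ tnth f i != tnth f j & rich eps0 [set tnth f i; tnth f j]]) ->
  c <= #|[set f | rl f]|%:R ->
  exists2 rl' : pred (s.-tuple V), eps0 ^+ size l * c <= #|[set f | rl' f]|%:R &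
    forall f, rl' f -> rl f /\ forall i j, (i, j) \in l -> exists z : V,
      forall f, rl' f -> sqd (p (tnth f i)) (p (tnth f j)) = sqd (p (tnth f i)) (p z) /\
                         sqd (p (tnth f i)) (p (tnth f j)) = sqd (p (tnth f j)) (p z).
Proof.
move=> V0 e0; elim: l c rl => [|[i j] l IH] c rl c0 H cR.
  by exists rl; rewrite ?expr0 ?mul1r.
pose tz f z := (z \notin [set tnth f i; tnth f j]) &&
  mono (z |: [set tnth f i; tnth f j]).
have [z zP] : exists z, eps0 * c <= #|[set f | rl f && tz f z]|%:R.
  case: (pickP (fun z => eps0 * c <= #|[set f | rl f && tz f z]|%:R)) => [z|no].
    by exists z.
  have : \sum_z #|[set f | rl f && tz f z]|%:R < \sum_(z : V) eps0 * c.
    have /card_gt0P[z0 _] := V0.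
    rewrite (bigD1 z0) //= [ltRHS](bigD1 z0) //=; apply: ltr_leD.
      by have := no z0 => /negbT; rewrite -ltNge.
    by apply: ler_sum => z _; have := no z => /negbT; rewrite -ltNge => /ltW.
  rewrite ltNge => /negP[]; rewrite sumr_const -[_ *+ _]mulr_natl.
  have -> : \sum_z #|[set f | rl f && tz f z]|%:R =
            \sum_(f | rl f) (extn mono [set tnth f i; tnth f j])%:R :> rat.
    rewrite -!natr_sum; congr (_%:R).
    under eq_bigr do rewrite cardsE -sum1_card big_mkcondr /=.
    rewrite exchange_big /=; apply: eq_bigr => f _.
    by rewrite -big_mkcond sum1_card /extn cardsE.
  apply: le_trans (_ : \sum_(f | rl f) (eps0 * #|V|%:R) <= _); last first.
    by apply: ler_sum => f /H H'; have [|_] := H' i j; rewrite ?mem_head.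
  rewrite sumr_const -[(_ * _) *+ _]mulr_natl; rewrite cardsE in cR.
  have -> : #|V|%:R * (eps0 * c) = c * (eps0 * #|V|%:R) by ring.
  by apply: ler_wpM2r; rewrite ?mulr_ge0 ?ler0n.
have [||rl' cR' rlP'] := IH (eps0 * c) (fun f => rl f && tz f z) _ _ zP.
- by rewrite mulr_ge0.
- by move=> i' j' f ij' /andP[rf _]; apply: H => //; rewrite inE ij' orbT.
exists rl'; first by rewrite /= exprSr -mulrA.
move=> f rf; have [/andP[rlf _] lP] := rlP' f rf; split=> // i' j'.
rewrite inE => /orP[/eqP[-> ->]|]; last exact: lP.
exists z => g rg; have [/andP[rlg]] := rlP' g rg.
rewrite /tz !inE negb_or => /andP[/andP[z1 z2] /monoP mz] _.
have [gij _] := H i j g (mem_head _ _) rlg.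
by split; apply: mz; rewrite ?inE ?eqxx ?orbT // eq_sym.
Qed.

End Mono.

(** Otherwise there are many cliques of r + 1 points in the graph of rich pairs.
    After fixing one apex z_ij for each pair of indices, a box of such cliques
    has constant distances between its parts, since d(x, y) = d(x, z_ij) = d(y,
    z_ij); but r + 1 homogeneous blocks do not fit in dimension 2 r. *)
Lemma few_rich_pairs (r : nat) (eps eps0 : rat) : (2 < r)%N -> 0 < eps -> 0 < eps0 ->
  exists N : nat, forall (R : realType) (V : finType) (p : V -> 'rV[R]_(2 * r)),
    injective p -> (N <= #|V|)%N ->
    (edges (fun x y : V => rich p eps0 [set x; y]))%:R <=
      (1 - r%:R^-1 + eps) * #|V|%:R ^+ 2.
Proof.
move=> r2 e e0; have r0 : (0 < r)%N by lia.
have [c c0 cP] := supersaturation r0 e.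
pose l := [seq ij <- enum {: 'I_r.+1 * 'I_r.+1} | ij.1 != ij.2].
have c'0 : 0 < eps0 ^+ size l * c by rewrite mulr_gt0 ?exprn_gt0.
have [N NP] := erdos_box r.+1 3 c'0.
exists N.+1 => R V p pinj NV; rewrite leNgt; apply/negP => He.
pose sh := (fun x y : V => rich p eps0 [set x; y]).
have shs : symmetric sh by move=> x y; rewrite /sh setUC.
have {cP} := cP V sh shs (ltW He).
set rl := fun t : r.+1.-tuple V => uniq t && clique sh [set x in t] => cR.
have V0 : (0 < #|V|)%N by lia.
have [||rl' rl'P H] := @fix_witnesses R _ V p r.+1 eps0 _ l rl V0 (ltW e0) _ _ cR.
- by rewrite mulr_ge0 ?exprn_ge0 // ltW.
- move=> i j f; rewrite mem_filter /= => /andP[ij _] /andP[uf /cliqueP cf].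
  have fij : tnth f i != tnth f j.
    by move/tuple_uniqP: uf => /inj_eq->.
  by split=> //; apply: cf; rewrite // inE mem_tnth.
have [||A A3 AP] := NP V rl'; first by lia.
  by rewrite -mulrA.
have A0 k : (0 < #|A k|)%N by rewrite A3.
suff : (2 * r.+1 <= 2 * r)%N by lia.
apply: (blocks_dim pinj (B := A)) => // [k|i j ij x x' y xA x'A yA]; first by rewrite A3.
have [f [fA fx fy]] := box_tuple A0 ij xA yA.
have [f' [f'A f'x f'y]] := box_tuple A0 ij x'A yA.
have [_ /(_ i j)[]] := H _ (AP f fA).
  by rewrite mem_filter ij mem_enum.
move=> z zP; have [_ E1] := zP _ (AP f fA); have [_ E2] := zP _ (AP f' f'A).
by move: E1 E2; rewrite fx fy f'x f'y => -> ->.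
Qed.

(** * Finding r blocks at a single distance *)

(** The proportion of ordered triples meeting three distinct classes of a
    balanced partition into r classes. *)
Definition density (r : nat) : rat := (1 - r%:R^-1) * (1 - 2 * r%:R^-1).

Lemma inv_r_bounds (r : nat) : (2 < r)%N -> 0 < r%:R^-1 :> rat /\ 3 * r%:R^-1 <= 1 :> rat.
Proof.
move=> r2; have r0 : 0 < r%:R :> rat by rewrite ltr0n; lia.
by rewrite invr_gt0 ler_pdivrMr // mul1r (ler_nat _ 3).
Qed.

Section CodegreeStep.
Variables (R : realType) (d : nat) (V : finType) (p : V -> 'rV[R]_d).

(** The Moon-Moser inequality at pairs, restricted to the rich ones: they carry
    almost all triangles and number at most (1 - h + eps) m^2 / 2. Counting all
    m^2 / 2 pairs instead would lose so much that the ratios vanish before r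
    points are reached when r is large. *)
Lemma four_cliques (h eps eps0 : rat) : 0 < h -> 3 * h <= 1 -> 0 <= eps -> 0 <= eps0 ->
  (edges (fun x y : V => rich p eps0 [set x; y]))%:R <= (1 - h + eps) * #|V|%:R ^+ 2 ->
  ((1 - h) * (1 - 2 * h) - eps) * #|V|%:R ^+ 3 <= 6 * (nsets (mono p) 3)%:R ->
  (2 - 6 * h) * #|V|%:R * (nsets (mono p) 3)%:R - (eps0 + eps) * #|V|%:R ^+ 4 <=
    8 * (nsets (mono p) 4)%:R.
Proof.
move=> h0 h1 e e0 HE Hk.
have := moon_moser_lin ((1 - 2 * h) * #|V|%:R) (rich p eps0) (@mono_glues _ _ _ p 2 isT).
set k3 := (nsets _ 3)%:R in Hk *; set k4 := (nsets _ 4)%:R; set m := #|V|%:R in HE Hk *.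
set S := (\sum_(C | _) extn _ C)%:R; set E := #|[set C | _ && _]|%:R. 
have m0 : 0 <= m by exact: ler0n.
have EE : 2 * E <= (1 - h + eps) * m ^+ 2.
  apply: le_trans HE; rewrite /E -natrM ler_nat cardsE -sum1_card big_mkcondr /=.
  rewrite sum_card2; apply: leq_sum => x _; rewrite big_mkcond.
  by apply: leq_sum => y _; case: ifP => //= _; rewrite mem_fun; case: ifP.
have PP : 2 * #|[set C : {set V} | #|C| == 2]|%:R <= m ^+ 2.
  rewrite -natrM cardsE -sum1_card (sum_card2 (fun=> 1%N)) /m -natrX ler_nat.
  rewrite expnS expn1 -sum_nat_const; apply: leq_sum => x _.
  by rewrite sum1_card max_card.
have SS : 3 * k3 <= S + eps0 * m * (m ^+ 2 / 2).
  have -> : 3 * k3 = S + (\sum_(C : {set V} | (#|C| == 2) && ~~ rich p eps0 C)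
                             extn (mono p) C)%N%:R.
    by rewrite /S /k3 -(natrM _ 3) -sum_extn1 [in LHS](bigID (rich p eps0)) natrD.
  rewrite lerD2l.
  apply: le_trans (_ : eps0 * m * #|[set C : {set V} | #|C| == 2]|%:R <= _); last first.
    by apply: ler_wpM2l; rewrite ?mulr_ge0 //; lra.
  rewrite cardsE -sum1_card !natr_sum big_distrr /= big_mkcondr /=.
  apply: ler_sum => C _; rewrite mulr1; case: ifP => [|_]; last by rewrite mulr_ge0.
  by rewrite -ltNge => /ltW.
move=> MM.
have k30 : 0 <= k3 by rewrite ler0n.
have a0 : 0 <= 1 - 2 * h by lra.
have a1 : 1 - 2 * h <= 1 by lra.
set a := 1 - 2 * h in a0 a1 MM Hk.
have am : 0 <= a * m by rewrite mulr_ge0.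
have m2 : 0 <= m ^+ 2 by rewrite exprn_ge0.
have m4 : 0 <= m ^+ 4 by rewrite exprn_ge0.
have S1 := ler_wpM2l am SS.
have S2 := ler_wpM2l (sqr_ge0 (a * m)) EE.
have S3 := ler_wpM2l am Hk.
have e4 : 0 <= eps * m ^+ 4 by rewrite mulr_ge0.
have e04 : 0 <= eps0 * m ^+ 4 by rewrite mulr_ge0.
have T1 : a * (eps * m ^+ 4) <= eps * m ^+ 4 by rewrite ler_piMl.
have T2 : a * (eps0 * m ^+ 4) <= eps0 * m ^+ 4 by rewrite ler_piMl.
have T3 : a * (a * (eps * m ^+ 4)) <= eps * m ^+ 4.
  by apply: le_trans T1; apply: ler_wpM2l => //; apply: ler_piMl.
have -> : 2 - 6 * h = 3 * a - 1 by rewrite /a; ring.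
have -> : (eps0 + eps) * m ^+ 4 = eps0 * m ^+ 4 + eps * m ^+ 4 by ring.
have {}MM : 2 * (a * m * S) - (a * m) ^+ 2 * E <= m * k3 + 8 * k4.
  by apply: le_trans (le_trans MM _); rewrite le_eqVlt; apply/orP; left; apply/eqP; ring.
have {}S1 : 3 * (a * m * k3) <= a * m * S + a * (eps0 * m ^+ 4) / 2.
  by apply: le_trans (le_trans S1 _); rewrite le_eqVlt; apply/orP; left; apply/eqP; field.
have {}S2 : 2 * ((a * m) ^+ 2 * E) <= a * a * (1 - h) * m ^+ 4 + a * (a * (eps * m ^+ 4)).
  by apply: le_trans (le_trans S2 _); rewrite le_eqVlt; apply/orP; left; apply/eqP; ring.
have {}S3 : a * a * (1 - h) * m ^+ 4 - a * (eps * m ^+ 4) <= 6 * (a * m * k3).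
  by apply: le_trans (le_trans S3 _); rewrite le_eqVlt; apply/orP; left; apply/eqP; ring.
have -> : (3 * a - 1) * m * k3 = 3 * (a * m * k3) - m * k3 by ring.
lra.
Qed.
End CodegreeStep.

Definition unit_blocks (R : realType) d (V : finType) (p : V -> 'rV[R]_d) r (t : nat)
    (A : 'I_r -> {set V}) (L : R) :=
  (forall i, #|A i| = t) /\
  forall i j, i != j -> {in A i & A j, forall x y, sqd (p x) (p y) = L}.

(** The ratios give a positive proportion of equidistant r-point sets; a box of
    them consists of blocks at a single mutual distance. *)
Lemma find_unit_blocks (r t : nat) : (2 < r)%N -> (0 < t)%N ->
  exists2 eps : rat, 0 < eps & exists N : nat,
  forall (R : realType) (V : finType) (p : V -> 'rV[R]_(2 * r)), injective p ->
    (N <= #|V|)%N ->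
    (density r - eps) * #|V|%:R ^+ 3 <= 6 * (nsets (mono p) 3)%:R ->
    exists (A : 'I_r -> {set V}) (L : R), unit_blocks p t A L.
Proof.
move=> r2 t0; have [h0 h1] := inv_r_bounds r2.
have rR : r%:R * r%:R^-1 = 1 :> rat by rewrite divff // pnatr_eq0; lia.
rewrite /density; set h := r%:R^-1 in h0 h1 rR *.
(* u below is 1/r + 18 eps, and this eps keeps 1 - (r - 1) u >= 1/(2 r) *)
pose eps := h * h / 36.
have e0 : 0 < eps by rewrite /eps; nra.
have [N1 N1P] := few_rich_pairs r2 e0 e0.
pose c := (h / 2 / r%:R) ^+ (r - 3) / 54.
have r0 : 0 < r%:R :> rat by rewrite ltr0n; lia.
have c0 : 0 < c by rewrite divr_gt0 // exprn_gt0 // !divr_gt0.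
have [N2 N2P] := erdos_box r t c0.
exists eps => //; exists (N1 + N2 + 1)%N => R V p pinj NV Hk.
have [NV1 NV2 V0] : [/\ N1 <= #|V|, N2 <= #|V| & 0 < #|V|]%N by split; lia.
have HE := N1P R V p pinj NV1.
have := four_cliques h0 h1 (ltW e0) (ltW e0) HE Hk.
set k3 := (nsets _ 3)%:R in Hk *; set k4 := (nsets _ 4)%:R; set m := #|V|%:R in Hk *.
move=> H4.
have m0 : 0 < m by rewrite ltr0n.
have ee : eps <= 1 / 9 by rewrite /eps; nra.
have dd : 2 / 9 <= (1 - h) * (1 - 2 * h) by nra.
have m3 : m ^+ 3 <= 54 * k3.
  have : (1 / 9) * m ^+ 3 <= 6 * k3.
    by apply: le_trans Hk; apply: ler_wpM2r; [rewrite exprn_ge0 // ltW|lra].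
  lra.
pose u := h + 18 * eps.
have base : (1 - 3 * u) * m * k3 <= 4 * k4.
  have : m * m ^+ 3 * eps <= m * (54 * k3) * eps.
    by apply: ler_wpM2r; [rewrite ltW|apply: ler_wpM2l; rewrite // ltW].
  by rewrite -exprS /u; nra.
have := @nsets_chain V (mono p) 3 r.-1 u (h / 2) isT.
rewrite (prednK (ltnW (ltnW r2))).
move=> /(_ (fun s s3 => @mono_glues _ _ _ p s (ltnW s3)) (@mono_down _ _ _ p)).
have u0 : 0 <= u by rewrite /u; lra.
move=> /(_ u0) H.
have {H} : (h / 2 / r%:R * m) ^+ (r - 3) * k3 <= (nsets (mono p) r)%:R.
  have := H _ _ base (r - 3)%N; rewrite (subnKC r2).
  apply => //; last by rewrite divr_ge0 // ltW.
  rewrite -subn1 (natrB _ (ltnW (ltnW r2))).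
  rewrite /u mulrBl mul1r mulrDr rR /eps.
  have -> : r%:R * (18 * (h * h / 36)) = (r%:R * h) * h / 2 by field.
  rewrite rR; nra.
move=> H.
have {}H : c * m ^+ r <= #|[set f : r.-tuple V | uniq f && mono p [set x in f]]|%:R.
  apply: le_trans (le_trans _ H) _; last by rewrite ler_nat nsets_tuples.
  rewrite exprMn -[_ * _ * k3]mulrA /c (_ : m ^+ r = m ^+ (r - 3) * m ^+ 3); last first.
    by rewrite -exprD (subnK r2).
  have -> : (h / 2 / r%:R) ^+ (r - 3) / 54 * (m ^+ (r - 3) * m ^+ 3) =
     (h / 2 / r%:R) ^+ (r - 3) * (m ^+ (r - 3) * (m ^+ 3 / 54)) by ring.
  apply: ler_wpM2l; first by rewrite exprn_ge0 // !mulr_ge0 ?invr_ge0 // ltW.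
  by apply: ler_wpM2l; [rewrite exprn_ge0 // ltW|lra].
have [A At AP] := N2P V _ NV2 H.
have A0 k : (0 < #|A k|)%N by rewrite At.
pose i0 : 'I_r := Ordinal (ltn_trans (ltn0Sn _) (ltnW r2)).
pose i1 : 'I_r := Ordinal (ltnW r2).
have i01 : i0 != i1 by [].
have /card_gt0P[x0 x0A] := A0 i0; have /card_gt0P[x1 x1A] := A0 i1.
have [f [fA _ _]] := box_tuple A0 i01 x0A x1A.
pose D (g : r.-tuple V) := sqd (p (tnth g i0)) (p (tnth g i1)).
have mf g k l k' l' : (forall i, tnth g i \in A i) -> k != l -> k' != l' ->
    sqd (p (tnth g k)) (p (tnth g l)) = sqd (p (tnth g k')) (p (tnth g l')).
  move=> gA kl kl'; have /andP[/tuple_uniqP ug /monoP mg] := AP g gA.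
  by apply: mg; rewrite ?inE ?mem_tnth // (inj_eq ug).
(* changing one entry leaves two other entries, hence the side length *)
have step i x g : (forall i, tnth g i \in A i) -> x \in A i ->
    exists g' : r.-tuple V, [/\ forall i, tnth g' i \in A i, tnth g' i = x,
      forall k, k != i -> tnth g' k = tnth g k & D g' = D g].
  move=> gA xA; have [g' [g'A g'i g'k]] := box_replace gA xA.
  exists g'; split=> //.
  have [k ki _] := third_index i i r2; have [l li lk] := third_index i k r2.
  by rewrite /D (mf g' i0 i1 k l) 1?(mf g i0 i1 k l) ?g'k // eq_sym.
exists A, (D f); split=> // i j ij x y xA yA.
have [g [gA gi _ <-]] := step i x f fA xA.
have [g' [g'A g'j g'k <-]] := step j y g gA yA.
by rewrite -gi -g'j -g'k // /D; exact: mf.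
Qed.

(** * Edge, triangle and symmetric-sum inequalities *)

(** The case of parts of size 3, which is all that homogeneous blocks need. *)
Lemma erdos_stone3 (s : nat) (eps : rat) : (0 < s)%N -> 0 < eps ->
  exists N : nat, forall (V : finType) (e : rel V), symmetric e -> (N <= #|V|)%N ->
    (forall B : 'I_s.+1 -> {set V}, (forall i, #|B i| = 3) ->
      ~ (forall i j, i != j -> {in B i & B j, forall x y, e x y})) ->
    (edges e)%:R <= (1 - s%:R^-1 + eps) * #|V|%:R ^+ 2.
Proof.
move=> s0 e0; have [c c0 cP] := supersaturation s0 e0.
have [N NP] := erdos_box s.+1 3 c0.
exists N => V e es NV nobox; rewrite leNgt; apply/negP => He.
have [A A3 AP] := NP V _ NV (cP V e es (ltW He)).
apply: (nobox A A3) => i j ij x y xA yA.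
have A0 k : (0 < #|A k|)%N by rewrite A3.
have [f [fA <- <-]] := box_tuple A0 ij xA yA.
have /andP[/tuple_uniqP uf /cliqueP cf] := AP f fA.
by apply: cf; rewrite ?inE ?mem_tnth // (inj_eq uf).
Qed.

(** The Moon-Moser inequality one level down, where the sets of one vertex
    extend by edges. *)
Lemma goodman (V : finType) (e : rel V) (a : rat) : symmetric e -> 1 <= 4 * a ->
  a * #|V|%:R ^+ 2 <= (edges e)%:R ->
  a * (2 * a - 1) * #|V|%:R ^+ 3 <= 6 * (nsets (clique e) 3)%:R.
Proof.
move=> es a1 He.
have := moon_moser_lin (a * #|V|%:R) predT (clique_glues es (s := 1)).
have -> : [set C : {set V} | (#|C| == 1)%N && predT C] =
          [set C : {set V} | (#|C| == 1)%N && clique e C].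
  by apply/setP => C; rewrite !inE; case: cards1P => //= -[x ->]; rewrite clique1.
rewrite -/(nsets (clique e) 1) (nsets1 (clique1 e)).
under eq_bigl do rewrite andbT.
rewrite sum_extn1 (edgesE es).
set k3 := (nsets _ 3)%:R.
have -> : (nsets (clique e) 2)%:R = (edges e)%:R / 2 :> rat.
  by rewrite -(edgesE es) natrM mulrC mulKf.
set m := #|V|%:R in He *; set E := (edges e)%:R in He *.
have m0 : 0 <= m by exact: ler0n.
have X : m * (4 * a - 1) * (a * m ^+ 2) <= m * (4 * a - 1) * E.
  by apply: ler_wpM2l => //; rewrite mulr_ge0 //; lra.
move=> H.
have {}X : 4 * (a * a * m ^+ 3) - a * m ^+ 3 <= 4 * (a * m * E) - m * E.
  by apply: le_trans (le_trans X _); rewrite le_eqVlt; apply/orP; left; apply/eqP; ring.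
have {}H : 2 * (a * m * E) - a * a * m ^+ 3 <= m * E / 2 + 3 * k3.
  by apply: le_trans (le_trans H _); rewrite le_eqVlt; apply/orP; left; apply/eqP; field.
have -> : a * (2 * a - 1) * m ^+ 3 = 2 * (a * a * m ^+ 3) - a * m ^+ 3 by ring.
lra.
Qed.

Section SymmetricSums.
Variables (I : finType) (x : I -> rat).

Lemma cauchy_sum (P : pred I) (n : nat) : (#|P| <= n)%N -> (0 < n)%N ->
  (\sum_(i | P i) x i) ^+ 2 <= n%:R * \sum_(i | P i) x i ^+ 2.
Proof.
move=> Pn n0; have nR : 0 < n%:R :> rat by rewrite ltr0n.
set s := \sum_(i | P i) x i; set s2 := \sum_(i | P i) _.
have H : 0 <= s2 - 2 * (s * (s / n%:R)) + n%:R * (s / n%:R) ^+ 2.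
  set c := s / n%:R.
  apply: le_trans (_ : 0 <= \sum_(i | P i) (x i - c) ^+ 2) _.
    by apply: sumr_ge0 => i _; rewrite sqr_ge0.
  apply: le_trans (_ : _ <= s2 - 2 * (s * c) + #|P|%:R * c ^+ 2) _.
    rewrite le_eqVlt; apply/orP; left; apply/eqP.
    rewrite (mulr_natl (c ^+ 2) #|P|) -sumr_const /s /s2 big_distrl big_distrr /=.
    by rewrite -sumrB -big_split; apply: eq_bigr => i _ /=; ring.
  by rewrite lerD2l; apply: ler_wpM2r; rewrite ?sqr_ge0 // ler_nat.
have := mulr_ge0 (ltW nR) H.
have -> : n%:R * (s2 - 2 * (s * (s / n%:R)) + n%:R * (s / n%:R) ^+ 2) = n%:R * s2 - s ^+ 2.
  by field; rewrite gt_eqF.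
by rewrite subr_ge0.
Qed.

Lemma sum_pairs_le (P : pred I) (n : nat) : (#|P| <= n)%N -> (0 < n)%N ->
  \sum_(i | P i) \sum_(j | P j && (j != i)) x i * x j <=
    (1 - n%:R^-1) * (\sum_(i | P i) x i) ^+ 2.
Proof.
move=> Pn n0; have nR : 0 < n%:R :> rat by rewrite ltr0n.
have -> : \sum_(i | P i) \sum_(j | P j && (j != i)) x i * x j =
          (\sum_(i | P i) x i) ^+ 2 - \sum_(i | P i) x i ^+ 2.
  apply/eqP; rewrite eq_sym subr_eq -big_split /= expr2 big_distrl; apply/eqP.
  apply: eq_bigr => i Pi /=; rewrite big_distrr (bigD1 i) //= addrC; congr (_ + _).
have := cauchy_sum Pn n0; set s := \sum_(i | P i) x i; set s2 := \sum_(i | P i) _ => H.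
rewrite mulrBl mul1r lerD2l lerN2 mulrC ler_pdivrMr //; lra.
Qed.
End SymmetricSums.

(** For fixed i the other r - 1 variables contribute at most (1 - 1/(r-1)) (T -
    x_i)^2 by Cauchy-Schwarz, and x (T - x)^2 lies below its tangent at T / r on
    [0, T]. *)
Lemma maclaurin3 (r : nat) (x : 'I_r -> rat) : (2 < r)%N -> (forall i, 0 <= x i) ->
  \sum_i \sum_(j | j != i) \sum_(k | (k != i) && (k != j)) x i * x j * x k <=
    (1 - r%:R^-1) * (1 - 2 * r%:R^-1) * (\sum_i x i) ^+ 3.
Proof.
move=> r2 x0; set T := \sum_i x i.
have rR : 0 < r%:R :> rat by rewrite ltr0n (ltnW (ltnW r2)).
have r3 : 3 <= r%:R :> rat by rewrite (ler_nat _ 3).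
have r1 : r.-1%:R = r%:R - 1 :> rat by rewrite -subn1 natrB // (ltnW (ltnW r2)).
have T0 : 0 <= T by apply: sumr_ge0.
set h := r%:R^-1; have rh : r%:R * h = 1 by rewrite mulfV // gt_eqF.
have h0 : 0 < h by rewrite invr_gt0.
have h3 : 3 * h <= 1 by have := ler_wpM2r (ltW h0) r3; rewrite rh.
pose b := (1 - 2 * h) / (1 - h).
have hb : b * (1 - h) = 1 - 2 * h by rewrite divfK // gt_eqF //; lra.
have b0 : 0 <= b by rewrite divr_ge0 //; lra.
have bE : 1 - r.-1%:R^-1 = b.
  rewrite r1 /b /h; field; apply/andP; split; first by rewrite gt_eqF.
  by rewrite gt_eqF //; lra.
apply: le_trans (_ : \sum_i b * (T ^+ 3 * h * (1 - h) ^+ 2 +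
   T ^+ 2 * (1 - h) * (1 - 3 * h) * (x i - T * h)) <= _).
  apply: ler_sum => i _.
  have xT : x i <= T by rewrite /T (bigD1 i) //= lerDl sumr_ge0.
  apply: le_trans (_ : b * (x i * (T - x i) ^+ 2) <= _); last first.
    apply: ler_wpM2l => //; rewrite -subr_ge0.
    have -> : T ^+ 3 * h * (1 - h) ^+ 2 + T ^+ 2 * (1 - h) * (1 - 3 * h) * (x i - T * h)
       - x i * (T - x i) ^+ 2 = (x i - T * h) ^+ 2 * (2 * T - x i - 2 * (T * h)) by ring.
    apply: mulr_ge0; first exact: sqr_ge0.
    by have := ler_wpM2l T0 h3; lra.
  have := @sum_pairs_le _ x (fun j => j != i) r.-1.
  have -> : \sum_(j | j != i) x j = T - x i by rewrite /T [in RHS](bigD1 i) //= [x i + _]addrC addrK.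
  rewrite bE => H; have {}H A B := ler_wpM2l (x0 i) (H A B).
  apply: le_trans (le_trans (H _ _) _).
  - rewrite le_eqVlt; apply/orP; left; apply/eqP; rewrite big_distrr /=.
    apply: eq_bigr => j _; rewrite big_distrr /=.
    by apply: eq_bigr => k _; rewrite mulrA.
  - by rewrite cardC1 card_ord.
  - by rewrite -ltnS prednK ?(ltnW r2) // (ltnW (ltnW r2)).
  - by rewrite le_eqVlt; apply/orP; left; apply/eqP; ring.
rewrite -mulr_sumr big_split /= -[X in _ + X]mulr_sumr sumrB !sumr_const card_ord /= -/T.
rewrite -[(T * h) *+ r]mulr_natl -[_ *+ r]mulr_natl.
have -> : b * (r%:R * (T ^+ 3 * h * (1 - h) ^+ 2) +
   T ^+ 2 * (1 - h) * (1 - 3 * h) * (T - r%:R * (T * h))) =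
   T ^+ 3 * ((r%:R * h) * (b * (1 - h)) * (1 - h)) +
   b * T ^+ 3 * (1 - h) * (1 - 3 * h) * (1 - r%:R * h) by ring.
by rewrite rh hb le_eqVlt; apply/orP; left; apply/eqP; ring.
Qed.

Lemma erdos_pairs (c : rat) : 0 < c -> exists N : nat,
  forall (V : finType) (e : V -> V -> bool), (N <= #|V|)%N ->
    c * #|V|%:R ^+ 2 <= (\sum_x \sum_y e x y)%N%:R ->
    exists B B' : {set V}, [/\ #|B| = 3, #|B'| = 3 & {in B & B', forall x y, e x y}].
Proof.
move=> c0; have [N NP] := erdos_box 2 3 c0; exists N => V e NV H.
have [|A A3 AP] := NP V (fun f => e (tnth f ord0) (tnth f (lift ord0 ord0))) NV.
  apply: le_trans H _; rewrite ler_nat card_sum sum_tupleS.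
  apply: leq_sum => x _; rewrite sum_tupleS; apply: leq_sum => y _.
  by rewrite (big_pred1 [tuple]) // => z; apply/esym/eqP; exact: tuple0.
exists (A ord0), (A (lift ord0 ord0)); split=> // x y xA yA.
have A0 k : (0 < #|A k|)%N by rewrite A3.
have ij : ord0 != lift ord0 ord0 :> 'I_2 by [].
by have [f [fA <- <-]] := box_tuple A0 ij xA yA; exact: AP.
Qed.

(** * Points in coordinates around the center *)

Section Coord.
Variables (R : realType) (r : nat) (V : finType).
Variables (S : V -> V -> R) (q : V -> 'I_r -> R * R) (L : R).

(** Squared distance to the center, which is the origin of the coordinates q. *)
Definition sqn x := \sum_i pnorm (q x i).
Definition on_plane i x := [forall j, (j != i) ==> (q x j == 0)].
Definition on_circle i x := on_plane i x && (pnorm (q x i) == L / 2).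
Definition tri x y z := [&& x != y, S x y == S x z & S x y == S y z].
(** Ordered pairs, so that the sum over x is six times the number of triangles. *)
Definition tdeg x := (\sum_y \sum_z tri x y z)%N.
(** The relation between x and y that makes xya equilateral for the points a of
    a circle over whose center both x and y lie: such points a are at squared
    distance sqn x + L / 2 from x (S_over_center). *)
Definition adj x y := [&& x != y, S x y == sqn x + L / 2 & S x y == sqn y + L / 2].
(** The number of circles whose points are all equidistant from x and all
    equidistant from y. *)
Definition zeros x y := #|[set i | (q x i == 0) && (q y i == 0)]|.
(** The pairs that are opposite to points of r - 2 circles, as pairs on two
    circles of the Lenz configuration are. *)
Definition strong_adj x y := adj x y && (r <= zeros x y + 2)%N.
Definition hom s (B : 'I_s -> {set V}) := forall i j, i != j ->
  forall x x' y, x \in B i -> x' \in B i -> y \in B j -> S x y = S x' y.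

(** What is retained of the ambient space: S is the squared distance, q gives
    coordinates in r orthogonal planes about the center, and L / 2 is the
    squared radius of the circles. The last two fields hold because the
    dimension is 2 r: there are no r + 1 homogeneous blocks, and r homogeneous
    blocks have only one point that is equidistant from the points of each of
    them. *)
Record frame := Frame {
  SE : forall x y, S x y = \sum_i pnorm (q x i - q y i);
  S0 : forall x y, S x y = 0 -> x = y;
  L0 : 0 < L;
  no_blocks : forall B : 'I_r.+1 -> {set V}, (forall i, 2 < #|B i|)%N -> ~ hom B;
  only_center : forall (B : 'I_r -> {set V}) x, (forall i, 2 < #|B i|)%N -> hom B ->
    (forall i, {in B i &, forall y y', S x y = S x y'}) ->
    (forall i, {in B i &, forall y y', sqn y = sqn y'}) -> sqn x = 0
}.

Hypothesis r2 : (2 < r)%N.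
Hypothesis fr : frame.
Let SE := SE fr.
Let S0 := S0 fr.
Let L0 := L0 fr.

Lemma SC x y : S x y = S y x.
Proof. by rewrite !SE; apply: eq_bigr => i _; rewrite pnormBC. Qed.

Lemma Sxx x : S x x = 0.
Proof. by rewrite SE big1 // => i _; rewrite subrr; apply/eqP; rewrite pnorm_eq0. Qed.

Lemma q_inj x y : (forall i, q x i = q y i) -> x = y.
Proof.
move=> E; apply: S0; rewrite SE big1 // => i _.
by rewrite E subrr; apply/eqP; rewrite pnorm_eq0.
Qed.

Lemma sqn_eq0 x : sqn x = 0 -> forall i, q x i = 0.
Proof.
move=> /eqP; rewrite psumr_eq0 => [/allP H i|i _]; last exact: pnorm_ge0.
by have := H i (mem_index_enum _); rewrite pnorm_eq0 => /eqP.
Qed.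

Lemma on_planeP i x : reflect (forall j, j != i -> q x j = 0) (on_plane i x).
Proof.
apply: (iffP forallP) => [H j ji|H j].
  by apply/eqP; have /implyP := H j; exact.
by apply/implyP => ji; rewrite H.
Qed.

Lemma pnorm0 : pnorm (0 : R * R) = 0.
Proof. by apply/eqP; rewrite pnorm_eq0. Qed.

Lemma sqn_plane i x : on_plane i x -> sqn x = pnorm (q x i).
Proof.
move=> /on_planeP H; rewrite /sqn (bigD1 i) //= big1 ?addr0 // => j ji.
by rewrite H // pnorm0.
Qed.

Lemma S_plane i u a : on_plane i a ->
  S u a = pnorm (q u i - q a i) + \sum_(j | j != i) pnorm (q u j).
Proof.
move=> /on_planeP H; rewrite SE (bigD1 i) //=; congr (_ + _).
by apply: eq_bigr => j ji; rewrite H // subr0.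
Qed.

(** The center and the projection of u to plane i are both equidistant from the
    three points. *)
Lemma three_on_plane i u a b c : a != b -> a != c -> b != c ->
  on_plane i a -> on_plane i b -> on_plane i c ->
  sqn a = sqn b -> sqn a = sqn c -> S u a = S u b -> S u a = S u c -> q u i = 0.
Proof.
move=> ab ac bc pa pb pc.
rewrite (sqn_plane pa) (sqn_plane pb) (sqn_plane pc) => nb nc.
rewrite (S_plane u pa) (S_plane u pb) (S_plane u pc) => /addIr sb /addIr sc.
have qn x y : x != y -> on_plane i x -> on_plane i y -> q x i != q y i.
  move=> xy /on_planeP px /on_planeP py; apply: contra xy => /eqP E.
  by apply/eqP; apply: q_inj => j; have [->//|ji] := eqVneq j i; rewrite px ?py.
apply: (circumcenter_unique (qn _ _ ab pa pb) (qn _ _ ac pa pc) (qn _ _ bc pb pc));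
  by rewrite ?subr0 // pnormBC [RHS]pnormBC.
Qed.

Lemma at_most_two_on_plane i u (P : {set V}) n0 s0 : q u i != 0 ->
  (forall a, a \in P -> [/\ on_plane i a, sqn a = n0 & S u a = s0]) -> (#|P| <= 2)%N.
Proof.
move=> qu HP; rewrite leqNgt; apply/negP => /card_gt2P[a [b [c [[aP bP cP] [ab bc ca]]]]].
have [pa na sa] := HP a aP; have [pb nb sb] := HP b bP; have [pc nc sc] := HP c cP.
case/negP: qu; apply/eqP.
by apply: (three_on_plane ab _ bc pa pb pc); rewrite ?na ?nb ?nc ?sa ?sb ?sc // eq_sym.
Qed.

Lemma adjC : symmetric adj.
Proof.
by move=> x y; rewrite /adj SC eq_sym [X in _ && X]andbC.
Qed.

Lemma zerosC x y : zeros x y = zeros y x.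
Proof. by congr #|pred_of_set _|; apply/setP => i; rewrite !inE andbC. Qed.

Lemma strong_adjC : symmetric strong_adj.
Proof. by move=> x y; rewrite /strong_adj adjC zerosC. Qed.

Lemma adjP x y : adj x y -> [/\ x != y, S x y = sqn x + L / 2, S x y = sqn y + L / 2
  & sqn x = sqn y].
Proof.
move=> /and3P[xy /eqP sx /eqP sy]; split=> //.
by apply: (addIr (L / 2)); rewrite -sx.
Qed.

Lemma adjI x y : x != y -> S x y = sqn x + L / 2 -> S x y = sqn y + L / 2 -> adj x y.
Proof. by move=> xy sx sy; apply/and3P; split=> //; apply/eqP. Qed.

Lemma strong_adjE x y : strong_adj x y = adj x y && (r <= zeros x y + 2)%N.
Proof. by []. Qed.

Lemma adj_nonzero x y : adj x y -> sqn x != 0.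
Proof.
move=> /adjP[xy _ _ E]; apply: contra xy => /eqP x0; apply/eqP; apply: q_inj => i.
by rewrite (sqn_eq0 x0) (sqn_eq0 (_ : sqn y = 0)) // -E.
Qed.

Lemma zeros_lt x y : x != y -> (zeros x y < r)%N.
Proof.
rewrite ltnNge; apply: contra => H.
have HT : [set i | (q x i == 0) && (q y i == 0)] = setT.
  by apply/eqP; rewrite eqEcard subsetT cardsT card_ord.
apply/eqP; apply: q_inj => i.
by have := in_setT i; rewrite -HT inE => /andP[/eqP-> /eqP->].
Qed.

Lemma on_circleE i x : on_circle i x = on_plane i x && (pnorm (q x i) == L / 2).
Proof. by []. Qed.

Lemma circle_sqn i x : on_circle i x -> sqn x = L / 2.
Proof. by move=> /andP[/sqn_plane-> /eqP]. Qed.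

Lemma circle_neq0 i x : on_circle i x -> q x i != 0.
Proof.
by move=> /andP[_ /eqP H]; rewrite -pnorm_eq0 H gt_eqF // divr_gt0.
Qed.

Lemma circle_uniq i j x : on_circle i x -> on_circle j x -> i = j.
Proof.
move=> cx /andP[/on_planeP px _]; apply/eqP; apply: contraNT (circle_neq0 cx) => ij.
by rewrite px.
Qed.

(** A point over the center of a circle is equidistant from its points. *)
Lemma S_over_center i x a : q x i = 0 -> on_circle i a -> S x a = sqn x + L / 2.
Proof.
move=> xi /andP[pa /eqP na]; rewrite (S_plane x pa) xi pnormBC subr0 na.
by rewrite /sqn [in RHS](bigD1 i) //= xi pnorm0 add0r addrC.
Qed.

Lemma S_circles i j x y : i != j -> on_circle i x -> on_circle j y -> S x y = L.
Proof.
move=> ij cx cy; have /andP[/on_planeP px _] := cx.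
rewrite (S_over_center _ cy) ?px 1?eq_sym // (circle_sqn cx); lra.
Qed.

Lemma at_most_two_on_circle i x s0 : q x i != 0 ->
  (#|[set y | on_circle i y && (S x y == s0)]| <= 2)%N.
Proof.
move=> cx; apply: (at_most_two_on_plane (n0 := L / 2) (s0 := s0) cx) => a.
by rewrite inE => /andP[ca /eqP]; split=> //; [case/andP: ca|exact: circle_sqn ca].
Qed.

End Coord.

(** * Pairs seen by the blocks *)

Section Coord2.
Variables (R : realType) (r : nat) (V : finType).
Variables (S : V -> V -> R) (q : V -> 'I_r -> R * R) (L : R).
Hypothesis r2 : (2 < r)%N.
Hypothesis fr : frame S q L.
Local Notation adj := (adj S q L).
Local Notation strong_adj := (strong_adj S q L).
Local Notation tri := (tri S).
Local Notation on_circle := (on_circle q L).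

(** If adj x y holds, then y alone determines S x y. *)
Lemma adj_no_box (B : 'I_r.+1 -> {set V}) : (forall i, #|B i| = 3) ->
  ~ (forall i j, i != j -> {in B i & B j, forall x y, adj x y}).
Proof.
move=> B3 H; apply: (no_blocks fr (B := B)) => [i|i j ij x x' y xB x'B yB].
  by rewrite B3.
have [_ _ -> _] := adjP (H _ _ ij _ _ xB yB).
by have [_ _ -> _] := adjP (H _ _ ij _ _ x'B yB).
Qed.

Lemma tri_neq a x y : tri a x y -> x != y.
Proof.
move=> /and3P[ax /eqP s1 /eqP s2]; apply: contra ax => /eqP xy; apply/eqP.
by apply: (S0 fr); rewrite s2 xy; exact: Sxx fr _.
Qed.

Section Count.
Variables (A : 'I_r -> {set V}) (t : nat).
Hypothesis At : forall i, #|A i| = t.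
Hypothesis Ac : forall i, {in A i, forall x, on_circle i x}.

Local Open Scope nat_scope.

(** Three apices in one block force x and y to lie over the center of its
    circle. *)
Lemma block_count i x y : \sum_(a in A i) tri a x y <=
  2 + t * (adj x y && ((q x i == 0%R) && (q y i == 0%R))).
Proof.
have [|lt2] := leqP (\sum_(a in A i) tri a x y) 2; first by move/leq_trans; apply; exact: leq_addr.
suff -> : adj x y && ((q x i == 0%R) && (q y i == 0%R)).
  rewrite muln1 -(At i) -sum1_card; apply: leq_trans (leq_addl _ _).
  by apply: leq_sum => a _; case: (tri a x y).
have : 2 < #|[set a in A i | tri a x y]|.
  by apply: leq_trans lt2 _; rewrite cardsE -sum1_card big_mkcondr; apply: leq_sum => a _;
     case: (tri a x y).
case/card_gt2P => a [b [c [[]]]]; rewrite !inE => /andP[aA ta] /andP[bA tb] /andP[cA tc].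
move=> [ab bc ca].
have ac : a != c by rewrite eq_sym.
have xy := tri_neq ta.
have sx e : e \in A i -> tri e x y -> S x e = S x y.
  by move=> _ /and3P[_ _ /eqP <-]; rewrite (SC fr).
have sy e : e \in A i -> tri e x y -> S y e = S x y.
  by move=> _ /and3P[_ /eqP s1 /eqP s2]; rewrite (SC fr y e) -s1 s2.
have pl e : e \in A i -> on_plane q i e by move=> /Ac/andP[].
have sq e : e \in A i -> sqn q e = (L / 2)%R by move=> /Ac/circle_sqn.
have q0 u : (forall e, e \in A i -> tri e x y -> S u e = S x y) -> q u i = 0%R.
  move=> H; apply: (three_on_plane fr ab ac bc (pl _ aA) (pl _ bA) (pl _ cA)); rewrite ?sq //;
    by rewrite !H.
have qx := q0 x sx; have qy := q0 y sy.
rewrite qx qy !eqxx !andbT; apply: adjI => //.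
  by rewrite -(sx a aA ta) (S_over_center fr qx (Ac aA)).
by rewrite -(sy a aA ta) (S_over_center fr qy (Ac aA)).
Qed.

(** If x and y have r - 1 common zeros, they lie in the same plane, and y is on
    a circle about the center at a prescribed distance from x. *)
Lemma near_count x : #|[set y | adj x y && (r <= zeros q x y + 1)]| <= 2.
Proof.
case: (set_0Vmem [set y | adj x y && (r <= zeros q x y + 1)]) => [->|[y0]]; first by rewrite cards0.
rewrite inE => /andP[a0 _].
have [i qi] : exists i, q x i != 0%R.
  case: (pickP (fun i => q x i != 0%R)) => [i qi|no]; first by exists i.
  case/negP: (adj_nonzero fr a0); rewrite /sqn big1 // => i _.
  by have /negbT := no i; rewrite negbK => /eqP->; exact: pnorm0.
apply: (at_most_two_on_plane fr (n0 := sqn q x) (s0 := (sqn q x + L / 2)%R) qi) => y.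
rewrite inE => /andP[/adjP[xy sx sy nxy] zy]; split=> //; last first.
apply/on_planeP => j ji.
suff zE : [set k | (q x k == 0%R) && (q y k == 0%R)] = [set~ i].
  have : j \in [set~ i] by rewrite !inE.
  by rewrite -zE inE => /andP[_ /eqP].
apply/eqP; rewrite eqEcard cardsC1 card_ord; apply/andP; split.
  by apply/subsetP => k; rewrite !inE => /andP[qk _]; apply: contraNneq qi => <-.
by rewrite -ltnS prednK ?(ltnW (ltnW r2)) // -addn1.
Qed.

(** Triangles with a vertex in the blocks, counted by the opposite pair (x, y).
    Up to a bounded error the pair is seen t times for each common zero, and
    apart from 2 m pairs there are at most r - 2 common zeros. *)
Lemma total_block_count : \sum_i \sum_(a in A i) tdeg S a <=
  2 * r * #|V| ^ 2 + t * ((r - 3) * edges adj + edges strong_adj + 2 * #|V|).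
Proof.
apply: (@leq_trans (\sum_x \sum_y \sum_i \sum_(a in A i) tri a x y)).
  rewrite [leqRHS](eq_bigr (fun x => \sum_i \sum_y \sum_(a in A i) tri a x y)); last first.
    by move=> x _; rewrite exchange_big.
  rewrite [leqRHS]exchange_big /=; apply: leq_sum => i _.
  rewrite exchange_big /=; apply: leq_sum => x _.
  by rewrite exchange_big.
apply: (@leq_trans (\sum_x \sum_y (2 * r + t * ((r - 3) * adj x y + strong_adj x y +
    (y \in [set y | adj x y && (r <= zeros q x y + 1)]))))).
  apply: leq_sum => x _; apply: leq_sum => y _.
  apply: (@leq_trans (\sum_i (2 + t * (adj x y && ((q x i == 0%R) && (q y i == 0%R)))))).
    by apply: leq_sum => i _; exact: block_count.
  rewrite big_split /= sum_nat_const card_ord mulnC leq_add2l -big_distrr /= leq_mul2l.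
  apply/orP; right; rewrite inE strong_adjE.
  case axy: (adj x y) => /=; last by rewrite big1.
  have zr : zeros q x y < r by apply: (zeros_lt fr); have [] := adjP axy.
  apply: leq_trans (_ : zeros q x y <= _).
    by rewrite /zeros cardsE -sum1_card [leqRHS]big_mkcond; apply: leq_sum => i _; rewrite mem_fun; case: ifP.
  rewrite muln1; case: (leqP r (zeros q x y + 2)); case: (leqP r (zeros q x y + 1)) => /=; lia.
have -> : \sum_x \sum_y (2 * r + t * ((r - 3) * adj x y + strong_adj x y +
    (y \in [set y | adj x y && (r <= zeros q x y + 1)]))) =
  2 * r * #|V| ^ 2 + t * ((r - 3) * edges adj + edges strong_adj +
    \sum_x #|[set y | adj x y && (r <= zeros q x y + 1)]|).
  have -> : edges adj = \sum_x \sum_y adj x y.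
    apply: eq_bigr => x _; apply: eq_bigr => y _.
    by case axy: (adj x y); rewrite ?andbF //; have [-> _ _ _] := adjP axy.
  have -> : edges strong_adj = \sum_x \sum_y strong_adj x y.
    apply: eq_bigr => x _; apply: eq_bigr => y _; rewrite strong_adjE.
    by case axy: (adj x y); rewrite ?andbF //; have [-> _ _ _] := adjP axy.
  have -> : 2 * r * #|V| ^ 2 = \sum_(x : V) \sum_(y : V) 2 * r.
    by rewrite !sum_nat_const; ring.
  rewrite [(r - 3) * _]big_distrr /= -!big_split big_distrr /= -big_split /=.
  apply: eq_bigr => x _; rewrite card_sum big_distrr /= -!big_split big_distrr /= -big_split /=.
  by apply: eq_bigr => y _; rewrite inE.
rewrite leq_add2l leq_mul2l; apply/orP; right; rewrite leq_add2l mulnC -sum_nat_const.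
by apply: leq_sum => x _; exact: near_count.
Qed.

End Count.

Definition support x := [set i | q x i != 0].

Lemma strong_adj_support x y : strong_adj x y -> (#|support x :|: support y| <= 2)%N.
Proof.
rewrite strong_adjE => /andP[_ zr].
have -> : support x :|: support y = ~: [set i | (q x i == 0) && (q y i == 0)].
  by apply/setP => i; rewrite !inE negb_and.
by have := cardsC [set i | (q x i == 0) && (q y i == 0)]; rewrite card_ord -/(zeros q x y); lia.
Qed.

Lemma support0 (W : {set 'I_r}) x i : support x \subset W -> i \notin W -> q x i = 0.
Proof.
move=> sW iW; apply/eqP; apply: contraNT iW => qi.
by apply: (subsetP sW); rewrite inE.
Qed.

(** The neighbours of a point off the circles live in one 4-space. If two
    coordinates of x are nonzero, these are the only nonzero coordinates of its
    neighbours. If only coordinate i is, every neighbour has it nonzero too,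
    because a neighbour orthogonal to x would put x on its circle; and B
    contains a point with a second nonzero coordinate j, since at most two
    points of plane i are at the required distance from x. The neighbours of
    that point are confined to i and j. *)
Lemma common_support x (B B' : {set V}) : (forall i, ~~ on_circle i x) ->
  (2 < #|B|)%N -> (2 < #|B'|)%N ->
  {in B, forall b, strong_adj x b} -> {in B', forall b, strong_adj x b} ->
  {in B & B', forall b b', strong_adj b b'} ->
  exists2 W : {set 'I_r}, (#|W| <= 2)%N &
    [/\ support x \subset W, {in B, forall b, support b \subset W} &
        {in B', forall b, support b \subset W}].
Proof.
move=> xC B3 B'3 xB xB' BB'.
have strong_adj_adj y z : strong_adj y z -> adj y z by rewrite strong_adjE => /andP[].
have full (W : {set 'I_r}) y z : (2 <= #|W|)%N -> W \subset support y -> strong_adj y z -> support y :|: support z = W.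
  move=> W2 Wy /strong_adj_support yz; apply/esym/eqP; rewrite eqEcard (leq_trans yz W2) andbT.
  by apply: subset_trans Wy (subsetUl _ _).
have [s2|s1] := leqP 2 #|support x|.
  exists (support x).
    have /card_gt0P[b /xB/strong_adj_support] : (0 < #|B|)%N by apply: ltn_trans B3.
    by apply: leq_trans; apply: subset_leq_card; exact: subsetUl.
  by split=> // b; [move/xB|move/xB'] => /(full _ _ _ s2 (subxx _)) <-; exact: subsetUr.
have [i qi] : exists i, q x i != 0.
  case: (pickP (fun i => q x i != 0)) => [i qi|no]; first by exists i.
  have /card_gt0P[b /xB/strong_adj_adj/(adj_nonzero fr)/negP[]] : (0 < #|B|)%N by exact: ltn_trans B3.
  rewrite /sqn big1 // => i _.
  by have /negbT := no i; rewrite negbK => /eqP->; exact: pnorm0.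
have sx : support x = [set i].
  apply/esym/eqP; rewrite eqEcard cards1 -ltnS s1 andbT.
  by apply/subsetP => j; rewrite !inE => /eqP->.
have px : on_plane q i x.
  by apply/on_planeP => j ji; apply: (support0 (W := [set i])); rewrite ?sx ?inE.
have iy y : strong_adj x y -> i \in support y.
  move=> /strong_adj_adj/adjP[_ sxy _ nxy]; rewrite inE; apply: contra (xC i) => /eqP qy.
  rewrite on_circleE px /= -(sqn_plane px).
  have : S y x = sqn q y + sqn q x.
    rewrite (S_plane fr y px) qy pnormBC subr0 -(sqn_plane px) addrC; congr (_ + _).
    by rewrite /sqn [RHS](bigD1 i) //= qy pnorm0 add0r.
  by rewrite (SC fr) sxy nxy => /addrI/eqP; rewrite eq_sym -nxy.
have wide (C : {set V}) : (2 < #|C|)%N -> {in C, forall b, strong_adj x b} ->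
    exists2 b, b \in C & (2 <= #|support b|)%N.
  move=> C3 xCC.
  case: (pickP (fun b => (b \in C) && (2 <= #|support b|)%N)) => [b /andP[bC b2]|no].
    by exists b.
  have Cp b : b \in C -> [/\ on_plane q i b, sqn q b = sqn q x & S x b = sqn q x + L / 2].
    move=> bC; have xb := xCC b bC; have [_ s _ n] := adjP (strong_adj_adj _ _ xb); split=> //.
    have : support b = [set i].
      apply/esym/eqP; rewrite eqEcard cards1 sub1set iy //=.
      by have := no b; rewrite bC /= => /negbT; rewrite -ltnNge.
    by move=> sb; apply/on_planeP => j ji; apply: (support0 (W := [set i])); rewrite ?sb ?inE.
  by have := at_most_two_on_plane fr qi Cp; rewrite leqNgt C3.
have [b bB b2] := wide B B3 xB.
have [b' b'B b'2] := wide B' B'3 xB'.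
have EB' c : c \in B' -> support c \subset support b.
  by move=> cB; rewrite -(full _ _ _ b2 (subxx _) (BB' b c bB cB)); exact: subsetUr.
have sbb' : support b' = support b.
  apply/eqP; rewrite eqEcard EB' //=; apply: leq_trans b'2.
  apply: leq_trans (strong_adj_support (xB b bB)); apply: subset_leq_card; exact: subsetUr.
exists (support b).
  apply: leq_trans (strong_adj_support (xB b bB)); apply: subset_leq_card; exact: subsetUr.
split=> // [|c cB]; first by rewrite sx sub1set iy // xB.
rewrite -sbb' -(full _ _ _ b'2 (subxx _) (_ : strong_adj b' c)) ?subsetUr //.
by rewrite strong_adjC //; exact: BB'.
Qed.

Lemma cover_by_pair (W : {set 'I_r}) : (#|W| <= 2)%N ->
  exists i j, i != j /\ W \subset [set i; j].
Proof.
move=> W2; pose i0 : 'I_r := Ordinal (ltn_trans (ltn0Sn _) (ltnW r2)).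
case: (set_0Vmem W) => [->|[i iW]].
  by have [j ij _] := third_index i0 i0 r2; exists j, i0; rewrite sub0set.
case: (set_0Vmem (W :\ i)) => [E|[j]].
  have [j ij _] := third_index i i r2; exists j, i; split=> //.
  by rewrite -(setD1K iW) E setU0 sub1set !inE eqxx orbT.
rewrite !inE => /andP[ji jW]; exists j, i; split=> //.
have sub : [set j; i] \subset W by apply/subsetP => k; rewrite !inE => /orP[]/eqP->.
suff -> : W = [set j; i] by exact: subxx.
by apply/esym/eqP; rewrite eqEcard sub cards2 ji.
Qed.

(** Otherwise B, B' and the blocks in the other r - 2 planes are r homogeneous
    blocks, and both x and the center are equidistant from the points of each of
    them; so x is the center, which has no neighbours. *)
Lemma link_free (A : 'I_r -> {set V}) x (B B' : {set V}) :
  (forall i, 2 < #|A i|)%N -> (forall i, {in A i, forall x, on_circle i x}) ->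
  (forall i, ~~ on_circle i x) -> (2 < #|B|)%N -> (2 < #|B'|)%N ->
  {in B, forall b, strong_adj x b} -> {in B', forall b, strong_adj x b} ->
  ~ {in B & B', forall b b', strong_adj b b'}.
Proof.
move=> A3 Ac xC B3 B'3 xB xB' BB'.
have strong_adj_adj y z : strong_adj y z -> adj y z by rewrite strong_adjE => /andP[].
have [W W2 [Wx WB WB']] := common_support xC B3 B'3 xB xB' BB'.
have [i [j [ij Wij]]] := cover_by_pair W2.
have off y k : support y \subset W -> k != i -> k != j -> q y k = 0.
  move=> yW ki kj; apply: (support0 yW); apply: contra ki => /(subsetP Wij).
  by rewrite !inE (negPf kj) orbF.
pose C k := if k == i then B else if k == j then B' else A k.
have C3 k : (2 < #|C k|)%N by rewrite /C; case: eqP => // _; case: eqP.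
have near y : y \in B \/ y \in B' -> [/\ support y \subset W, sqn q y = sqn q x
    & S x y = sqn q x + L / 2].
  by case=> yB; [have xy := xB y yB|have xy := xB' y yB];
    have [_ s _ n] := adjP (strong_adj_adj _ _ xy); split=> //; [exact: WB|exact: WB'].
(* squared distances between these blocks: neighbours have equal norms, hence
   pairs that involve B or B' are all at sqn x + L / 2 *)
pose val k l := if [&& k != i, k != j, l != i & l != j] then L else sqn q x + L / 2.
have val_nA k l y z : k != i -> k != j -> z \in A k -> y \in C l -> l != k ->
    S y z = val k l.
  move=> ki kj zA yC lk; rewrite /val ki kj /=; move: yC; rewrite /C.
  have [li yB|li] := eqVneq l i; first have [Wy <- _] := near y (or_introl yB).
    by rewrite /= (S_over_center fr _ (Ac k z zA)) // off.
  have [lj yB|lj] := eqVneq l j; first have [Wy <- _] := near y (or_intror yB).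
    by rewrite /= (S_over_center fr _ (Ac k z zA)) // off.
  by move=> yA; exact: (S_circles fr lk (Ac l y yA) (Ac k z zA)).
have valC k l y z : k != l -> y \in C k -> z \in C l -> S y z = val k l.
  move=> kl yC zC.
  have vC k' l' : val k' l' = val l' k'.
    by rewrite /val; case: (k' == i); case: (k' == j); case: (l' == i); case: (l' == j).
  have CA k' y' : y' \in C k' -> k' != i -> k' != j -> y' \in A k'.
    by rewrite /C => yC' /negPf ki /negPf kj; rewrite ki kj in yC'.
  have [/andP[ki kj]|k2] := boolP ((k != i) && (k != j)).
    rewrite (SC fr); apply: (val_nA k l z y ki kj (CA _ _ yC ki kj) zC).
    by rewrite eq_sym.
  have [/andP[li lj]|l2] := boolP ((l != i) && (l != j)).
    by rewrite vC; apply: (val_nA l k y z li lj (CA _ _ zC li lj) yC).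
  have -> : val k l = sqn q x + L / 2.
    by rewrite /val; move: k2; case: (k == i) => //=; case: (k == j).
  have BBv b b' : b \in B -> b' \in B' -> S b b' = sqn q x + L / 2.
    move=> bB b'B; have [_ -> _ _] := adjP (strong_adj_adj _ _ (BB' b b' bB b'B)).
    by have [_ -> _] := near b (or_introl bB).
  move: k2 l2 kl yC zC; rewrite !negb_and !negbK /C => /orP[]/eqP-> /orP[]/eqP->;
    rewrite ?eqxx //= 1?eq_sym ?(negPf ij) // 1?eq_sym ?(negPf ij) => _ yB zB.
    exact: BBv.
  by rewrite (SC fr); exact: BBv.
have hC : hom S C by move=> k l kl y y' z yC y'C zC; rewrite (valC k l) ?(valC k l y' z).
have /card_gt0P[b bB] : (0 < #|B|)%N by apply: ltn_trans B3.
have /negP := adj_nonzero fr (strong_adj_adj _ _ (xB b bB)); apply; apply/eqP.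
apply: (only_center fr C3 hC) => k.
  suff H y : y \in C k -> S x y = sqn q x + L / 2 by move=> y y' yC y'C; rewrite !H.
  rewrite /C; have [_ yB|ki] := eqVneq k i; first by have [] := near y (or_introl yB).
  have [_ yB|kj] := eqVneq k j; first by have [] := near y (or_intror yB).
  by move=> yA; rewrite (S_over_center fr _ (Ac k y yA)) // off.
suff [c H] : exists c, forall y, y \in C k -> sqn q y = c.
  by move=> y y' yC y'C; rewrite !H.
rewrite /C; have [_|ki] := eqVneq k i.
  by exists (sqn q x) => y yB; have [] := near y (or_introl yB).
have [_|kj] := eqVneq k j.
  by exists (sqn q x) => y yB; have [] := near y (or_intror yB).
by exists (L / 2) => y /Ac/circle_sqn.
Qed.
End Coord2.

(** * Counting triangles by circles *)

Section Sums.
Variable V : finType.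
Local Open Scope nat_scope.

Lemma card_in (X : {set V}) : #|X| = \sum_x (x \in X).
Proof. by rewrite -sum1_card big_mkcond. Qed.

Lemma sum_in_in (X Y : {set V}) : \sum_x \sum_y (x \in X) * (y \in Y) = #|X| * #|Y|.
Proof. by rewrite -big_distrlr /= -!card_in. Qed.

Lemma sum_le_card (X : {set V}) (f : V -> nat) n : (forall x, f x <= n) ->
  (forall x, x \notin X -> f x = 0) -> \sum_x f x <= #|X| * n.
Proof.
move=> fn f0; rewrite mulnC card_in big_distrr; apply: leq_sum => x _ /=.
by case xX: (x \in X); rewrite ?muln1 // f0 ?xX.
Qed.
End Sums.

Section Coord3.
Variables (R : realType) (r : nat) (V : finType).
Variables (S : V -> V -> R) (q : V -> 'I_r -> R * R) (L : R).
Hypothesis r2 : (2 < r)%N.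
Hypothesis fr : frame S q L.
Local Notation adj := (adj S q L).
Local Notation strong_adj := (strong_adj S q L).
Local Notation tri := (tri S).
Local Notation on_circle := (on_circle q L).

Definition circle i := [set x | on_circle i x].
Definition off := [set x | [forall i, ~~ on_circle i x]].
Definition spread (P : pred 'I_r) :=
  (\sum_(i | P i) \sum_(j | P j && (j != i)) #|circle i| * #|circle j|)%N.

Lemma offP x : reflect (forall i, ~~ on_circle i x) (x \in off).
Proof. by rewrite inE; exact: forallP. Qed.

Lemma circleI x : x \notin off -> exists i, x \in circle i.
Proof. by rewrite inE negb_forall => /existsP[i]; rewrite negbK => xi; exists i; rewrite inE. Qed.

Lemma in_circle i x : (x \in circle i) = on_circle i x.
Proof. exact: in_set. Qed.

Lemma circle_disj i j x : x \in circle i -> x \in circle j -> i = j.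
Proof. by rewrite !in_circle; exact: circle_uniq fr _ _ _. Qed.

Local Open Scope nat_scope.

Lemma sum_circles : \sum_i #|circle i| + #|off| = #|V|.
Proof.
rewrite card_in; under eq_bigr do rewrite card_in.
rewrite exchange_big -big_split -sum1_card /=; apply: eq_bigr => x _.
case: (boolP (x \in off)) => [xo|/circleI[i xi]].
  by rewrite big1 // => i _; rewrite in_circle (negPf (offP _ xo i)).
rewrite (bigD1 i) //= xi big1 // => j ji.
by case xj: (x \in circle j) => //; rewrite (circle_disj xi xj) eqxx in ji.
Qed.

Definition link x := \sum_y \sum_z [&& strong_adj x y, strong_adj x z & strong_adj y z].
Definition same x y := [exists i, (x \in circle i) && (y \in circle i)] && adj x y.

Lemma same_le x : \sum_y same x y <= 2.
Proof.
rewrite -card_sum; case: (boolP (x \in off)) => [xo|/circleI[i xi]].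
  rewrite (_ : [set _ | _] = set0) ?cards0 //; apply/setP => y; rewrite !inE.
  by apply/negP => /andP[/existsP[i]]; rewrite in_circle (negPf (offP _ xo i)).
have ci : on_circle i x by rewrite -in_circle.
apply: leq_trans (at_most_two_on_circle fr (sqn q x + L / 2)%R (circle_neq0 fr ci)).
apply: subset_leq_card; apply/subsetP => y; rewrite !inE.
move=> /andP[/existsP[j /andP[xj yj]] /adjP[_ /eqP-> _ _]]; rewrite andbT.
by move: yj; rewrite -(circle_disj xi xj) in_circle.
Qed.

(** A triangle with all vertices on the circles either has them on three
    distinct circles, or contains an edge between two points of one circle, and
    a point has at most two such neighbours. *)
Lemma strong_triangles : 6 * nsets (clique strong_adj) 3 <= 3 * (\sum_(x in off) link x) + 6 * #|V| ^ 2
  + \sum_i \sum_(j | j != i) \sum_(k | (k != i) && (k != j)) #|circle i| * #|circle j| * #|circle k|.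
Proof.
have hs := strong_adjC fr.
rewrite nsets_sum sum_card3.
pose h x y z : nat := [&& strong_adj x y, strong_adj x z & strong_adj y z].
pose d x y z := \sum_i \sum_(j | j != i) \sum_(k | (k != i) && (k != j))
  (x \in circle i) * (y \in circle j) * (z \in circle k).
apply: (@leq_trans (\sum_x \sum_y \sum_z ((x \in off) * h x y z + (y \in off) * h y x z +
   (z \in off) * h z x y + (same x y + same x z + same y z) + d x y z))).
  apply: leq_sum => x _; rewrite big_mkcond; apply: leq_sum => y _.
  case: ifP => // xy; rewrite big_mkcond; apply: leq_sum => z _.
  case: ifP => // /andP[xz yz]; rewrite clique3 // -/(h x y z).
  have hC : h y x z = h x y z by rewrite /h (hs y x); congr nat_of_bool; rewrite [strong_adj y z && _]andbC.
  have hC' : h z x y = h x y z.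
    by rewrite /h (hs z x) (hs z y); case: (strong_adj x y); case: (strong_adj x z); case: (strong_adj y z).
  rewrite hC hC'.
  case: (boolP (x \in off)) => [_|/circleI[i xi]]; first by rewrite mul1n -!addnA leq_addr.
  case: (boolP (y \in off)) => [_|/circleI[j yj]]; first by rewrite mul1n mul0n add0n -!addnA leq_addr.
  case: (boolP (z \in off)) => [_|/circleI[k zk]].
    by rewrite mul1n !mul0n !add0n -!addnA leq_addr.
  rewrite !mul0n !add0n /h.
  case xya: (strong_adj x y) => //; case xza: (strong_adj x z) => //; case yza: (strong_adj y z) => //=.
  have strong_adj_adj a b : strong_adj a b -> adj a b by rewrite strong_adjE => /andP[].
  have [ij|ij] := eqVneq i j.
    suff -> : same x y by rewrite -!addnA leq_addr.
    by rewrite /same (strong_adj_adj _ _ xya) andbT; apply/existsP; exists i; rewrite xi ij yj.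
  have [ik|ik] := eqVneq i k.
    suff -> : same x z by rewrite -!addnA addnCA leq_addr.
    by rewrite /same (strong_adj_adj _ _ xza) andbT; apply/existsP; exists i; rewrite xi ik zk.
  have [jk|jk] := eqVneq j k.
    suff -> : same y z by rewrite -addnA addnCA leq_addr.
    by rewrite /same (strong_adj_adj _ _ yza) andbT; apply/existsP; exists j; rewrite yj jk zk.
  apply: leq_trans (leq_addl _ _).
  rewrite /d (bigD1 i) //= (bigD1 j) 1?eq_sym //= (bigD1 k) //=; last by rewrite !(eq_sym k) ik jk.
  by rewrite xi yj zk.
have E1 : \sum_x \sum_y \sum_z (x \in off) * h x y z = \sum_(x in off) link x.
  rewrite [RHS]big_mkcond; apply: eq_bigr => x _.
  case: (x \in off); last by rewrite big1 // => y _; rewrite big1.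
  by rewrite /link; apply: eq_bigr => y _; apply: eq_bigr => z _; rewrite mul1n.
have E2 : \sum_x \sum_y \sum_z (y \in off) * h y x z = \sum_(x in off) link x.
  by rewrite exchange_big.
have E3 : \sum_x \sum_y \sum_z (z \in off) * h z x y = \sum_(x in off) link x.
  rewrite -E1; under eq_bigr do rewrite exchange_big; rewrite exchange_big /=.
  by apply: eq_bigr => x _; rewrite exchange_big.
have E4 : \sum_x \sum_y \sum_z (same x y + same x z + same y z) <= 6 * #|V| ^ 2.
  under eq_bigr do under eq_bigr do rewrite !big_split /=.
  under eq_bigr do rewrite !big_split /=.
  rewrite !big_split /= (_ : 6 * #|V| ^ 2 = #|V| * (#|V| * 2) + #|V| * (#|V| * 2) + #|V| * (#|V| * 2));
    last by ring.
  apply: leq_add; [apply: leq_add|].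
  - rewrite -sum_nat_const; apply: leq_sum => x _.
    rewrite exchange_big -sum_nat_const; apply: leq_sum => z _; exact: same_le.
  - rewrite -sum_nat_const; apply: leq_sum => x _.
    rewrite -sum_nat_const; apply: leq_sum => z _; exact: same_le.
  - rewrite -sum_nat_const; apply: leq_sum => x _.
    rewrite -sum_nat_const; apply: leq_sum => z _; exact: same_le.
have E5 : \sum_x \sum_y \sum_z d x y z = \sum_i \sum_(j | j != i)
    \sum_(k | (k != i) && (k != j)) #|circle i| * #|circle j| * #|circle k|.
  rewrite /d.
  under eq_bigr do under eq_bigr do rewrite exchange_big.
  under eq_bigr do rewrite exchange_big.
  rewrite exchange_big; apply: eq_bigr => i _ /=.
  under eq_bigr do under eq_bigr do rewrite exchange_big.
  under eq_bigr do rewrite exchange_big.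
  rewrite exchange_big; apply: eq_bigr => j ij /=.
  under eq_bigr do under eq_bigr do rewrite exchange_big.
  under eq_bigr do rewrite exchange_big.
  rewrite exchange_big; apply: eq_bigr => k _ /=.
  under eq_bigr do under eq_bigr do rewrite -big_distrr /= -card_in.
  under eq_bigr do rewrite -big_distrl /=.
  by rewrite -big_distrl /= sum_in_in.
have sum3D (f g : V -> V -> V -> nat) : \sum_x \sum_y \sum_z (f x y z + g x y z) =
    \sum_x \sum_y \sum_z f x y z + \sum_x \sum_y \sum_z g x y z.
  rewrite -big_split; apply: eq_bigr => x _; rewrite -big_split.
  by apply: eq_bigr => y _; rewrite -big_split.
rewrite 4!sum3D E1 E2 E3 E5 leq_add2r.
by rewrite (_ : 3 * _ = \sum_(x in off) link x + \sum_(x in off) link x +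
  \sum_(x in off) link x) ?leq_add2l //; ring.
Qed.

Lemma off_pairs : \sum_y \sum_z ((y \in off) + (z \in off)) = 2 * #|off| * #|V|.
Proof.
under eq_bigr do rewrite big_split /= -card_in sum_nat_const.
by rewrite big_split /= sum_nat_const -big_distrr /= -card_in; ring.
Qed.

Lemma spread_pairs (P : pred 'I_r) : \sum_y \sum_z \sum_(i | P i) \sum_(j | P j && (j != i))
  (y \in circle i) * (z \in circle j) = spread P.
Proof.
under eq_bigr do rewrite exchange_big.
rewrite exchange_big; apply: eq_bigr => i _ /=.
under eq_bigr do rewrite exchange_big.
rewrite exchange_big; apply: eq_bigr => j _ /=.
exact: sum_in_in.
Qed.

(** A point of a circle has at most two points of this circle at a given
    distance. *)
Lemma chord_pairs i (s0 : V -> R) :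
  \sum_y \sum_z (y \in circle i) * ((z \in circle i) && (S y z == s0 y)) <= #|circle i| * 2.
Proof.
apply: sum_le_card => y; last by move=> /negPf->; rewrite big1.
rewrite -big_distrr /= -card_sum; case yi: (y \in circle i); rewrite ?mul0n // mul1n.
rewrite in_circle in yi; apply: leq_trans (at_most_two_on_circle fr (s0 y) (circle_neq0 fr yi)).
by apply: subset_leq_card; apply/subsetP => z; rewrite !inE.
Qed.

Lemma cross_pairs (X : {set V}) i u s0 : q u i != 0%R ->
  \sum_y \sum_z (y \in X) * ((z \in circle i) && (S u z == s0)) <= #|X| * 2.
Proof.
move=> ui; apply: sum_le_card => y; last by move=> /negPf->; rewrite big1.
rewrite -big_distrr /= -card_sum; case: (y \in X); rewrite ?mul0n // mul1n.
apply: leq_trans (at_most_two_on_circle fr s0 ui).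
by apply: subset_leq_card; apply/subsetP => z; rewrite !inE.
Qed.

(** The side of an equilateral triangle inscribed in the circle is determined by
    the radius, which leaves two choices for y; the point z is then the other
    one at this distance from y. *)
Lemma inscribed_pairs i x : x \in circle i ->
  \sum_y \sum_z [&& y \in circle i, z \in circle i & tri x y z] <= 2.
Proof.
move=> xi; have ci : on_circle i x by rewrite -in_circle.
pose Y := [set y | on_circle i y && (S x y == (3 * (L / 2))%R)].
apply: leq_trans (_ : #|Y| * 1 <= _); last by rewrite muln1; exact: at_most_two_on_circle (circle_neq0 fr ci).
have Sc a b : on_circle i a -> on_circle i b -> S a b = pnorm (q a i - q b i)%R.
  move=> /andP[/on_planeP pa _] cb; rewrite (S_plane fr a (proj1 (andP cb))) big1 ?addr0 // => j ji.
  by rewrite pa // pnorm0.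
apply: sum_le_card => y; last first.
  move=> yY; rewrite big1 // => z _; apply/eqP; rewrite eqb0; apply: contra yY.
  rewrite !in_circle => /and3P[cy cz /and3P[xy /eqP s1 /eqP s2]].
  rewrite inE cy /=; apply/eqP; rewrite (Sc _ _ ci cy).
  have /andP[_ /eqP nx] := ci; have /andP[_ /eqP ny] := cy; have /andP[_ /eqP nz] := cz.
  rewrite !Sc // in s1 s2.
  apply: (inscribed_equilateral nx ny nz) => //.
  by rewrite lt0r pnorm_ge0 andbT -Sc //; apply: contra xy => /eqP/(S0 fr)->.
rewrite -card_sum; case: (boolP (y \in circle i)) => [yi|yi]; last first.
  by rewrite (_ : [set _ | _] = set0) ?cards0 //; apply/setP => z; rewrite !inE.
have cy : on_circle i y by rewrite -in_circle.
have := at_most_two_on_circle fr (S x y) (circle_neq0 fr cy).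
rewrite (cardsD1 x) inE ci (SC fr) eqxx /= add1n ltnS; apply: leq_trans.
apply: subset_leq_card; apply/subsetP => z; rewrite !inE => /andP[cz].
move=> /and3P[xy /eqP s1 /eqP s2]; rewrite cz -s2 eqxx /= andbT.
apply: contra xy => /eqP zx; apply/eqP; apply: (S0 fr).
by rewrite s1 zx (Sxx fr).
Qed.

(** The term spread counts the pairs on two distinct circles other than that of
    x. In the remaining triangles two vertices lie on one circle, and there are
    at most two such partners for each of the three choices of the two vertices;
    inscribed triangles add the constant 2. The bound is attained by the Lenz
    configuration below. *)
Lemma tdeg_circle i x : x \in circle i ->
  tdeg S x <= spread (fun j => j != i) + 6 * (\sum_(j | j != i) #|circle j|) + 2 +
    2 * #|off| * #|V|.
Proof.
move=> xi; have ci : on_circle i x by rewrite -in_circle.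
pose F1 (y z : V) := \sum_(j | j != i) \sum_(k | (k != i) && (k != j))
  (y \in circle j) * (z \in circle k).
pose F2 (y z : V) := \sum_(j | j != i) (y \in circle j) * ((z \in circle j) && (S y z == L)).
pose F3 (y z : V) := \sum_(j | j != i) (y \in circle j) * ((z \in circle i) && (S x z == L)).
pose F4 (y z : V) := \sum_(j | j != i) (z \in circle j) * ((y \in circle i) && (S x y == L)).
pose F5 (y z : V) : nat := [&& y \in circle i, z \in circle i & tri x y z].
apply: (@leq_trans (\sum_y \sum_z (F1 y z + F2 y z + F3 y z + F4 y z + F5 y z +
  ((y \in off) + (z \in off))))).
  apply: leq_sum => y _; apply: leq_sum => z _.
  case xyz: (tri x y z) => //; have /and3P[xy /eqP s1 /eqP s2] := xyz.
  suff : [|| 0 < F1 y z, 0 < F2 y z, 0 < F3 y z, 0 < F4 y z, 0 < F5 y z, y \in off | z \in off].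
    move: (F1 y z) (F2 y z) (F3 y z) (F4 y z) (F5 y z) (y \in off) (z \in off).
    by clear => a b c d e f g; case: f; case: g; rewrite /= ?orbT ?orbF; lia.
  case: (boolP (y \in off)) => [_|/circleI[j yj]]; first by rewrite !orbT.
  case: (boolP (z \in off)) => [_|/circleI[k zk]]; first by rewrite !orbT.
  have cy : on_circle j y by rewrite -in_circle.
  have cz : on_circle k z by rewrite -in_circle.
  have [ji|ji] := eqVneq j i.
    have [ki|ki] := eqVneq k i.
      suff -> : 0 < F5 y z by rewrite !orbT.
      have yi : y \in circle i by rewrite -ji.
      have zi : z \in circle i by rewrite -ki.
      by rewrite /F5 yi zi xyz.
    have SL : S x y = L by rewrite s1 (S_circles fr _ ci cz) // eq_sym.
    suff -> : 0 < F4 y z by rewrite !orbT.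
    by rewrite /F4 (bigD1 k) //= zk -ji yj SL eqxx.
  have SL : S x y = L by rewrite (S_circles fr _ ci cy) // eq_sym.
  have [ki|ki] := eqVneq k i.
    suff -> : 0 < F3 y z by rewrite !orbT.
    by rewrite /F3 (bigD1 j) //= yj -ki zk -s1 SL eqxx.
  have [kj|kj] := eqVneq k j.
    suff -> : 0 < F2 y z by rewrite !orbT.
    by rewrite /F2 (bigD1 j) //= yj -kj zk -s2 SL eqxx.
  suff -> : 0 < F1 y z by [].
  by rewrite /F1 (bigD1 j) //= (bigD1 k) ?ki //= yj zk.
have sumD (f g : V -> V -> nat) : \sum_y \sum_z (f y z + g y z) =
    \sum_y \sum_z f y z + \sum_y \sum_z g y z.
  by rewrite -big_split; apply: eq_bigr => y _; rewrite -big_split.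
have sumI (P : pred 'I_r) (f : 'I_r -> V -> V -> nat) :
    \sum_y \sum_z \sum_(j | P j) f j y z = \sum_(j | P j) \sum_y \sum_z f j y z.
  under eq_bigr do rewrite exchange_big.
  by rewrite exchange_big.
rewrite 5!sumD off_pairs /F1 /F2 /F3 /F4 /F5 spread_pairs !sumI leq_add2r.
apply: leq_add; last exact: inscribed_pairs.
rewrite -!addnA leq_add2l (_ : 6 = 2 + (2 + 2)) // !mulnDl ![2 * _]mulnC !big_distrl /=.
apply: leq_add; last apply: leq_add; apply: leq_sum => j ji.
- exact: (chord_pairs j (fun=> L)).
- exact: cross_pairs (circle_neq0 fr ci).
- rewrite exchange_big; exact: cross_pairs (circle_neq0 fr ci).
Qed.

(** The circles whose points are all at squared distance L from x. *)
Definition core x := [pred i | (q x i == 0%R) && (sqn q x == (L / 2)%R)].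

(** Being at squared distance L from the points of r - 1 circles would put x on
    the remaining one. *)
Lemma card_core x : x \in off -> #|core x| <= r - 2.
Proof.
move=> xo; rewrite leqNgt; apply/negP => big.
have [i0 i0c] : exists i, i \in core x by apply/card_gt0P; apply: leq_ltn_trans big.
have nx : sqn q x = (L / 2)%R by have /andP[_ /eqP] := i0c.
have [i qi] : exists i, q x i != 0%R.
  case: (pickP (fun i => q x i != 0%R)) => [i qi|no]; first by exists i.
  have : sqn q x = 0%R.
    by rewrite /sqn big1 // => i _; have /negbT := no i; rewrite negbK => /eqP->; exact: pnorm0.
  by rewrite nx => /eqP; rewrite gt_eqF // divr_gt0 ?(L0 fr).
have cE : core x =i [set~ i].
  apply/subset_cardP; last first.
    by apply/subsetP => k; rewrite !inE => /andP[qk _]; apply: contraNneq qi => <-.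
  have sub : core x \subset [set~ i].
    by apply/subsetP => k; rewrite !inE => /andP[qk _]; apply: contraNneq qi => <-.
  rewrite cardsC1 card_ord; apply/eqP; rewrite eqn_leq; apply/andP; split; last by apply: leq_trans big; move: r2; clear; lia.
  by have := subset_leq_card sub; rewrite cardsC1 card_ord.
case/negP: (offP _ xo i).
have px : on_plane q i x.
  by apply/on_planeP => j ji; have := cE j; rewrite !inE ji => /andP[/eqP].
by rewrite on_circleE px /= -(sqn_plane px) nx.
Qed.

(** A triangle on x and two points of distinct circles has squared side L, and a
    circle outside the core has at most two points at this distance from x. *)
Lemma tdeg_off x : x \in off ->
  tdeg S x <= spread (core x) + (4 * r + 2) * #|V| + 2 * #|off| * #|V|.
Proof.
move=> xo.
pose F1 (y z : V) := \sum_(j | core x j) \sum_(k | core x k && (k != j))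
  (y \in circle j) * (z \in circle k).
pose F2 (y z : V) := \sum_j (y \in circle j) * ((z \in circle j) && (S y z == S x y)).
pose F3 (y z : V) := \sum_(k | ~~ core x k) (y \in setT) * ((z \in circle k) && (S x z == L)).
pose F4 (y z : V) := \sum_(j | ~~ core x j) (z \in setT) * ((y \in circle j) && (S x y == L)).
apply: (@leq_trans (\sum_y \sum_z (F1 y z + F2 y z + F3 y z + F4 y z +
  ((y \in off) + (z \in off))))).
  apply: leq_sum => y _; apply: leq_sum => z _.
  case xyz: (tri x y z) => //; have /and3P[xy /eqP s1 /eqP s2] := xyz.
  suff : [|| 0 < F1 y z, 0 < F2 y z, 0 < F3 y z, 0 < F4 y z, y \in off | z \in off].
    move: (F1 y z) (F2 y z) (F3 y z) (F4 y z) (y \in off) (z \in off).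
    by clear => a b c d f g; case: f; case: g; rewrite /= ?orbT ?orbF; lia.
  case: (boolP (y \in off)) => [_|/circleI[j yj]]; first by rewrite !orbT.
  case: (boolP (z \in off)) => [_|/circleI[k zk]]; first by rewrite !orbT.
  have cy : on_circle j y by rewrite -in_circle.
  have cz : on_circle k z by rewrite -in_circle.
  have [kj|kj] := eqVneq k j.
    suff -> : 0 < F2 y z by rewrite !orbT.
    by rewrite /F2 (bigD1 j) //= yj -kj zk -s2 eqxx.
  have SL : S x y = L by rewrite s2 (S_circles fr _ cy cz) // eq_sym.
  case cj: (core x j); last first.
    suff -> : 0 < F4 y z by rewrite !orbT.
    by rewrite /F4 (bigD1 j) ?cj //= in_setT yj SL eqxx.
  case ck: (core x k); last first.
    suff -> : 0 < F3 y z by rewrite !orbT.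
    by rewrite /F3 (bigD1 k) ?ck //= in_setT zk -s1 SL eqxx.
  suff -> : 0 < F1 y z by [].
  rewrite /F1 (bigD1 j) //= (bigD1 k) /=; last by rewrite kj andbT.
  by rewrite yj zk.
have sumD (f g : V -> V -> nat) : \sum_y \sum_z (f y z + g y z) =
    \sum_y \sum_z f y z + \sum_y \sum_z g y z.
  by rewrite -big_split; apply: eq_bigr => y _; rewrite -big_split.
have sumI (P : pred 'I_r) (f : 'I_r -> V -> V -> nat) :
    \sum_y \sum_z \sum_(j | P j) f j y z = \sum_(j | P j) \sum_y \sum_z f j y z.
  under eq_bigr do rewrite exchange_big.
  by rewrite exchange_big.
rewrite 4!sumD off_pairs /F1 /F2 /F3 /F4 spread_pairs !sumI leq_add2r -[leqLHS]addnA -[leqLHS]addnA leq_add2l.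
have -> : (4 * r + 2) * #|V| = 2 * #|V| + (r * (#|V| * 2) + r * (#|V| * 2)) by ring.
have sr (P : pred 'I_r) (f : 'I_r -> nat) n : (forall j, P j -> f j <= n) ->
    \sum_(j | P j) f j <= r * n.
  move=> H; apply: (@leq_trans (\sum_(j < r) n)); last by rewrite sum_nat_const card_ord.
  by rewrite big_mkcond; apply: leq_sum => j _; case: ifP => // /H.
apply: leq_add.
  rewrite mulnC -sum_circles mulnDl big_distrl /=; apply: leq_trans (leq_addr _ _).
  by apply: leq_sum => j _; exact: chord_pairs.
have qj j u : ~~ core x j -> S x u = L -> u \in circle j -> q x j != 0%R.
  move=> nc sL uj; apply: contra nc => /eqP qx; rewrite /= qx eqxx /=.
  have := S_over_center fr qx (_ : on_circle j u); rewrite -in_circle => /(_ uj).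
  by rewrite sL => E; apply/eqP; lra.
have bound j : ~~ core x j ->
   \sum_y \sum_z (y \in [set: V]) * ((z \in circle j) && (S x z == L)) <= #|V| * 2.
  move=> nc; case: (pickP (fun u => (u \in circle j) && (S x u == L))) => [u|no].
    move=> /andP[uj /eqP sL]; rewrite -cardsT; apply: cross_pairs; exact: qj nc sL uj.
  by rewrite big1 // => y _; rewrite big1 // => z _; rewrite no muln0.
apply: leq_add; apply: sr => j nc; first exact: bound.
by rewrite exchange_big; exact: bound.
Qed.
End Coord3.

(** * From points to coordinates *)

Section Points.
Variables (R : realType) (d : nat) (V : finType) (p : V -> 'rV[R]_d).
Hypothesis pinj : injective p.

Definition dist2 x y := sqd (p x) (p y).

Lemma dist2C x y : dist2 x y = dist2 y x.
Proof. exact: sqdC. Qed.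

Lemma dist2_eq0 x y : dist2 x y = 0 -> x = y.
Proof. by move=> /eqP; rewrite sqd_eq0 => /eqP/pinj. Qed.

Lemma mono3 x y z : x != y -> x != z -> y != z -> mono p [set x; y; z] = tri dist2 x y z.
Proof.
move=> xy xz yz; apply/monoP/and3P => [H|[_ /eqP s1 /eqP s2]].
  by split=> //; apply/eqP; apply: H; rewrite ?inE ?eqxx ?orbT.
apply/monoP; apply: (@mono_const _ _ _ _ _ (dist2 x y)) => u v.
have s3 := sqdC (p x) (p y); have s4 := sqdC (p x) (p z); have s5 := sqdC (p y) (p z).
rewrite !inE => /orP[/orP[]|]/eqP-> /orP[/orP[]|]/eqP->; rewrite ?eqxx // => _;
  by rewrite /dist2 in s1 s2 *; rewrite -?s3 -?s4 -?s5 -?s1 -?s2.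
Qed.

Lemma sum_tdeg : (6 * nsets (mono p) 3 = \sum_x tdeg dist2 x)%N.
Proof.
rewrite nsets_sum sum_card3; apply: eq_bigr => x _; rewrite big_mkcond.
apply: eq_bigr => y _; case: ifPn => [xy|/negPn/eqP->]; last first.
  by rewrite big1 // => z _; rewrite /tri eqxx.
rewrite big_mkcond; apply: eq_bigr => z _; case: ifPn => [/andP[xz yz]|H].
  by rewrite mono3.
suff /negbTE-> : ~~ tri dist2 x y z by [].
apply: contra H => /and3P[_ /eqP s1 /eqP s2]; apply/andP; split; apply: contra xy => /eqP E.
  by apply/eqP; apply: dist2_eq0; rewrite s1 E /dist2; apply/eqP; rewrite sqd_eq0.
by apply/eqP; apply: dist2_eq0; rewrite s2 E /dist2; apply/eqP; rewrite sqd_eq0.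
Qed.
End Points.

(** A homogeneous family of r + 1 blocks contradicts blocks_dim, and the
    uniqueness of the center is blocks_center_unique. *)
Lemma frame_of_blocks (R : realType) (r t : nat) (V : finType) (p : V -> 'rV[R]_(2 * r))
    (A : 'I_r -> {set V}) (L : R) : (2 < r)%N -> (2 < t)%N -> injective p ->
  unit_blocks p t A L ->
  exists2 q, frame (dist2 p) q L & forall i, {in A i, forall x, on_circle q L i x}.
Proof.
move=> r2 t2 pinj [At AL].
have A3 i : (2 < #|A i|)%N by rewrite At.
have [o [q [qE qo qA qL]]] := lenz_frame pinj r2 erefl A3 AL.
have A0 i : (0 < #|A i|)%N by apply: ltn_trans (A3 i).
pose i0 : 'I_r := Ordinal (ltn_trans (ltn0Sn _) (ltnW r2)).
have [i1 i10 _] := third_index i0 i0 r2; rewrite eq_sym in i10.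
exists (fun x => q (p x)); last first.
  move=> i x xA; apply/andP; split; last by rewrite qL.
  by apply/on_planeP => j ji; rewrite (qA i j) // eq_sym.
split.
- by move=> x y; rewrite /dist2 qE.
- by move=> x y; apply: dist2_eq0.
- have /card_gt0P[y yA] := A0 i1.
  have /card_gt1P[x [x' [xA x'A xx']]] : (1 < #|A i0|)%N by exact: ltnW.
  have E := AL _ _ i10 _ _ xA yA; rewrite -E lt0r sqd_ge0 andbT sqd_eq0.
  apply: contra xx' => /eqP xy; have := AL _ _ i10 _ _ x'A yA.
  rewrite -E xy => /eqP; rewrite (_ : sqd (p y) (p y) = 0); last by apply/eqP; rewrite sqd_eq0.
  by rewrite sqd_eq0 -xy (inj_eq pinj) eq_sym.
- move=> B B3 hB; have : (2 * r.+1 <= 2 * r)%N by exact: (blocks_dim pinj (leqW (ltnW r2)) B3 hB).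
  by rewrite leq_mul2l ltnn.
- move=> B x B3 hB xB nB.
  have sqnE y : sqd o (p y) = sqn (fun x => q (p x)) y.
    by rewrite qE; apply: eq_bigr => i _; rewrite qo pnormBC subr0.
  have E : o = p x.
    apply: (blocks_center_unique pinj (ltnW r2) B3 hB erefl) => // i y y' yB y'B.
    by rewrite !sqnE; exact: nB yB y'B.
  by rewrite -sqnE E; apply/eqP; rewrite sqd_eq0.
Qed.

(** * Almost all points lie on the circles *)

Lemma six_bounds (a b c d e n : nat) : (a + b + c + d + e + 1 <= n)%N ->
  [/\ a <= n, b <= n, c <= n, d <= n & e <= n /\ 0 < n]%N.
Proof. by split; lia. Qed.

Section Arithmetic.
Variable F : realFieldType.
Implicit Types r h t e m : F.

(** Pairs that are not strong count at most r - 3 times, so the large degrees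
    have to come from strong pairs. *)
Lemma many_strong_edges r h t e1 e m ea eh : 3 <= r -> r * h = 1 -> 0 < t -> r * e1 = e ->
  2 * r <= t * e1 -> 2 * r + 2 <= m * e1 -> 0 < m -> ea <= (1 - h + e1) * m ^+ 2 ->
  r * t * ((1 - h) * (1 - 2 * h) * m ^+ 2 - 2 * m) <=
    2 * r * m ^+ 2 + t * ((r - 3) * ea + eh + 2 * m) ->
  (1 - h - e) * m ^+ 2 <= eh.
Proof.
move=> r3 rh t0 re1 tP mP m0 EA KC.
have m20 : 0 <= m ^+ 2 by rewrite sqr_ge0.
have s1 : (r - 3) * ea <= (r - 3) * ((1 - h + e1) * m ^+ 2).
  by apply: ler_wpM2l => //; lra.
have s2 : 2 * r * m ^+ 2 <= t * e1 * m ^+ 2 by apply: ler_wpM2r.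
have s3 : (2 * r + 2) * m <= m * e1 * m by apply: ler_wpM2r; rewrite // ltW.
have s4 : r * ((1 - h) * (1 - 2 * h)) = r - 3 + 2 * h.
  transitivity (r - 3 * (r * h) + 2 * (r * h) * h); first by ring.
  by rewrite rh; ring.
have s5 : (r - 3) * (1 - h + e1) = r - 3 - 1 + 3 * h + e - 3 * e1.
  transitivity (r - 3 - r * h + 3 * h + r * e1 - 3 * e1); first by ring.
  by rewrite rh re1; ring.
have KC' : t * ((r - 3 + 2 * h) * m ^+ 2 - 2 * r * m) <=
    t * (e1 * m ^+ 2 + (r - 3) * ea + eh + 2 * m).
  rewrite -s4; lra.
rewrite (ler_pM2l t0) in KC'.
have s6 : (r - 3) * ((1 - h + e1) * m ^+ 2) = (r - 3 - 1 + 3 * h + e - 3 * e1) * m ^+ 2.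
  by rewrite -s5 mulrA.
have e10 : 0 <= e1 * m ^+ 2.
  by apply: mulr_ge0 => //; rewrite -(pmulr_lge0 _ m0) mulrC; lra.
rewrite s6 in s1; lra.
Qed.

(** Here f is the number of points off the circles: they carry few triangles,
    the other points carry at most the proportion density of (m - f)^3 of them. *)
Lemma few_off_bound h e m f k3 lk T3 : 0 < h -> 3 * h <= 1 -> 0 < e -> 8 <= m * e -> 0 < m ->
  0 <= f -> f <= m -> lk <= f * (e * m ^+ 2) ->
  T3 <= (1 - h) * (1 - 2 * h) * (m - f) ^+ 3 ->
  6 * k3 <= 3 * lk + 6 * m ^+ 2 + T3 ->
  (1 - h - e) * (2 * (1 - h - e) - 1) * m ^+ 3 <= 6 * k3 ->
  f <= 32 * e * m.
Proof.
move=> h0 h1 e0 mP m0 f0 fm LK MC HT HG.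
set dens := (1 - h) * (1 - 2 * h) in MC.
have d29 : 2 / 9 <= dens by rewrite /dens; nra.
have cub : (m - f) ^+ 3 <= m ^+ 2 * (m - f).
  have : 0 <= (m - f) * (f * (2 * m - f)) by rewrite !mulr_ge0 //; lra.
  lra.
have b1 : f * (e * m ^+ 2) <= e * m ^+ 3.
  have : 0 <= (m - f) * (e * m ^+ 2) by rewrite !mulr_ge0 ?sqr_ge0 //; lra.
  lra.
have b2 : 6 * m ^+ 2 <= e * m ^+ 3.
  have : 0 <= (m * e - 6) * m ^+ 2 by apply: mulr_ge0; [lra|exact: sqr_ge0].
  lra.
have b3 : dens * (m - f) ^+ 3 <= dens * (m ^+ 2 * (m - f)).
  by apply: ler_wpM2l => //; lra.
have b4 : (dens - 3 * e) * m ^+ 3 <= (1 - h - e) * (2 * (1 - h - e) - 1) * m ^+ 3.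
  apply: ler_wpM2r; first by rewrite exprn_ge0 // ltW.
  rewrite /dens; nra.
have fin : dens * f * m ^+ 2 <= 7 * e * m * m ^+ 2 by lra.
rewrite ler_pM2r ?exprn_gt0 // in fin.
have : 2 / 9 * f <= dens * f by apply: ler_wpM2r.
lra.
Qed.
End Arithmetic.

(** Summing the degrees over the blocks gives almost (1 - 1/r) m^2 strong edges,
    hence by Goodman almost density r m^3 strong triangles. Points off the
    circles have sparse links, by erdos_pairs and link_free. *)
Lemma near_structure (r : nat) (eps : rat) : (2 < r)%N -> 0 < eps -> 36 * eps <= 1 ->
  exists N : nat, forall (R : realType) (V : finType) (p : V -> 'rV[R]_(2 * r)),
    injective p -> (N <= #|V|)%N ->
    (forall x, density r * #|V|%:R ^+ 2 - 2 * #|V|%:R <= (tdeg (dist2 p) x)%:R) ->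
    exists (q : V -> 'I_r -> R * R) (L : R), frame (dist2 p) q L /\ #|off q L|%:R <= 32 * eps * #|V|%:R.
Proof.
move=> r2 e0 e36; have [h0 h1] := inv_r_bounds r2.
have r0 : 0 < r%:R :> rat by rewrite ltr0n (ltnW (ltnW r2)).
have r3 : 3 <= r%:R :> rat by rewrite (ler_nat _ 3).
have rh : r%:R * r%:R^-1 = 1 :> rat by rewrite mulfV // gt_eqF.
pose e1 := eps / r%:R.
have re1 : r%:R * e1 = eps by rewrite /e1 mulrC divfK // gt_eqF.
have e10 : 0 < e1 by rewrite divr_gt0.
(* the error 2 r per pair has to be small against the block size t *)
have [t1 t1P] := rat_bound (2 * r%:R / e1).
have [t [t2 t1t']] : exists t, (2 < t)%N /\ (t1 <= t)%N by exists (t1 + 3)%N; rewrite addn3; split; rewrite // -addn3 leq_addr.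
have tR : 0 < t%:R :> rat by rewrite ltr0n (ltnW (ltnW t2)).
have t1t : t1%:R <= t%:R :> rat by rewrite ler_nat.
have tP : 2 * r%:R <= t%:R * e1 by rewrite -ler_pdivrMr // (le_trans t1P).
have [eB eB0 [NB NBP]] := find_unit_blocks r2 (ltnW (ltnW t2)).
have [NA NAP] := erdos_stone3 (ltnW (ltnW r2)) e10.
have [NP NPP] := erdos_pairs e0.
have [M1 M1P] := rat_bound (2 / eB).
have [M2 M2P] := rat_bound ((2 * r%:R + 2) / e1).
exists (NB + NA + NP + M1 + M2 + 1)%N => R V p pinj NV Hdeg.
have [VB VA VP V1 [V2 V0]] := six_bounds NV.
have m1P : 2 <= #|V|%:R * eB.
  by rewrite -ler_pdivrMr //; apply: le_trans M1P _; rewrite ler_nat.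
have m2P : 2 * r%:R + 2 <= #|V|%:R * e1.
  by rewrite -ler_pdivrMr //; apply: le_trans M2P _; rewrite ler_nat.
have m0 : 0 < #|V|%:R :> rat by rewrite ltr0n.
have Ktri : (density r - eB) * #|V|%:R ^+ 3 <= 6 * (nsets (mono p) 3)%:R.
  rewrite -(natrM _ 6) (sum_tdeg pinj) natr_sum.
  apply: le_trans (_ : \sum_(x : V) (density r * #|V|%:R ^+ 2 - 2 * #|V|%:R) <= _); last first.
    by apply: ler_sum => x _; exact: Hdeg.
  rewrite sumr_const -[_ *+ _]mulr_natl.
  by have := ler_wpM2r (sqr_ge0 #|V|%:R) m1P; lra.
have [A [L blk]] := NBP R V p pinj VB Ktri.
have [q fr Ac] := frame_of_blocks r2 t2 pinj blk.
exists q, L; split; first exact: fr.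
have At i : #|A i| = t by case: blk.
have EA := NAP V (adj (dist2 p) q L) (adjC fr) VA (adj_no_box fr).
have := total_block_count r2 fr At Ac.
rewrite -(ler_nat rat) natr_sum (natrD _ (2 * r * #|V| ^ 2)%N) (natrM _ (2 * r)%N).
rewrite (natrM _ 2 r) natrX (natrM _ t) (natrD _ _ (2 * #|V|)%N) (natrM _ 2 #|V|).
rewrite (natrD _ ((r - 3) * _)%N) (natrM _ (r - 3)%N) => KC.
set m := #|V|%:R in m0 m1P m2P EA KC Hdeg *.
have KL : r%:R * t%:R * (density r * m ^+ 2 - 2 * m) <=
    \sum_i (\sum_(a in A i) tdeg (dist2 p) a)%N%:R.
  apply: le_trans (_ : \sum_(i < r) t%:R * (density r * m ^+ 2 - 2 * m) <= _).
    by rewrite sumr_const card_ord -[leRHS]mulr_natl mulrA lexx.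
  apply: ler_sum => i _; rewrite natr_sum -(At i) mulr_natl -sumr_const.
  by apply: ler_sum => a _; exact: Hdeg.
have := le_trans KL KC; rewrite (natrB _ r2).
set ea := (edges _)%:R in EA *; set eh := (edges _)%:R => {}KC.
set h := r%:R^-1 in h0 h1 rh EA *.
have dE : density r = (1 - h) * (1 - 2 * h) by [].
have EH : (1 - h - eps) * m ^+ 2 <= eh.
  rewrite dE in KC; exact: many_strong_edges r3 rh tR re1 tP m2P m0 EA KC.
have HG := goodman (strong_adjC fr) (_ : 1 <= 4 * (1 - h - eps)) EH.
have {HG} := HG ltac:(lra).
have := strong_triangles fr.
set TT := (\sum_i _)%N; set LL := (\sum_(x in _) _)%N.
rewrite -(ler_nat rat) (natrM _ 6) (natrD _ (3 * LL + _)%N) (natrD _ (3 * LL)%N).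
rewrite (natrM _ 3 LL) (natrM _ 6) natrX.
set k3 := (nsets _ 3)%:R; set F := #|off q L|%:R.
have mF : \sum_i #|circle q L i|%:R = m - F :> rat.
  apply/eqP; rewrite eq_sym subr_eq -natr_sum -natrD; apply/eqP; congr (_%:R).
  exact/esym/(sum_circles fr).
have F0 : 0 <= F by exact: ler0n.
have Fm : 0 <= m - F by rewrite -mF; apply: sumr_ge0.
have := @maclaurin3 r (fun i => #|circle q L i|%:R) r2 (fun i => ler0n _ _).
rewrite mF -dE => MC.
have -> : TT%:R =
  \sum_i \sum_(j | j != i) \sum_(k | (k != i) && (k != j))
    #|circle q L i|%:R * #|circle q L j|%:R * #|circle q L k|%:R :> rat.
  rewrite natr_sum; apply: eq_bigr => i _; rewrite natr_sum; apply: eq_bigr => j _.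
  by rewrite natr_sum; apply: eq_bigr => k _; rewrite !natrM.
move: MC; set T3 := \sum_i _ => MC HT HG.
have LK : LL%:R <= F * (eps * m ^+ 2).
  rewrite natr_sum /F mulr_natl -sumr_const; apply: ler_sum => x xo.
  rewrite leNgt; apply/negP => /ltW lk.
  pose e (y z : V) := [&& strong_adj (dist2 p) q L x y, strong_adj (dist2 p) q L x z & strong_adj (dist2 p) q L y z].
  have [B [B' [B3 B'3 HB]]] := NPP V e VP lk.
  have c1 (X : {set V}) : #|X| = 3 -> exists y, y \in X.
    by move=> X3; apply/card_gt0P; rewrite X3.
  have [b0 b0B] := c1 B B3; have [b1 b1B] := c1 B' B'3.
  have A3 i : (2 < #|A i|)%N by rewrite At.
  have xb b : b \in B -> strong_adj (dist2 p) q L x b.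
    by move=> bB; have /and3P[] := HB b b1 bB b1B.
  have xb' b : b \in B' -> strong_adj (dist2 p) q L x b.
    by move=> bB; have /and3P[] := HB b0 b b0B bB.
  have bb' b b' : b \in B -> b' \in B' -> strong_adj (dist2 p) q L b b'.
    by move=> bB b'B; have /and3P[] := HB b b' bB b'B.
  have B2 : (2 < #|B|)%N by rewrite B3.
  have B'2 : (2 < #|B'|)%N by rewrite B'3.
  exact: (link_free r2 fr A3 Ac (offP _ _ _ xo) B2 B'2 xb xb' bb').
have me : 8 <= m * eps.
  have := ler_wpM2r (_ : 0 <= r%:R) m2P; rewrite -mulrA [e1 * _]mulrC re1 => H.
  have {H} := H (ltW r0); have := ler_wpM2r (ltW r0) r3; lra.
rewrite dE in MC; rewrite subr_ge0 in Fm.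
exact: few_off_bound h0 h1 e0 me m0 F0 Fm LK MC HT HG.
Qed.

(** * Quantitative estimates *)

Section Arithmetic.
Variable F : realFieldType.
Implicit Types r h t e m : F.

(** A circle with many more than m / r points leaves too few pairs on the other
    circles for the degrees of its own points. *)
Lemma balanced h e m n f sp s : 0 < h -> 3 * h <= 1 -> 0 < e -> 400 * e <= 1 -> 0 < m ->
  10 <= m * e -> 0 <= s -> s <= m - n -> f <= 32 * e * m ->
  (1 - h) * sp <= (1 - 2 * h) * s ^+ 2 ->
  (1 - h) * (1 - 2 * h) * m ^+ 2 - 2 * m <= sp + 6 * m + 2 + 2 * f * m ->
  n <= (h + 130 * e) * m.
Proof.
move=> h0 h1 e0 e1 m0 me s0 smn fm spP H; rewrite leNgt; apply/negP => nm.
have m1 : 1 <= m.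
  have : m * e <= m * (1 / 400) by apply: ler_wpM2l; lra.
  lra.
have u : s <= (1 - h - 130 * e) * m by lra.
have s2 : s ^+ 2 < ((1 - h) ^+ 2 - 130 * e) * m ^+ 2.
  apply: le_lt_trans (_ : ((1 - h - 130 * e) * m) ^+ 2 < _).
    by rewrite ler_sqr ?nnegrE // mulr_ge0 //; lra.
  rewrite exprMn ltr_pM2r ?exprn_gt0 //.
  have : 0 < e * (2 * (1 - h) - 1 - 130 * e) by apply: mulr_gt0 => //; lra.
  lra.
have lin : 10 * m <= e * m ^+ 2.
  have := ler_wpM2r (ltW m0) me; lra.
have fm2 : f * m <= 32 * e * m ^+ 2 by have := ler_wpM2r (ltW m0) fm; lra.
have low : (1 - h) * (1 - 2 * h) * m ^+ 2 - 65 * e * m ^+ 2 <= sp by lra.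
have k1 : (1 - h) * ((1 - h) * (1 - 2 * h) * m ^+ 2 - 65 * e * m ^+ 2) <=
          (1 - 2 * h) * s ^+ 2.
  by apply: le_trans (le_trans (ler_wpM2l _ low) spP) _ => //; lra.
have k2 : (1 - 2 * h) * s ^+ 2 < (1 - 2 * h) * (((1 - h) ^+ 2 - 130 * e) * m ^+ 2).
  by rewrite ltr_pM2l //; lra.
have := le_lt_trans k1 k2.
have : 0 <= e * m ^+ 2 * (1 - 3 * h) by rewrite !mulr_ge0 ?sqr_ge0 //; lra.
lra.
Qed.

(** A point off the circles completes pairs on at most r - 2 circles, about (1 -
    2 h) (1 - 3 h) m^2 of them, which falls short of (1 - h) (1 - 2 h) m^2 by 2
    h (1 - 2 h) m^2; the error terms are small against h. *)
Lemma off_degree_small r h e m f sp s : 3 <= r -> r * h = 1 -> 0 < h -> 1200 * e = h ^+ 2 ->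
  0 < m -> 40 * (r + 1) <= h * m -> f <= 32 * e * m -> 0 <= s ->
  s <= (r - 2) * ((h + 130 * e) * m) -> (r - 2) * sp <= (r - 3) * s ^+ 2 ->
  sp + (4 * r + 2) * m + 2 * f * m < (1 - h) * (1 - 2 * h) * m ^+ 2 - 2 * m.
Proof.
move=> r3 rh h0 eh m0 hm fm s0 sP spP.
have h1 : 3 * h <= 1 by have := ler_wpM2r (ltW h0) r3; lra.
set b := h + 130 * e in sP.
have hh2 : 0 < h ^+ 2 by rewrite exprn_gt0.
have e0 : 0 < e by lra.

have r20 : 0 < r - 2 by lra.
have sp1 : sp <= (r - 3) * (r - 2) * b ^+ 2 * m ^+ 2.
  rewrite -(ler_pM2l r20); apply: le_trans spP _.
  have -> : (r - 2) * ((r - 3) * (r - 2) * b ^+ 2 * m ^+ 2) =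
    (r - 3) * ((r - 2) * (b * m)) ^+ 2 by ring.
  apply: ler_wpM2l; first by lra.
  rewrite ler_sqr ?nnegrE // !mulr_ge0 // /b; lra.
have bh : b ^+ 2 <= h ^+ 2 + 3 / 9 * h ^+ 3.
  have e9 : 9 * (130 * e) <= h ^+ 2 by have := exprn_ge0 2 (ltW h0); lra.
  have p1 : h * (9 * (130 * e)) <= h * h ^+ 2 by apply: ler_wpM2l; rewrite // ltW.
  have p2 : (130 * e) * (9 * (130 * e)) <= (130 * e) * h ^+ 2.
    by apply: ler_wpM2l => //; lra.
  have p3 : h * (3 * h) <= h * 1 by apply: ler_wpM2l; rewrite // ltW.
  have p4 : 130 * e * h ^+ 2 <= h * (9 * (130 * e)).
    have : 0 <= (130 * e) * (h * (9 - h)) by rewrite !mulr_ge0 //; lra.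
    lra.
  rewrite /b; lra.
have rr : 0 <= (r - 3) * (r - 2) by rewrite mulr_ge0 //; lra.
have rr1 : (r - 3) * (r - 2) * h ^+ 2 = (1 - 3 * h) * (1 - 2 * h).
  transitivity ((r * h - 3 * h) * (r * h - 2 * h)); first by ring.
  by rewrite rh.
have m2 : 0 <= m ^+ 2 by exact: sqr_ge0.
have sp2 : sp <= ((1 - 3 * h) * (1 - 2 * h) + h / 3) * m ^+ 2.
  apply: le_trans sp1 _; apply: ler_wpM2r => //.
  apply: le_trans (ler_wpM2l rr bh) _.
  have -> : (r - 3) * (r - 2) * (h ^+ 2 + 3 / 9 * h ^+ 3) =
    (r - 3) * (r - 2) * h ^+ 2 * (1 + h / 3) by field.
  rewrite rr1.
  have : 0 <= (h / 3) * (1 - (1 - 3 * h) * (1 - 2 * h)).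
    apply: mulr_ge0; first by lra.
    have : 0 <= h * (5 - 6 * h) by apply: mulr_ge0; lra.
    lra.
  lra.
have lin : 40 * (r + 1) * m <= h * m * m by apply: ler_wpM2r; rewrite // ltW.
have fm2 : f * m <= 32 * e * m ^+ 2 by have := ler_wpM2r (ltW m0) fm; lra.
have hm2 : 0 < h * m ^+ 2 by rewrite mulr_gt0 ?exprn_gt0.
have em : 1200 * e * m ^+ 2 <= h * (1 / 3) * m ^+ 2.
  rewrite eh expr2; apply: ler_wpM2r => //; apply: ler_wpM2l; lra.
have hh : 3 * h * (h * m ^+ 2) <= 1 * (h * m ^+ 2) by apply: ler_wpM2r; rewrite // ltW.
lra.
Qed.

(** The scale e of the error terms.  With 1200 e = h^2 the imbalance 130 e of
    the circles is at most about h^2 / 9, as off_degree_small requires. *)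
Lemma pick_scale h : 0 < h -> 3 * h <= 1 ->
  exists e, [/\ 1200 * e = h ^+ 2, 0 < e & 36 * e <= 1].
Proof.
move=> h0 h1; have hh : h * (3 * h) <= h * 1 by apply: ler_wpM2l h1; apply: ltW.
have hh0 : 0 < h ^+ 2 by apply: exprn_gt0.
by exists (h ^+ 2 / 1200); split; lra.
Qed.
End Arithmetic.

Lemma eventually_large (x e : rat) : 0 < e ->
  exists M : nat, forall m : nat, (M <= m)%N -> x <= m%:R * e.
Proof.
move=> e0; have [M MP] := rat_bound (x / e); exists M => m Mm.
by rewrite -ler_pdivrMr //; apply: le_trans MP _; rewrite ler_nat.
Qed.

(** * All points lie on the circles *)

Lemma inv_r_facts (r : nat) : (2 < r)%N ->
  [/\ 3 <= r%:R :> rat, r%:R * r%:R^-1 = 1 :> rat & r.-1%:R = r%:R - 1 :> rat].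
Proof.
move=> r2; have r0 := ltnW (ltnW r2); split; first by rewrite (ler_nat _ 3).
  by rewrite mulfV // gt_eqF // ltr0n.
by rewrite -subn1 natrB.
Qed.

Section OnCircles.
Variables (R : realType) (r : nat) (V : finType).
Variables (S : V -> V -> R) (q : V -> 'I_r -> R * R) (L : R).
Hypothesis r2 : (2 < r)%N.
Hypothesis fr : frame S q L.
Local Notation n i := (#|circle q L i|%:R : rat).

Lemma spread_le (P : pred 'I_r) (k : nat) : (#|P| <= k)%N -> (0 < k)%N ->
  (spread q L P)%:R <= (1 - k%:R^-1) * (\sum_(i | P i) n i) ^+ 2.
Proof.
move=> Pk k0; have := sum_pairs_le (fun i => n i) Pk k0; apply: le_trans.
rewrite natr_sum; apply: ler_sum => i _; rewrite natr_sum; apply: ler_sum => j _.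
by rewrite natrM.
Qed.

Lemma sum_others i : \sum_(j | j != i) n j <= #|V|%:R - n i.
Proof.
have -> : #|V|%:R = n i + \sum_(j | j != i) n j + #|off q L|%:R :> rat.
  by rewrite -(sum_circles fr) natrD natr_sum (bigD1 i).
have := ler0n rat #|off q L|; lra.
Qed.

Lemma spread_others i :
  (1 - r%:R^-1) * (spread q L (fun j => j != i))%:R <=
    (1 - 2 * r%:R^-1) * (\sum_(j | j != i) n j) ^+ 2.
Proof.
have [r3 rh r1] := inv_r_facts r2; have [h0 h1] := inv_r_bounds r2.
have sp := @spread_le (fun j => j != i) r.-1.
have r10 : (0 < r.-1)%N by rewrite -ltnS prednK ?(ltnW r2) // (ltnW (ltnW r2)).
have {sp} := sp (_ : (#|[pred j | j != i]| <= r.-1)%N) r10.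
rewrite cardC1 card_ord leqnn => /(_ isT).
rewrite r1; set h := r%:R^-1 in h0 h1 rh *.
set s := \sum_(j | _) _; set spr := (spread _ _ _)%:R => sp.
have r1R : 0 < r%:R - 1 :> rat by lra.
have -> : 1 - 2 * h = (1 - h) * (1 - (r%:R - 1)^-1).
  rewrite -(mulfK (lt0r_neq0 r1R) (1 - 2 * h)).
  have -> : (1 - 2 * h) * (r%:R - 1) = (1 - h) * (r%:R - 2).
    transitivity (r%:R - 1 - 2 * (r%:R * h) + 2 * h); first by ring.
    rewrite rh; transitivity (r%:R - 2 - r%:R * h + 2 * h); last by ring.
    by rewrite rh; ring.
  by field; exact: lt0r_neq0.
by rewrite -mulrA; apply: ler_wpM2l sp; lra.
Qed.

Lemma spread_core x : x \in off q L ->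
  (r%:R - 2) * (spread q L (core q L x))%:R <=
    (r%:R - 3) * (\sum_(j | core q L x j) n j) ^+ 2.
Proof.
move=> xo; have [r3 _ _] := inv_r_facts r2.
have r20 : (0 < r - 2)%N by rewrite subn_gt0.
have := spread_le (card_core r2 fr xo) r20; rewrite (natrB _ (ltnW r2)).
set s := \sum_(j | _) _; set spr := (spread _ _ _)%:R => sp.
have R20 : 0 < r%:R - 2 :> rat by lra.
have -> : r%:R - 3 = (r%:R - 2) * (1 - (r%:R - 2)^-1) :> rat.
  by rewrite mulrBr mulfV ?lt0r_neq0 //; ring.
by rewrite -mulrA; apply: ler_wpM2l sp; lra.
Qed.

Lemma sum_core x (b : rat) : x \in off q L -> (forall i, n i <= b) ->
  \sum_(j | core q L x j) n j <= (r%:R - 2) * b.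
Proof.
move=> xo nb; have b0 : 0 <= b.
  by apply: le_trans (nb (Ordinal (ltn_trans (ltn0Sn _) (ltnW r2)))); exact: ler0n.
apply: le_trans (_ : \sum_(j | core q L x j) b <= _); first by apply: ler_sum.
rewrite sumr_const -[leLHS]mulr_natl -(natrB _ (ltnW r2)).
by apply: (ler_wpM2r b0); rewrite ler_nat; exact: (card_core r2 fr xo).
Qed.

Lemma tdeg_circle_rat i x : x \in circle q L i ->
  (tdeg S x)%:R <= (spread q L (fun j => j != i))%:R + 6 * (\sum_(j | j != i) n j) + 2 +
    2 * #|off q L|%:R * #|V|%:R :> rat.
Proof.
move=> xi; have := tdeg_circle fr xi; rewrite -(ler_nat rat) => T1.
rewrite natrD (natrD _ (spread _ _ _ + _)%N) (natrD _ (spread _ _ _)) in T1.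
by rewrite (natrM _ 6) (natrM _ (2 * _)%N) (natrM _ 2) natr_sum in T1.
Qed.

Lemma tdeg_off_rat x : x \in off q L ->
  (tdeg S x)%:R <= (spread q L (core q L x))%:R + (4 * r%:R + 2) * #|V|%:R +
    2 * #|off q L|%:R * #|V|%:R :> rat.
Proof.
move=> xo; have := tdeg_off fr xo; rewrite -(ler_nat rat) => T1.
rewrite natrD (natrD _ (spread _ _ _)) in T1.
by rewrite (natrM _ (4 * r + 2)%N) (natrD _ (4 * r)%N) (natrM _ 4) (natrM _ (2 * _)%N) (natrM _ 2) in T1.
Qed.

Lemma all_on_circles (e : rat) : 1200 * e = r%:R^-1 ^+ 2 -> 10 <= #|V|%:R * e ->
  40 * (r%:R + 1) <= r%:R^-1 * #|V|%:R :> rat ->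
  (forall x, density r * #|V|%:R ^+ 2 - 2 * #|V|%:R <= (tdeg S x)%:R) ->
  #|off q L|%:R <= 32 * e * #|V|%:R -> off q L = set0.
Proof.
have [h0 h1] := inv_r_bounds r2; have [r3 rh _] := inv_r_facts r2.
have dE : density r = (1 - r%:R^-1) * (1 - 2 * r%:R^-1) by [].
have so := sum_others; have sp := spread_others.
have T1 := tdeg_circle_rat; have T2 := tdeg_off_rat.
have c0 := spread_core; have c1 := sum_core.
have s0 (P : pred 'I_r) : 0 <= \sum_(j | P j) n j by apply: sumr_ge0 => j _; exact: ler0n.
have V0 := ler0n rat #|V|.
have n0 i : #|circle q L i| = 0%N -> n i = 0 by move=> ->.
rewrite dE; set h := r%:R^-1 in h0 h1 rh sp *; set m := #|V|%:R in so T1 T2 V0 *.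
move=> eh me hm Hdeg Foff.
have hh : h * (3 * h) <= h * 1 by apply: ler_wpM2l h1; apply: ltW.
have hh0 : 0 < h ^+ 2 by apply: exprn_gt0.
have e0 : 0 < e by lra.
have e1 : 400 * e <= 1 by lra.
have m0 : 0 < m.
  rewrite lt_neqAle V0 andbT; apply/eqP => m0; rewrite -m0 mul0r in me; lra.
have be : 0 <= h + 130 * e by lra.
have bal i : n i <= (h + 130 * e) * m.
  have [z|/card_gt0P[x xi]] := posnP #|circle q L i|.
    by rewrite (n0 i z); apply: mulr_ge0 be V0.
  apply: (balanced h0 h1 e0 e1 m0 me (s0 _) (so i) Foff (sp i)).
  apply: le_trans (Hdeg x) _; apply: le_trans (T1 i x xi) _.
  rewrite lerD2r lerD2r lerD2l; apply: ler_wpM2l; first exact: ler0n.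
  by apply: le_trans (so i) _; rewrite gerBl; exact: ler0n.
apply/eqP; apply: contraT => /set0Pn[x xo].
have := off_degree_small r3 rh h0 eh m0 hm Foff (s0 _) (c1 _ _ xo bal) (c0 _ xo).
by move=> /(le_lt_trans (le_trans (Hdeg x) (T2 x xo))); rewrite ltxx.
Qed.

(** Maclaurin's inequality for the pairs on three circles and Cauchy-Schwarz for
    the pairs on two circles say that equal circles are best. *)
Lemma count_on_circles : off q L = set0 ->
  (\sum_x tdeg S x)%N%:R <= density r * #|V|%:R ^+ 3 +
    6 * (1 - r%:R^-1) * #|V|%:R ^+ 2 + 2 * #|V|%:R.
Proof.
move=> off0.
have mE : \sum_i n i = #|V|%:R.
  by rewrite -natr_sum -[#|V|](sum_circles fr) off0 cards0 addn0.
have H : (\sum_x tdeg S x <= \sum_i #|circle q L i| *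
    (spread q L (fun j => j != i) + 6 * (\sum_(j | j != i) #|circle q L j|) + 2))%N.
  apply: (@leq_trans (\sum_x \sum_i (x \in circle q L i) * tdeg S x)%N).
    apply: leq_sum => x _; have : x \notin off q L by rewrite off0 inE.
    by case/circleI => i xi; rewrite (bigD1 i) //= xi mul1n leq_addr.
  rewrite exchange_big; apply: leq_sum => i _ /=.
  rewrite card_in big_distrl; apply: leq_sum => x _ /=.
  case: (boolP (x \in circle q L i)) => [xi|]; last by rewrite !mul0n.
  rewrite !mul1n; apply: leq_trans (tdeg_circle fr xi) _.
  by rewrite off0 cards0 muln0 mul0n addn0.
move: H; rewrite -(ler_nat rat) => H; apply: le_trans H _.
have -> : (\sum_i #|circle q L i| *
    (spread q L (fun j => j != i) + 6 * (\sum_(j | j != i) #|circle q L j|) + 2))%N%:R =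
  (\sum_i \sum_(j | j != i) \sum_(k | (k != i) && (k != j)) n i * n j * n k) +
  6 * (\sum_i \sum_(j | j != i) n i * n j) + 2 * (\sum_i n i).
  rewrite natr_sum !big_distrr /= -!big_split /=; apply: eq_bigr => i _.
  rewrite natrM natrD natrD (natrM _ 6) natr_sum natr_sum !mulrDr.
  congr (_ + _ + _); last by ring.
    rewrite big_distrr; apply: eq_bigr => j _ /=; rewrite natr_sum big_distrr.
    by apply: eq_bigr => k _ /=; rewrite natrM mulrA.
  by rewrite mulrCA big_distrr.
rewrite mE lerD2r; apply: lerD.
  by have := @maclaurin3 r (fun i => n i) r2 (fun i => ler0n _ _); rewrite mE.
rewrite -mulrA; apply: ler_wpM2l => //.
have := @sum_pairs_le _ (fun i => n i) predT r; rewrite mE; apply.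
  by rewrite cardT -cardE card_ord.
exact: ltnW (ltnW r2).
Qed.
End OnCircles.

Lemma dense_tdeg_bound (r : nat) : (2 < r)%N ->
  exists N : nat, forall (R : realType) (V : finType) (p : V -> 'rV[R]_(2 * r)),
    injective p -> (N <= #|V|)%N ->
    (forall x, density r * #|V|%:R ^+ 2 - 2 * #|V|%:R <= (tdeg (dist2 p) x)%:R) ->
    (\sum_x tdeg (dist2 p) x)%N%:R <= density r * #|V|%:R ^+ 3 +
      6 * (1 - r%:R^-1) * #|V|%:R ^+ 2 + 2 * #|V|%:R.
Proof.
move=> r2; have [h0 h1] := inv_r_bounds r2.
set h := r%:R^-1 in h0 h1 *.
have [e [eh e0 e36]] := pick_scale h0 h1.
have [N NP] := near_structure r2 e0 e36.
have [M1 M1P] := eventually_large 10 e0.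
have [M2 M2P] := eventually_large (40 * (r%:R + 1)) h0.
exists (N + M1 + M2)%N => R V p pinj NV Hdeg.
have NV1 : (N <= #|V|)%N by apply: leq_trans NV; rewrite -addnA leq_addr.
have MV1 : (M1 <= #|V|)%N by apply: leq_trans NV; rewrite addnAC leq_addl.
have MV2 : (M2 <= #|V|)%N by apply: leq_trans NV; rewrite leq_addl.
have [q [L [fr Foff]]] := NP R V p pinj NV1 Hdeg.
apply: (count_on_circles r2 fr).
apply: (all_on_circles r2 fr eh (M1P _ MV1) _ Hdeg Foff).
rewrite [leRHS]mulrC; exact: M2P _ MV2.
Qed.

(** * The upper bound by removal of points *)

Section TriSymmetry.
Variables (R : realType) (d : nat) (V : finType) (p : V -> 'rV[R]_d).
Hypothesis pinj : injective p.
Local Notation S := (dist2 p).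

Lemma tri_swap12 x y z : tri S x y z = tri S y x z.
Proof. by rewrite /tri eq_sym (dist2C p y x) [X in _ && X]andbC. Qed.

Lemma tri_neq13 x y z : tri S x y z -> x != z.
Proof.
move=> /and3P[xy /eqP s1 _]; apply: contra xy => /eqP xz; apply/eqP.
by apply: (dist2_eq0 pinj); rewrite s1 xz; apply/eqP; rewrite sqd_eq0.
Qed.

Lemma tri_swap23 x y z : tri S x y z = tri S x z y.
Proof.
have imp a b c : tri S a b c -> tri S a c b.
  move=> t; have ac := tri_neq13 t; case/and3P: t => [_ /eqP s1 /eqP s2].
  by apply/and3P; split; rewrite // ?(dist2C p c b) -?s1 -?s2.
by apply/idP/idP; exact: imp.
Qed.

Lemma trixx x z : tri S x x z = false.
Proof. by rewrite /tri eqxx. Qed.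
End TriSymmetry.

(** A triangle through v is counted at each of its three vertices. *)
Lemma tdeg_remove (R : realType) (d n : nat) (p : 'I_n.+1 -> 'rV[R]_d) (v : 'I_n.+1) :
  injective p ->
  (\sum_x tdeg (dist2 p) x =
    \sum_x tdeg (dist2 (p \o lift v)) x + 3 * tdeg (dist2 p) v)%N.
Proof.
move=> pinj; set g := fun x y z => nat_of_bool (tri (dist2 p) x y z).
rewrite (bigD1_ord v) //= addnC.
have E x : tdeg (dist2 p) (lift v x) = (\sum_z g (lift v x) v z +
    (\sum_y g (lift v x) (lift v y) v + \sum_y \sum_z g (lift v x) (lift v y) (lift v z)))%N.
  rewrite /tdeg (bigD1_ord v) //=; congr (_ + _)%N; rewrite -big_split.
  by apply: eq_bigr => y _; rewrite (bigD1_ord v).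
rewrite (eq_bigr _ (fun x _ => E x)) !big_split /=.
have E1 : (\sum_(x < n) \sum_z g (lift v x) v z = tdeg (dist2 p) v)%N.
  rewrite /tdeg [RHS](bigD1_ord v) //= [X in (X + _)%N]big1 => [|z _]; last by rewrite trixx.
  by rewrite add0n; apply: eq_bigr => x _; apply: eq_bigr => z _; rewrite /g tri_swap12.
have E2 : (\sum_(x < n) \sum_(y < n) g (lift v x) (lift v y) v = tdeg (dist2 p) v)%N.
  rewrite -E1; apply: eq_bigr => x _; rewrite [RHS](bigD1_ord v) //= /g.
  rewrite tri_swap12 tri_swap23 // trixx add0n.
  by apply: eq_bigr => y _; rewrite tri_swap23.
have -> : (\sum_x tdeg (dist2 (p \o lift v)) x =
    \sum_(x < n) \sum_y \sum_z g (lift v x) (lift v y) (lift v z))%N.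
  apply: eq_bigr => x _; apply: eq_bigr => y _; apply: eq_bigr => z _.
  by rewrite /g /tri (inj_eq lift_inj).
rewrite E1 E2; ring.
Qed.

Lemma sum_tdeg_le (R : realType) (d : nat) (V : finType) (p : V -> 'rV[R]_d) :
  (\sum_x tdeg (dist2 p) x <= #|V| ^ 3)%N.
Proof.
rewrite expnS -sum_nat_const; apply: leq_sum => x _.
rewrite expnS expn1 -sum_nat_const; apply: leq_sum => y _.
by rewrite -[leqRHS]sum1_card; apply: leq_sum => z _; case: (tri _ x y z).
Qed.

(** Six times the value in the theorem, as a polynomial defined for all n,
    because the induction passes through sizes not divisible by 12 r. *)
Definition ordered_bound (r n : nat) : rat :=
  density r * n%:R ^+ 3 + 6 * (1 - r%:R^-1) * n%:R ^+ 2 + 2 * n%:R.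

Lemma ordered_bound_step (F : realFieldType) (dens c m D : F) :
  0 <= c -> dens <= 1 -> 0 <= m -> D <= dens * (m + 1) ^+ 2 - 2 * (m + 1) ->
  dens * m ^+ 3 + 6 * c * m ^+ 2 + 2 * m + 3 * D + 1 <=
    dens * (m + 1) ^+ 3 + 6 * c * (m + 1) ^+ 2 + 2 * (m + 1).
Proof.
move=> c0 d1 m0 H.
have cm : 0 <= c * m by apply: mulr_ge0.
have dm : dens * m <= m by apply: ler_piMl.
lra.
Qed.

(** If some degree is small, removing the point increases the surplus over
    ordered_bound by at least 1; otherwise there is no surplus. Since the
    surplus at N points is at most N^3, it has disappeared at N + N^3 points. *)
Lemma ordered_upper (r : nat) : (2 < r)%N -> exists N : nat,
  forall (R : realType) n (p : 'I_n -> 'rV[R]_(2 * r)), (N <= n)%N -> injective p ->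
    (\sum_x tdeg (dist2 p) x)%N%:R <= ordered_bound r n.
Proof.
move=> r2; have [N NP] := dense_tdeg_bound r2.
have [h0 h1] := inv_r_bounds r2.
have d0 : 0 <= density r by apply: mulr_ge0; lra.
have d1 : density r <= 1.
  rewrite /density; have : 0 <= r%:R^-1 * (3 - 2 * r%:R^-1) :> rat by apply: mulr_ge0; lra.
  lra.
have c0 : 0 <= 1 - r%:R^-1 :> rat by lra.
pose B := (N ^ 3)%N.
have bound0 n : 0 <= ordered_bound r n.
  have n0 := ler0n rat n.
  by apply: addr_ge0; [apply: addr_ge0|]; apply: mulr_ge0 => //;
    [exact: exprn_ge0|apply: mulr_ge0|exact: exprn_ge0].
have incr n (D : rat) : D <= density r * n.+1%:R ^+ 2 - 2 * n.+1%:R ->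
    ordered_bound r n + 3 * D + 1 <= ordered_bound r n.+1.
  by rewrite /ordered_bound -natr1; apply: ordered_bound_step.
have main (R : realType) j (p : 'I_(j + N) -> 'rV[R]_(2 * r)) : injective p ->
    (\sum_x tdeg (dist2 p) x)%N%:R <= ordered_bound r (j + N) \/
    (\sum_x tdeg (dist2 p) x)%N%:R + j%:R <= ordered_bound r (j + N) + B%:R.
  elim: j p => [|j IH] p pinj.
    right; rewrite addr0; apply: le_trans (_ : B%:R <= _); last by rewrite lerDr bound0.
    by rewrite ler_nat; have := sum_tdeg_le p; rewrite card_ord.
  case: (pickP (fun v => (tdeg (dist2 p) v)%:R <=
      density r * (j + N).+1%:R ^+ 2 - 2 * (j + N).+1%:R)) => [v Hv|no]; last first.
    left; have := NP R 'I_(j.+1 + N) p pinj; rewrite card_ord; apply; first exact: leq_addl.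
    by move=> x; have := no x => /negbT; rewrite -ltNge => /ltW.
  have qinj : injective (p \o lift v) by move=> x y /pinj/lift_inj.
  have step : ordered_bound r (j + N) + 3 * (tdeg (dist2 p) v)%:R + 1 <=
      ordered_bound r (j.+1 + N) by exact: incr.
  rewrite (tdeg_remove v pinj) natrD natrM -[j.+1%:R]natr1.
  set W := (\sum_x tdeg _ x)%N%:R; set D := (tdeg _ v)%:R in step *.
  by case: (IH _ qinj); rewrite -/W => H; [left|right]; lra.
exists (N + B)%N => R n p Nn.
have [j Ej] : exists j, n = (j + N)%N.
  by exists (n - N)%N; rewrite subnK // (leq_trans _ Nn) // leq_addr.
subst n; move=> pinj; case: (main R j p pinj) => // H.
have jB : B%:R <= j%:R :> rat by rewrite ler_nat; rewrite addnC leq_add2r in Nn.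
lra.
Qed.

(** * Twelfth roots of unity and disjoint orbits *)

From mathcomp Require Import complex.

Section TwelfthRoot.
Local Open Scope complex_scope.
Variable R : realType.

Definition nsq (z : R[i]) : R := complex.Re z ^+ 2 + complex.Im z ^+ 2.

Lemma nsqM (x y : R[i]) : nsq (x * y) = nsq x * nsq y.
Proof. by case: x => a b; case: y => c d; rewrite /nsq /=; ring. Qed.

Definition w12 : R[i] := (Num.sqrt 3 / 2) +i* (1 / 2).

Lemma sqrt3 : Num.sqrt 3 * Num.sqrt 3 = 3 :> R.
Proof. by rewrite -expr2 sqr_sqrtr. Qed.

Lemma w12_3 : w12 ^+ 3 = 0 +i* 1.
Proof.
rewrite /w12 !exprS expr0 mulr1; apply/eqP; rewrite eq_complex /=.
have s := sqrt3; set a := Num.sqrt 3 in s *.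
have a3 : a * (a * a) = 3 * a by rewrite s mulrC.
by apply/andP; split; apply/eqP; lra.
Qed.

Lemma w12_4 : w12 ^+ 4 = (- (1 / 2)) +i* (Num.sqrt 3 / 2).
Proof.
rewrite exprS w12_3 /w12; apply/eqP; rewrite eq_complex /=.
by apply/andP; split; apply/eqP; ring.
Qed.

Lemma w12_6 : w12 ^+ 6 = -1.
Proof.
rewrite (exprD _ 3 3) w12_3; apply/eqP; rewrite eq_complex /=.
by apply/andP; split; apply/eqP; ring.
Qed.

Lemma w12_12 : w12 ^+ 12 = 1.
Proof. by rewrite (exprD _ 6 6) w12_6 mulrNN mulr1. Qed.

Lemma nsq_w12 : nsq w12 = 1.
Proof.
rewrite /nsq /= !expr2; have s := sqrt3; lra.
Qed.

Lemma nsqX (n : nat) : nsq (w12 ^+ n) = 1.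
Proof.
by elim: n => [|n IH]; rewrite ?exprS ?nsqM ?IH ?nsq_w12 ?mulr1 // /nsq /=; ring.
Qed.

(** Otherwise some multiple of s is 4 or 6 modulo 12, while w12^4 and w12^6
    differ from 1. *)
Lemma w12_order (s : nat) : (s < 12)%N -> w12 ^+ s = 1 -> s = 0%N.
Proof.
move=> s12 ws.
have n6 : w12 ^+ 6 != 1.
  by rewrite w12_6 eq_sym -subr_eq0 opprK -mulr2n pnatr_eq0.
have n4 : w12 ^+ 4 != 1.
  rewrite w12_4 eq_complex /=; apply/negP => /andP[/eqP H _].
  by clear ws n6; lra.
have X (k : nat) : w12 ^+ ((s * k) %% 12) = 1 by rewrite (expr_mod _ w12_12) exprM ws expr1n.
have F6 (k : nat) : ((s * k) %% 12 = 6)%N -> s = 0%N.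
  by move=> E; have := X k; rewrite E => /eqP; rewrite (negPf n6).
have F4 (k : nat) : ((s * k) %% 12 = 4)%N -> s = 0%N.
  by move=> E; have := X k; rewrite E => /eqP; rewrite (negPf n4).
move: s12 F6 F4; clear X ws; case: s => [//|[|[|[|[|[|[|[|[|[|[|[|s]]]]]]]]]]]] // _ F6 F4.
- by have := F6 6%N erefl.
- by have := F6 3%N erefl.
- by have := F6 2%N erefl.
- by have := F4 1%N erefl.
- by have := F6 6%N erefl.
- by have := F6 1%N erefl.
- by have := F6 6%N erefl.
- by have := F4 2%N erefl.
- by have := F6 2%N erefl.
- by have := F6 3%N erefl.
- by have := F6 6%N erefl.
Qed.

Lemma w12_inj (s t : nat) : (s < 12)%N -> (t < 12)%N -> w12 ^+ s = w12 ^+ t -> s = t.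
Proof.
wlog st : s t / (s <= t)%N.
  by move=> H s12 t12 E; case: (leqP s t) => [st|/ltnW ts]; [apply: H|symmetry; apply: H].
move=> s12 t12 E.
have w0 : w12 ^+ s != 0.
  by apply/eqP => w0; have := nsqX s; rewrite w0 /nsq /= expr0n /= addr0 => /eqP;
     rewrite eq_sym oner_eq0.
suff : (t - s)%N = 0%N by lia.
apply: w12_order; first by lia.
by apply: (mulfI w0); rewrite mulr1 -exprD subnKC.
Qed.

(** The rational parametrization of the unit circle, a source of infinitely many
    points. *)
Definition upoint (k : nat) : R[i] :=
  ((1 - k%:R ^+ 2) / (1 + k%:R ^+ 2)) +i* ((2 * k%:R) / (1 + k%:R ^+ 2)).

Lemma upoint_den (k : nat) : 1 + k%:R ^+ 2 != 0 :> R.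
Proof. by rewrite gt_eqF // ltr_wpDr ?sqr_ge0. Qed.

Lemma nsq_upoint k : nsq (upoint k) = 1.
Proof. by rewrite /nsq /upoint /=; field; exact: upoint_den. Qed.

Lemma upoint_inj : injective upoint.
Proof.
move=> k l [E1 E2].
have den n : 1 + (1 - n%:R ^+ 2) / (1 + n%:R ^+ 2) = 2 / (1 + n%:R ^+ 2) :> R.
  by field; exact: upoint_den.
have E3 : 2 / (1 + k%:R ^+ 2) = 2 / (1 + l%:R ^+ 2) :> R by rewrite -!den E1.
have E4 : k%:R * (2 / (1 + k%:R ^+ 2)) = l%:R * (2 / (1 + l%:R ^+ 2)) :> R.
  by rewrite !mulrA ![_ * 2]mulrC.
rewrite E3 in E4; apply/eqP; rewrite -(eqr_nat R); apply/eqP.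
apply: (mulIf _ E4); apply: mulf_neq0; first by rewrite pnatr_eq0.
by rewrite invr_eq0 upoint_den.
Qed.

Lemma fresh_upoint (us : seq R[i]) : exists k, upoint k \notin us.
Proof.
case: (pickP (fun k : 'I_(size us).+1 => upoint k \notin us)) => [k kP|no]; first by exists k.
have : (size [seq upoint k | k <- iota 0 (size us).+1] <= size us)%N.
  apply: uniq_leq_size; first by rewrite map_inj_uniq ?iota_uniq //; exact: upoint_inj.
  move=> z /mapP[k]; rewrite mem_iota add0n /= => kP ->.
  by have /negbT := no (Ordinal kP); rewrite negbK.
by rewrite size_map size_iota ltnn.
Qed.

(** Choose the points one after the other, each outside the finitely many orbits
    already used. *)
Lemma disjoint_orbits (h : nat) : exists z : 'I_h -> R[i], (forall j, nsq (z j) = 1) /\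
  injective (fun a : 'I_h * 'I_12 => w12 ^+ a.2 * z a.1).
Proof.
elim: h => [|h [z [z1 zi]]].
  by exists (fun=> 0); split=> [[]//|[[]]//].
pose us := [seq (fun a : 'I_h * 'I_12 => w12 ^+ a.2 * z a.1) a | a <- enum {: 'I_h * 'I_12}].
have [k kP] := fresh_upoint us.
pose z' (j : 'I_h.+1) := if unlift ord_max j is Some j' then z j' else upoint k.
have zn0 (j : 'I_h.+1) : z' j != 0.
  have n1 : nsq (z' j) = 1 by rewrite /z'; case: unliftP => *; rewrite ?z1 ?nsq_upoint.
  apply/eqP => E; move: n1; rewrite E /nsq /= expr0n /= addr0 => /eqP.
  by rewrite eq_sym oner_eq0.
have newold (s t : 'I_12) j : w12 ^+ s * upoint k <> w12 ^+ t * z j.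
  move=> E; case/negP: kP; apply/mapP.
  (* multiply by the inverse 12 - s of the turn s *)
  exists (j, inZp (12 - s + t) : 'I_12); first by rewrite mem_enum.
  rewrite /= (expr_mod _ w12_12) exprD -mulrA -E mulrA -exprD subnK ?(ltnW (ltn_ord s)) //.
  by rewrite w12_12 mul1r.
exists z'; split=> [j|[i s] [j t]] /=.
  by rewrite /z'; case: unliftP => *; rewrite ?z1 ?nsq_upoint.
have [<-|ij] := eqVneq i j.
  move=> /(mulIf (zn0 i)) E; congr (_, _); apply: val_inj.
  exact: w12_inj (ltn_ord s) (ltn_ord t) E.
rewrite /z'; case: unliftP ij => [i' ->|->]; case: unliftP => [j' ->|->].
- by move=> _ E; have [-> ->] := zi (i', s) (j', t) E.
- by move=> _ /esym/newold.
- by move=> _ /newold.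
- by rewrite eqxx.
Qed.

End TwelfthRoot.

(** * The Lenz configuration of regular 12-gons *)

Lemma sum_even_odd (M : nmodType) (f : nat -> M) (r : nat) :
  \sum_(k < 2 * r) f k = \sum_(i < r) (f (2 * i)%N + f (2 * i).+1).
Proof.
elim: r => [|r IH]; first by rewrite muln0 !big_ord0.
rewrite [RHS]big_ord_recr /= -IH -!(big_mkord predT f) mulnS addnC addn2.
by rewrite big_nat_recr //= big_nat_recr //= addrA.
Qed.

Section LenzConfiguration.
Local Open Scope complex_scope.
Variables (R : realType) (r h : nat).
Variable z : 'I_h -> R[i].
Hypothesis z1 : forall j, nsq (z j) = 1.
Hypothesis zinj : injective (fun a : 'I_h * 'I_12 => w12 R ^+ a.2 * z a.1).

Definition lenz_index : finType := ('I_r * ('I_h * 'I_12))%type.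
Definition rim (a : 'I_h * 'I_12) := w12 R ^+ a.2 * z a.1.
(** Coordinates 2 i and 2 i + 1 carry the i-th plane. *)
Definition lenz_point (x : lenz_index) : 'rV[R]_(2 * r) :=
  \row_k (if (k./2 == x.1 :> nat)%N
          then if odd k then complex.Im (rim x.2) else complex.Re (rim x.2) else 0).

Lemma nsq_rim a : nsq (rim a) = 1.
Proof. by rewrite /rim nsqM nsqX z1 mulr1. Qed.

Lemma sqd_lenz x y : sqd (lenz_point x) (lenz_point y) =
  if x.1 == y.1 then nsq (rim x.2 - rim y.2) else 2.
Proof.
pose f (x : lenz_index) (k : nat) := if (k./2 == x.1 :> nat)%N
  then if odd k then complex.Im (rim x.2) else complex.Re (rim x.2) else 0.
have -> : sqd (lenz_point x) (lenz_point y) = \sum_(k < 2 * r) (f x k - f y k) ^+ 2.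
  by apply: eq_bigr => k _; rewrite !mxE.
rewrite (sum_even_odd (fun k => (f x k - f y k) ^+ 2)).
have fE u (i : 'I_r) : f u (2 * i)%N = (if i == u.1 then complex.Re (rim u.2) else 0) /\
    f u (2 * i).+1 = (if i == u.1 then complex.Im (rim u.2) else 0).
  by rewrite /f /= mul2n odd_double doubleK uphalf_double.
have fE1 u i := proj1 (fE u i); have fE2 u i := proj2 (fE u i).
under eq_bigr do rewrite !fE1 !fE2.
have [xy|xy] := eqVneq x.1 y.1.
  rewrite (bigD1 x.1) //= -xy eqxx big1 ?addr0; last first.
    by move=> i /negPf ix; rewrite ix subrr expr0n addr0.
  by rewrite /nsq; case: (rim x.2) => a b; case: (rim y.2).
rewrite (bigD1 x.1) //= (bigD1 y.1) /=; last by rewrite eq_sym.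
rewrite !eqxx (negPf xy) eq_sym (negPf xy) big1 ?addr0 => [|i /andP[/negPf ix /negPf iy]]; last first.
  by rewrite ix iy subrr expr0n addr0.
rewrite !subr0 !sub0r !sqrrN.
have n1 := nsq_rim x.2; have n2 := nsq_rim y.2.
rewrite -[X in X + _ = _]/(nsq (rim x.2)) -[X in _ + X = _]/(nsq (rim y.2)) n1 n2.
by rewrite -[RHS]/(1 + 1).
Qed.

Lemma lenz_point_inj : injective lenz_point.
Proof.
move=> x y E; have : sqd (lenz_point x) (lenz_point y) == 0 by rewrite sqd_eq0 E.
rewrite sqd_lenz; have [xy|_] := eqVneq x.1 y.1; last by rewrite pnatr_eq0.
move=> /eqP n0.
have /eqP : rim x.2 - rim y.2 = 0.
  move: n0; case: (rim x.2 - rim y.2) => a b; rewrite /nsq /= => /eqP.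
  by rewrite paddr_eq0 ?sqr_ge0 // !sqrf_eq0 => /andP[/eqP-> /eqP->].
rewrite subr_eq0 => /eqP/zinj xy2.
by case: x y xy xy2 {E n0} => [i a] [j b] /= -> ->.
Qed.

Local Notation S := (dist2 lenz_point).

Lemma lenz_cross x y : x.1 != y.1 -> S x y = 2.
Proof. by move=> /negPf xy; rewrite /dist2 sqd_lenz xy. Qed.

(** Rotation by t times 30 degrees. *)
Definition turn (t : 'I_12) (a : 'I_h * 'I_12) : 'I_h * 'I_12 := (a.1, (a.2 + t)%R).

Lemma rim_turn t a : rim (turn t a) = w12 R ^+ t * rim a.
Proof.
by rewrite /rim /turn /= mulrA -exprD addnC (expr_mod _ (w12_12 R)).
Qed.

Lemma lenz_turn i a t : S (i, a) (i, turn t a) = nsq (w12 R ^+ t - 1).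
Proof.
rewrite /dist2 sqd_lenz eqxx /= rim_turn -{1}[rim a]mul1r -mulrBl nsqM nsq_rim mulr1.
by case: (w12 R ^+ t) => u v; rewrite /nsq /=; ring.
Qed.

Definition i3 : 'I_12 := inZp 3.
Definition i4 : 'I_12 := inZp 4.
Definition i8 : 'I_12 := inZp 8.
Definition i9 : 'I_12 := inZp 9.

Lemma chord3 : nsq (w12 R ^+ i3 - 1) = 2.
Proof. by rewrite w12_3 /nsq /=; ring. Qed.
Lemma chord9 : nsq (w12 R ^+ i9 - 1) = 2.
Proof. by rewrite (exprD _ 6 3) w12_6 w12_3 /nsq /=; ring. Qed.
Lemma chord4 : nsq (w12 R ^+ i4 - 1) = 3.
Proof.
rewrite w12_4 /nsq /=; have s := @sqrt3 R; set a := Num.sqrt 3 in s *; lra.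
Qed.
Lemma chord8 : nsq (w12 R ^+ i8 - 1) = 3.
Proof.
rewrite (exprD _ 6 2) w12_6 mulN1r expr2 /w12 /nsq /=.
have s := @sqrt3 R; set a := Num.sqrt 3 in s *.
have a4 : a * a * (a * a) = 9 by rewrite s; ring.
lra.
Qed.

Lemma lenz3 i a : S (i, a) (i, turn i3 a) = 2.
Proof. by rewrite lenz_turn chord3. Qed.
Lemma lenz9 i a : S (i, a) (i, turn i9 a) = 2.
Proof. by rewrite lenz_turn chord9. Qed.
Lemma lenz4 i a : S (i, a) (i, turn i4 a) = 3.
Proof. by rewrite lenz_turn chord4. Qed.
Lemma lenz8 i a : S (i, a) (i, turn i8 a) = 3.
Proof. by rewrite lenz_turn chord8. Qed.

Lemma turn_neq t u a : t != u -> turn t a != turn u a.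
Proof. by move=> tu; rewrite xpair_eqE eqxx /= (inj_eq (addrI _)). Qed.

Local Open Scope nat_scope.

Lemma two_witnesses (T : finType) (P : pred T) (a b : T) : a != b -> P a -> P b ->
  2 <= \sum_x P x.
Proof.
move=> ab Pa Pb; rewrite -card_sum.
have <- : #|[set a; b]| = 2 by rewrite cards2 ab.
by apply: subset_leq_card; apply/subsetP => x; rewrite !inE => /orP[]/eqP->.
Qed.

Lemma quarter_turns x i : i = x.1 -> 2 <= \sum_a (S x (i, a) == 2%R).
Proof.
case: x => j b /= ->; apply: (@two_witnesses _ _ (turn i3 b) (turn i9 b)).
- exact: turn_neq.
- by rewrite lenz3.
- by rewrite lenz9.
Qed.

Lemma tri_at2 x y u : S x y = 2%R -> S x u = 2%R -> S y u = 2%R -> tri S x y u.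
Proof.
move=> s1 s2 s3; apply/and3P; rewrite s1 s2 s3; split=> //.
apply/eqP => xy; have := s1; rewrite xy /dist2 => /eqP.
have /eqP-> : sqd (lenz_point y) (lenz_point y) == 0%R by rewrite sqd_eq0.
by rewrite eq_sym pnatr_eq0.
Qed.

Local Notation k := (12 * h).

Lemma card_rim : #|{: 'I_h * 'I_12}| = k.
Proof. by rewrite card_prod !card_ord mulnC. Qed.

Lemma tdeg_lenz_split x : tdeg S x = \sum_i \sum_j \sum_a \sum_b tri S x (i, a) (j, b).
Proof.
rewrite /tdeg -(pair_bigA _ (fun i a => \sum_y tri S x (i, a) y)) /=.
apply: eq_bigr => i _; rewrite [RHS]exchange_big; apply: eq_bigr => a _ /=.
by rewrite -(pair_bigA _ (fun j b => nat_of_bool (tri S x (i, a) (j, b)))).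
Qed.

(** With k points on each circle: the pairs on two further circles; the pairs
    that form a quarter turn with two of the three vertices on one circle, in
    three ways; and the two orders of the inscribed triangle at x. *)
Lemma tdeg_lenz x : 1 < r ->
  k ^ 2 * ((r - 1) * (r - 2)) + 6 * k * (r - 1) + 2 <= tdeg S x.
Proof.
case: x => i0 a0 r1; rewrite tdeg_lenz_split; pose x : lenz_index := (i0, a0).
pose G i j := \sum_a \sum_b tri S x (i, a) (j, b).
have sumk (f : 'I_h * 'I_12 -> nat) n : (forall a, n <= f a) -> k * n <= \sum_a f a.
  by move=> H; rewrite -card_rim -sum_nat_const; apply: leq_sum.
have G1 i j : i != i0 -> j != i0 -> j != i -> k ^ 2 <= G i j.
  move=> ii jj ij; rewrite expnS expn1; apply/sumk => a; rewrite -[leqLHS]muln1; apply: (sumk (fun b => tri S x (i, a) (j, b)) 1) => b.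
  by rewrite tri_at2 // lenz_cross //= eq_sym.
have G2 j : j != i0 -> 2 * k <= G i0 j.
  move=> jj; rewrite mulnC /G exchange_big; apply: sumk => b.
  apply: leq_trans (quarter_turns (erefl x.1)) _; apply: leq_sum => a _.
  by case: eqP => // s; rewrite tri_at2 // lenz_cross //= eq_sym.
have G3 i : i != i0 -> 2 * k <= G i i0.
  move=> ii; rewrite mulnC /G; apply: sumk => a.
  apply: leq_trans (quarter_turns (erefl x.1)) _; apply: leq_sum => b _.
  by case: eqP => // s; rewrite tri_at2 // lenz_cross //= eq_sym.
have G4 i : i != i0 -> 2 * k <= G i i.
  move=> ii; rewrite mulnC /G; apply: sumk => a.
  apply: leq_trans (@quarter_turns (i, a) i erefl) _; apply: leq_sum => b _.
  by case: eqP => // s; rewrite tri_at2 // lenz_cross //= eq_sym.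
have G5 : 2 <= G i0 i0.
  rewrite /G pair_big /=.
  apply: (@two_witnesses _ (fun c => tri S x (i0, c.1) (i0, c.2))
    (turn i4 a0, turn i8 a0) (turn i8 a0, turn i4 a0)).
  - by rewrite xpair_eqE negb_and turn_neq.
  - have s1 := lenz4 i0 a0; have s2 := lenz8 i0 a0; have s3 := lenz4 i0 (turn i4 a0).
    have E : turn i4 (turn i4 a0) = turn i8 a0.
      by rewrite /turn /=; congr (_, _); rewrite -addrA; congr (_ + _)%R; apply: val_inj.
    rewrite E in s3; apply/and3P; split; rewrite ?s1 ?s2 ?s3 ?eqxx //.
    by apply: contra_eq_neq s1 => <-; rewrite /dist2 eq_sym (_ : sqd _ _ = 0%R) ?pnatr_eq0 //;
      apply/eqP; rewrite sqd_eq0.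
  - have s1 := lenz4 i0 a0; have s2 := lenz8 i0 a0; have s3 := lenz4 i0 (turn i4 a0).
    have E : turn i4 (turn i4 a0) = turn i8 a0.
      by rewrite /turn /=; congr (_, _); rewrite -addrA; congr (_ + _)%R; apply: val_inj.
    rewrite E in s3; apply/and3P; split; rewrite ?s1 ?s2 ?(dist2C lenz_point (i0, turn i8 a0)) ?s3 ?eqxx //.
    by apply: contra_eq_neq s2 => <-; rewrite /dist2 eq_sym (_ : sqd _ _ = 0%R) ?pnatr_eq0 //;
      apply/eqP; rewrite sqd_eq0.
rewrite (eq_bigr (fun i => \sum_j G i j)) // (bigD1 i0) //=.
have cI (i : 'I_r) : #|[pred j | j != i]| = r - 1 by rewrite cardC1 card_ord subn1.
have S1 : 2 + (r - 1) * (2 * k) <= \sum_j G i0 j.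
  rewrite (bigD1 i0) //=; apply: leq_add => //.
  by rewrite -(cI i0) -sum_nat_const; apply: leq_sum => j; exact: G2.
have S2 i : i != i0 -> 2 * k + (2 * k + (r - 2) * k ^ 2) <= \sum_j G i j.
  move=> ii; rewrite (bigD1 i0) //= (bigD1 i) //=; apply: leq_add; first exact: G3.
  apply: leq_add; first exact: G4.
  have <- : #|[pred j | (j != i0) && (j != i)]| = r - 2.
    have := cardC [pred j : 'I_r | (j == i0) || (j == i)].
    rewrite card_ord (eq_card (B := pred2 i0 i)) // card2 eq_sym ii /=.
    rewrite (eq_card (B := [pred j | (j != i0) && (j != i)])); last first.
      by move=> j; rewrite !inE negb_or.
    by move=> /(congr1 (subn^~ 2)); rewrite addnC addnK.
  rewrite -sum_nat_const; apply: leq_sum => j /andP[j0 ji]; exact: G1.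
apply: leq_trans (leq_add S1 (_ : (r - 1) * (2 * k + (2 * k + (r - 2) * k ^ 2)) <= _)).
  by rewrite leq_eqVlt; apply/orP; left; apply/eqP; ring.
by rewrite -(cI i0) -sum_nat_const; apply: leq_sum => i; exact: S2.
Qed.
End LenzConfiguration.

(** * The maximum *)

Lemma equidistantE (R : realType) (d : nat) (P : {fset 'rV[R]_d}) (S : {set P}) :
  equidistant S = mono (fun x : P => val x) S.
Proof.
rewrite /equidistant /mono; apply: eq_forallb => x; congr (_ ==> _).
apply: eq_forallb => y; congr (_ ==> _); apply: eq_forallb => z; congr (_ ==> _).
apply: eq_forallb => t; congr (_ ==> _); congr (_ ==> _).
by rewrite /edist eqr_sqrt //; exact: sqd_ge0.
Qed.

Lemma triangles_tdeg (R : realType) (d : nat) (P : {fset 'rV[R]_d}) :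
  (6 * #|equilateral_triangles P| = \sum_x tdeg (dist2 (fun x : P => val x)) x)%N.
Proof.
have <- : nsets (mono (fun x : P => val x)) 3 = #|equilateral_triangles P|.
  rewrite /nsets; suff -> : equilateral_triangles P =
    [set A : {set P} | (#|A| == 3)%N && mono (fun x : P => val x) A] by [].
  apply/setP => S.
  rewrite /equilateral_triangles.
  by rewrite [LHS]in_set [RHS]in_set equidistantE.
exact: sum_tdeg val_inj.
Qed.

Lemma tdeg_reindex (R : realType) (d : nat) (V W : finType) (f : V -> W)
    (p : W -> 'rV[R]_d) : bijective f ->
  (\sum_x tdeg (dist2 p) x = \sum_x tdeg (dist2 (p \o f)) x)%N.
Proof.
move=> bf; rewrite (reindex f) /=; last exact: onW_bij.
apply: eq_bigr => x _; rewrite /tdeg (reindex f) /=; last exact: onW_bij.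
apply: eq_bigr => y _; rewrite (reindex f) /=; last exact: onW_bij.
by apply: eq_bigr => z _; rewrite /tri (bij_eq bf).
Qed.

Lemma T_upper (r : nat) : (2 < r)%N -> exists N : nat, forall (R : realType) n, (N <= n)%N ->
  (6 * T R (2 * r) n)%N%:R <= ordered_bound r n.
Proof.
move=> r2; have [N NP] := ordered_upper r2; exists N => R n Nn.
have d0 : (0 < 2 * r)%N by rewrite muln_gt0 (ltnW (ltnW r2)).
have [P [Pn <-]] := T_attained R n d0.
rewrite triangles_tdeg.
have Pc : #|{: P}| = n by rewrite -cardfE.
pose f (i : 'I_n) : P := enum_val (cast_ord (esym Pc) i).
have bf : bijective f.
  apply: inj_card_bij; last by rewrite card_ord Pc.
  by move=> i j /enum_val_inj/cast_ord_inj.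
rewrite (tdeg_reindex _ bf); apply: NP => //.
by move=> i j /val_inj/(bij_inj bf).
Qed.

Lemma T_lower (R : realType) (r h : nat) : (1 < r)%N ->
  (12 * r * h * ((12 * h) ^ 2 * ((r - 1) * (r - 2)) + 6 * (12 * h) * (r - 1) + 2)
    <= 6 * T R (2 * r) (12 * r * h))%N.
Proof.
move=> r1; have [z [z1 zinj]] := disjoint_orbits R h.
pose pt := @lenz_point R r h z.
have pinj : injective pt := lenz_point_inj z1 zinj.
pose P : {fset 'rV[R]_(2 * r)} := [fset x in [seq pt v | v <- enum {: lenz_index r h}]]%fset.
have inP v : pt v \in P by rewrite in_fset; apply: map_f; rewrite mem_enum.
pose f v : P := [` inP v]%fset.
have finj : injective f by move=> u v /(congr1 val) /= /pinj.
have cV : #|{: lenz_index r h}| = (12 * r * h)%N.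
  by rewrite card_prod card_rim card_ord mulnCA mulnA.
have cP : #|` P| = (12 * r * h)%N.
  rewrite card_fseq undup_id; first by rewrite size_map -cardE cV.
  by rewrite map_inj_uniq ?enum_uniq.
have bf : bijective f by apply: inj_card_bij; rewrite // cV -cardfE cP.
apply: leq_trans (_ : 6 * #|equilateral_triangles P| <= _)%N; last first.
  by rewrite leq_mul2l T_ge.
rewrite triangles_tdeg (tdeg_reindex _ bf) -[in leqLHS]cV -sum_nat_const.
by apply: leq_sum => x _; exact: tdeg_lenz z1 _ r1.
Qed.

Theorem corollary4 (R : realType) (r : nat) (hr : (3 <= r)%N) :
  exists N : nat, forall n : nat, (N <= n)%N -> (12 * r %| n)%N ->
    (T R (2 * r) n)%:R =
      'C(r, 3)%:R * (n%:R / r%:R) ^+ 3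
      + (r%:R - 1) * n%:R ^+ 2 / r%:R + n%:R / 3%:R :> rat.
Proof.
have [N NP] := T_upper hr; exists N => n Nn /dvdnP[h En].
have up := NP R n Nn.
have low := T_lower R h (ltnW hr).
rewrite (_ : 12 * r * h = n)%N in low; last by rewrite En mulnC.
have r0 : r%:R != 0 :> rat by rewrite pnatr_eq0 -lt0n (ltnW (ltnW hr)).
have nE : n%:R = 12%:R * r%:R * h%:R :> rat by rewrite En mulnC !natrM.
have cE : 6%:R * 'C(r, 3)%:R = r%:R * (r%:R - 1) * (r%:R - 2) :> rat.
  rewrite -natrM mulnC (bin_ffact r 3) !ffactnSr ffactn0 mul1n subn0 !natrM.
  by rewrite (natrB _ (ltnW (ltnW hr))) (natrB _ (ltnW hr)).
have T6 : 6 * (T R (2 * r) n)%:R = ordered_bound r n.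
  apply/eqP; rewrite eq_le -[X in X <= _](natrM _ 6) up /=.
  rewrite -[X in _ <= X](natrM _ 6); move: low; rewrite -(ler_nat rat); apply: le_trans.
  rewrite le_eqVlt; apply/orP; left; apply/eqP.
  rewrite natrM (natrD _ (_ + _)%N) (natrD _ (_ ^ 2 * _)%N) natrM natrX natrM.
  rewrite (natrM _ (r - 1)%N) (natrM _ (6 * _)%N) (natrM _ 6) (natrM _ 12 h).
  rewrite (natrB _ (ltnW (ltnW hr))) (natrB _ (ltnW hr)).
  rewrite /ordered_bound /density nE; field; exact: r0.
apply: (mulfI (_ : 6 != 0 :> rat)); first by rewrite pnatr_eq0.
rewrite T6 /ordered_bound /density !mulrDr [6 * ('C(r, 3)%:R * _)]mulrA cE.
by field; exact: r0.
Qed.
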